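(* (1) Every t-diagram $X$ has a characteristic tree, unique up to simultaneous reversal of the cyclic orders at all vertices: if $(G,\varphi)$ and $(G',\varphi')$ are characteristic trees of $X$, there is a graph isomorphism $\psi:G\to G'$ with $\psi\circ\varphi=\varphi'$ which either preserves the cyclic order at every degree-3 vertex or reverses it at every degree-3 vertex. (2) For every $d\ge 0$ and every 3-tree $G$ with $2d+4$ vertices there exists a t-diagram for which $G$ is a characteristic tree (for a suitable bijection), and this t-diagram is unique up to equivalence by diagonals.
   Context: A t-diagram is a set $X$ of $2d+4$ black and white points in the plane ($d\ge 0$) such that: the points are in general position; exactly $d+3$ are black and in convex position; no white point lies outside the convex hull of the black points; every triangle with black vertices contains exactly one white point. The boundary of the convex hull of the black points gives an unoriented cyclic order on them. A 3-tree is a finite tree all of whose vertices have degree 1 or 3, with a cyclic order on the three edges at each degree-3 vertex; it induces a cyclic order on the leaves (walk around the tree, at each degree-3 vertex leaving along the edge following the arrival edge in its cyclic order). A characteristic tree of a t-diagram $X$ is a 3-tree $G$ with a bijection $\varphi$ from $X$ to the vertices of $G$ such that: (i) white points go to degree-3 vertices, black points to leaves; (ii) the unoriented cyclic order of leaves agrees via $\varphi$ with the unoriented cyclic order of black points; (iii) a white point $B$ lies inside the triangle with black vertices $A_i,A_j,A_k$ iff there are three paths from $\varphi(B)$ to $\varphi(A_i),\varphi(A_j),\varphi(A_k)$ pairwise sharing only $\varphi(B)$. Two t-diagrams $X,Y$ are equivalent by diagonals if there is a bijection $\varphi:X\to Y$ preserving colors and the unoriented cyclic order of black points, such that a white point $B$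 lies in the convex hull of a set of cyclically consecutive black points $\{A_i\}$ of $X$ iff $\varphi(B)$ lies in the convex hull of $\{\varphi(A_i)\}$ in $Y$. *)

(* Defs.v *)
From HB Require Import structures.
From mathcomp Require Import all_boot all_order all_algebra finmap.
From mathcomp Require Import all_classical all_reals all_analysis.

Set Implicit Arguments.
Unset Strict Implicit.
Unset Printing Implicit Defensive.

Import Order.TTheory GRing.Theory Num.Theory.
Import numFieldNormedType.Exports.

Local Open Scope classical_set_scope.
Local Open Scope ring_scope.

(** * Plane geometry *)

Definition plane (R : realType) := 'rV[R]_2.

Definition collinear (R : realType) (a b c : plane R) : Prop :=
  exists p v : plane R, v != 0 /\
    {in [:: a; b; c], forall x, exists t : R, x = p + t *: v}.

Definition conv_hull (R : realType) (A : set (plane R)) : set (plane R) :=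
  smallest (@convex_set R (plane R)) A.

Definition boundary (R : realType) (A : set (plane R)) : set (plane R) :=
  closure A `\` interior A.

(** * t-diagrams *)

Section PointHulls.
Variables (R : realType) (X : {fset plane R}).

Definition hull (A : {set X}) : set (plane R) :=
  conv_hull [set fsval x | x in [set` A]].

Definition triangle (a b c : X) : set (plane R) := hull [set a; b; c]%SET.

Definition distinct3 (a b c : X) : Prop := [/\ a != b, a != c & b != c].

End PointHulls.

(* [black] is the set of black points; all other points are white. *)
Record tdiagram (R : realType) (d : nat) := TDiagram {
  points :> {fset plane R};
  black : {set points};
  card_points : #|` points| = (2 * d + 4)%N;
  card_black : #|black| = (d + 3)%N;
  general_position : forall a b c : points, distinct3 a b c ->
    ~ collinear (fsval a) (fsval b) (fsval c);
  black_convex_position : forall a : points, a \in black ->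
    ~ hull (black :\ a)%SET (fsval a);
  white_in_hull : forall w : points, w \notin black -> hull black (fsval w);
  triangle_white : forall a b c : points,
    a \in black -> b \in black -> c \in black -> distinct3 a b c ->
    exists! w : points, w \notin black /\ triangle a b c (fsval w)
}.

Section HullCycle.
Variables (R : realType) (d : nat) (X : tdiagram R d).

(* [s] lists the black points along the boundary of their convex hull.  The
   sequences with this property are stable under rotation and reversal and form
   a single such class: the unoriented cyclic order of the black points. *)
Definition hull_cycle (s : seq X) : Prop :=
  [/\ uniq s, s =i black X &
      forall a, a \in s ->
        hull [set a; next s a]%SET `<=` boundary (hull (black X))].

(* Prefixes are enough since hull cycles are stable under rotation. *)
Definition consecutive (A : {set X}) : Prop :=
  exists (s : seq X) (k : nat),
    hull_cycle s /\ A = [set x | x \in take k s]%SET.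

End HullCycle.

(** * 3-trees *)

Definition degree (V : finType) (adj : rel V) (v : V) : nat :=
  #|[set u | adj v u]%SET|.

(* [nxt v u] is the neighbour of [v] at the end of the edge that follows the
   edge [vu] in the cyclic order at [v].  It is only meaningful when [v] has
   degree 3 and [u] is a neighbour of [v]. *)
Record three_tree := ThreeTree {
  vertex :> finType;
  adj : rel vertex;
  nxt : vertex -> vertex -> vertex;
  adj_sym : symmetric adj;
  adj_irr : irreflexive adj;
  adj_connected : forall x y, connect adj x y;
  adj_acyclic : forall c : seq vertex, ucycle adj c -> (size c <= 2)%N;
  degree13 : forall v, degree adj v = 1%N \/ degree adj v = 3%N;
  nxt_cyclic : forall v u, degree adj v = 3%N -> adj v u ->
    [/\ adj v (nxt v u), nxt v u != u & nxt v (nxt v (nxt v u)) = u]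
}.

Section ThreeTree.
Variable G : three_tree.

Definition leaf : pred G := fun v => degree (@adj G) v == 1%N.
Definition inner : pred G := fun v => degree (@adj G) v == 3%N.

(* A dart [(u, v)] is the edge [uv] traversed from [u] to [v]; at a leaf the
   walk turns back. *)
Definition walk_step (e : G * G) : G * G :=
  (e.2, if inner e.2 then nxt e.2 e.1 else e.1).

(* [s] lists the leaves in the order in which a closed walk around the tree
   visits them. *)
Definition leaf_cycle (s : seq G) : Prop :=
  exists2 e : G * G, adj e.1 e.2 &
    s = [seq f.2 | f <- orbit walk_step e & leaf f.2].

Definition simple_path (x y : G) (p : seq G) : Prop :=
  [/\ path (@adj G) x p, last x p = y & uniq (x :: p)].

Definition share_only (x : G) (p q : seq G) : Prop :=
  forall v, v \in x :: p -> v \in x :: q -> v = x.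

Definition three_paths (x a b c : G) : Prop :=
  exists p q r : seq G,
    [/\ simple_path x a p, simple_path x b q & simple_path x c r] /\
    [/\ share_only x p q, share_only x p r & share_only x q r].

End ThreeTree.

Definition graph_iso (G G' : three_tree) (psi : G -> G') : Prop :=
  bijective psi /\ forall x y, adj (psi x) (psi y) = adj x y.

Definition preserves_orders (G G' : three_tree) (psi : G -> G') : Prop :=
  forall v u, inner v -> adj v u -> psi (nxt v u) = nxt (psi v) (psi u).

Definition reverses_orders (G G' : three_tree) (psi : G -> G') : Prop :=
  forall v u, inner v -> adj v u -> nxt (psi v) (psi (nxt v u)) = psi u.

(** * Characteristic trees and equivalence by diagonals *)

(* The second clause compares unoriented cyclic orders, because hull cycles are
   stable under rotation and reversal. *)
Definition characteristic_tree (R : realType) (d : nat) (X : tdiagram R d)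
    (G : three_tree) (phi : X -> G) : Prop :=
  [/\ bijective phi,
      forall x : X, if x \in black X then leaf (phi x) else inner (phi x),
      exists2 s : seq X, hull_cycle s & leaf_cycle [seq phi x | x <- s] &
      forall w a b c : X, w \notin black X ->
        a \in black X -> b \in black X -> c \in black X -> distinct3 a b c ->
        (triangle a b c (fsval w) <->
         three_paths (phi w) (phi a) (phi b) (phi c))].

Definition equivalent_by_diagonals (R : realType) (d : nat)
    (X Y : tdiagram R d) : Prop :=
  exists phi : X -> Y,
    [/\ bijective phi,
        forall x : X, (phi x \in black Y) = (x \in black X),
        forall s : seq X, hull_cycle s -> hull_cycle [seq phi x | x <- s] &
        forall (w : X) (A : {set X}), w \notin black X -> consecutive A ->
          (hull A (fsval w) <-> hull (phi @: A)%SET (fsval (phi w)))].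

(* Main.v *)
Require Import Defs.
From mathcomp Require Import all_boot all_order all_algebra finmap.
From mathcomp Require Import all_classical all_reals all_analysis.
From mathcomp Require Import lra ring zify.

(** Rooted at a leaf [r], a 3-tree with a cyclic order at each inner vertex is a
    binary tree [T]: reading [T] from left to right gives the cyclic order of the
    leaves, and three leaves [a], [b], [c] are joined to an inner vertex [w] by
    disjoint paths iff they lie in different branches at [w], a branch being one
    of the two subtrees below [w] or the rest.  Such a tree is determined by the
    order of its leaves and their least common ancestors, and
    [lca x y] is the vertex that separates [r], [x] and [y]; this gives both
    uniqueness statements.

    For a t-diagram, root at a black point [p] and let [g x y] be the white point
    of the triangle [p x y].  The two triangulations of a quadrangle contain the
    same white points, so that, for [x < y < z], [g x z] is one of [g x y] and
    [g y z]; moreover disjoint triangles have distinct white points.  These two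
    properties make [g] the [lca] function of a binary tree.

    Conversely every binary tree is obtained by repeatedly replacing a leaf [a] by
    a vertex [w] with two leaves [a] and [b].  Geometrically one adds a black
    point [b] very close to [a] along a supporting line at [a], and a white
    point [w] very close to the midpoint of [ab] inside the polygon. *)

Set Implicit Arguments.
Unset Strict Implicit.
Unset Printing Implicit Defensive.

Import Order.TTheory GRing.Theory Num.Theory.
Import numFieldNormedType.Exports.

(** * Labelled binary trees *)

(** Disjoint paths, boundary cycles and convex hulls all have to be reduced to finite data. A vertex
    [w] separates three leaves iff their values of [br T w] differ; a white point lies in a black
    triangle iff three determinants have the same sign, and general position says that these
    determinants are nonzero. The properties of [g] concern only triangles with vertex [p]. The
    other triangles follow because [w] lies in [xyz] iff it lies in exactly one of [pxy], [pyz],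
    [pxz], and branches obey the same rule. Every white point occurs in the tree by counting: the
    [d + 2] leaves force [d + 1] distinct inner labels, which is the number of white points. In the
    converse, a triangle with only one of [a], [b] as a vertex sees the old white points as if that
    vertex were [a], while one with both contains [w] alone. General position concerns all points,
    so the new points have to avoid finitely many lines; this is why they are moved along curves
    that contain no line segment. The tree decides the equivalence by diagonals since a white point
    in the hull of some black points lies in a triangle of them. *)

Inductive bt (V : Type) := Lf of V | Nd of V & bt V & bt V.

Arguments Lf {V}.
Arguments Nd {V}.

Section BinaryTrees.
Variable V : eqType.
Implicit Types (T L R t : bt V) (u v w x y r p : V).

Definition lab T := match T with Lf v => v | Nd v _ _ => v end.

Fixpoint leaves T : seq V :=
  match T with Lf v => [:: v] | Nd _ L R => leaves L ++ leaves R end.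

Fixpoint inners T : seq V :=
  match T with Lf _ => [::] | Nd v L R => v :: inners L ++ inners R end.

Fixpoint labels T : seq V :=
  match T with Lf v => [:: v] | Nd v L R => v :: labels L ++ labels R end.

(* The branch of [T] at its inner vertex [w] that contains [x]: 1 and 2 are the
   subtrees below [w], and 0 is the rest of the tree. *)
Fixpoint br T w x : nat :=
  match T with
  | Lf _ => 0
  | Nd v L R => if v == w then (if x \in labels L then 1 else
                                if x \in labels R then 2 else 0)
                else br L w x + br R w x
  end.

Fixpoint lca T x y : V :=
  match T with
  | Lf v => v
  | Nd v L R => if (x \in leaves L) && (y \in leaves L) then lca L x y else
                if (x \in leaves R) && (y \in leaves R) then lca R x y else v
  end.

(* [subt u T p t]: [t] is a subtree of [T] and [p] is the parent of its root,
   where the root of [T] is given the parent [u]. *)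
Inductive subt : V -> bt V -> V -> bt V -> Prop :=
| subt_here u T : subt u T u T
| subt_l u v L R p t : subt v L p t -> subt u (Nd v L R) p t
| subt_r u v L R p t : subt v R p t -> subt u (Nd v L R) p t.

Lemma labels_perm T : perm_eq (labels T) (leaves T ++ inners T).
Proof.
elim: T => [v|v L IHL R IHR] //=; apply/permP => P /=.
move/permP: IHL => /(_ P); move/permP: IHR => /(_ P).
rewrite !count_cat /= !count_cat; lia.
Qed.

Lemma mem_labels T x : (x \in labels T) = (x \in leaves T) || (x \in inners T).
Proof. by rewrite (perm_mem (labels_perm T)) mem_cat. Qed.

Lemma leaves_labels T : {subset leaves T <= labels T}.
Proof. by move=> x xT; rewrite mem_labels xT. Qed.

Lemma inners_labels T : {subset inners T <= labels T}.
Proof. by move=> x xT; rewrite mem_labels xT orbT. Qed.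

Lemma uniq_leaves T : uniq (labels T) -> uniq (leaves T).
Proof. by rewrite (perm_uniq (labels_perm T)) cat_uniq => /and3P[]. Qed.

Lemma leaf_not_inner T x : uniq (labels T) -> x \in leaves T -> x \notin inners T.
Proof.
rewrite (perm_uniq (labels_perm T)) cat_uniq => /and3P[_ /hasPn h _] xT.
by apply/negP => /h; rewrite /= xT.
Qed.

Lemma lab_labels T : lab T \in labels T.
Proof. by case: T => *; rewrite inE eqxx. Qed.

Lemma size_leaves T : size (leaves T) = (size (inners T)).+1.
Proof. by elim: T => //= v L IHL R IHR; rewrite !size_cat IHL IHR addSn addnS. Qed.

Lemma uniq_Nd v L R : uniq (labels (Nd v L R)) ->
  [/\ uniq (labels L), uniq (labels R), v \notin labels L, v \notin labels R &
      forall x, x \in labels L -> x \notin labels R].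
Proof.
rewrite /= mem_cat negb_or cat_uniq => /andP[/andP[-> ->] /and3P[-> /hasPn h ->]].
by split=> // x xL; apply/negP => /h; rewrite /= xL.
Qed.

Lemma br_out T w x : x \notin labels T -> br T w x = 0.
Proof.
elim: T => //= v L IHL R IHR; rewrite inE mem_cat !negb_or => /and3P[_ xL xR].
by rewrite (negPf xL) (negPf xR) IHL // IHR // if_same.
Qed.

Lemma br_notin T w x : w \notin inners T -> br T w x = 0.
Proof.
elim: T => //= v L IHL R IHR; rewrite inE mem_cat !negb_or => /and3P[wv wL wR].
by rewrite eq_sym (negPf wv) IHL // IHR.
Qed.

Lemma br_l v L R w x : uniq (labels (Nd v L R)) -> w \in inners L ->
  br (Nd v L R) w x = br L w x.
Proof.
move=> /uniq_Nd[_ _ vL _ d] wL /=.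
case: eqP => [e|_]; first by move: vL; rewrite e inners_labels.
by rewrite [X in _ + X]br_notin ?addn0 //; apply: contra (d _ (inners_labels wL));
  exact: inners_labels.
Qed.

Lemma br_r v L R w x : uniq (labels (Nd v L R)) -> w \in inners R ->
  br (Nd v L R) w x = br R w x.
Proof.
move=> /uniq_Nd[_ _ _ vR d] wR /=.
case: eqP => [e|_]; first by move: vR; rewrite e inners_labels.
rewrite br_notin //; apply/negP => /inners_labels/d.
by rewrite inners_labels.
Qed.

Lemma subt_labels u T p t : subt u T p t ->
  p \in u :: labels T /\ {subset labels t <= labels T}.
Proof.
elim=> {u T p t} [u T|u v L R p t _ [pL tL]|u v L R p t _ [pR tR]].
- by rewrite inE eqxx; split.
- split; last by move=> x /tL xL; rewrite /= inE mem_cat xL orbT.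
  by move: pL; rewrite !inE mem_cat => /orP[->|->]; rewrite ?orbT.
- split; last by move=> x /tR xR; rewrite /= inE mem_cat xR !orbT.
  by move: pR; rewrite !inE mem_cat => /orP[->|->]; rewrite ?orbT.
Qed.

Lemma subt_uniq u T p t : subt u T p t -> uniq (labels T) -> uniq (labels t).
Proof. by elim=> // {u T p t} u v L R p t _ IH /uniq_Nd[]; auto. Qed.

Lemma subt_inners u T p w L R : subt u T p (Nd w L R) -> w \in inners T.
Proof.
move: {-1}(Nd w L R) (erefl (Nd w L R)) => t et st.
elim: st et => {u T p t} [u T <-|u v L' R' p t _ IH|u v L' R' p t _ IH] /=.
- by rewrite inE eqxx.
- by move=> /IH; rewrite inE mem_cat => ->; rewrite orbT.
- by move=> /IH; rewrite inE mem_cat => ->; rewrite !orbT.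
Qed.

Lemma subt_ex x u t : x \in labels t -> exists p t', subt u t p t' /\ lab t' = x.
Proof.
elim: t u => [v|v L IHL R IHR] u; first by rewrite inE => /eqP->; exists u, (Lf v); split; constructor.
rewrite /= inE mem_cat => /or3P[/eqP->|/(IHL v)[p [t [st e]]]|/(IHR v)[p [t [st e]]]].
- by exists u, (Nd v L R); split; constructor.
- by exists p, t; split=> //; constructor.
- by exists p, t; split=> //; constructor.
Qed.

Lemma subt_children u t p v L R : subt u t p (Nd v L R) -> subt u t v L /\ subt u t v R.
Proof.
move: {-1}(Nd v L R) (erefl (Nd v L R)) => t' + st.
elim: st => {u t p t'} [u t <-|u v' L' R' p t _ IH|u v' L' R' p t _ IH].
- by split; [apply: subt_l|apply: subt_r]; exact: subt_here.
- by case/IH; split; apply: subt_l.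
- by case/IH; split; apply: subt_r.
Qed.

(** The branches at [w] are the components that remain when [w] is removed, and an edge away from
    [w] stays in one of them. The root [r], though not a label of [T], gets the correct value 0 from
    [br_out]. *)
Lemma br_edge r T w p t : uniq (r :: labels T) -> subt r T p t ->
  p != w -> lab t != w -> br T w p = br T w (lab t).
Proof.
move=> + st; elim: st => {r T p t} [u T|u v L R p t st IH|u v L R p t st IH].
- case: T => //= v L R.
  rewrite inE negb_or mem_cat negb_or => /and3P[/and3P[uv uL uR] + _] uw vw.
  rewrite mem_cat negb_or => /andP[vL vR].
  by rewrite (negPf vw) !br_out.
- rewrite cons_uniq => /andP[_ U] pw tw.
  have [UL _ vL vR d] := uniq_Nd U.
  have [pL tL] := subt_labels st.
  have {}tL : lab t \in labels L by apply/tL/lab_labels.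
  have pR : p \notin labels R by move: pL; rewrite inE => /orP[/eqP->//|/d].
  rewrite /=; case: eqP => [e|_].
    by move: pL; rewrite tL inE e (negPf pw) /= => ->.
  by rewrite IH ?cons_uniq ?vL // [br R w p]br_out // [br R w (lab t)]br_out // d.
- rewrite cons_uniq => /andP[_ U] pw tw.
  have [_ UR vL vR d] := uniq_Nd U.
  have [pR tR] := subt_labels st.
  have {}tR : lab t \in labels R by apply/tR/lab_labels.
  have pL : p \notin labels L.
    by apply/negP => pL; move: pR (d _ pL) vL; rewrite inE => /orP[/eqP<-|->//]; rewrite pL.
  have tL : lab t \notin labels L by apply/negP => /d; rewrite tR.
  rewrite /=; case: eqP => [e|_].
    by move: pR; rewrite tR (negPf pL) (negPf tL) inE e (negPf pw) /= => ->.
  by rewrite IH ?cons_uniq ?vR // [br L w p]br_out // [br L w (lab t)]br_out.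
Qed.

Lemma br_node r T p w L R : uniq (r :: labels T) -> subt r T p (Nd w L R) ->
  [/\ br T w p = 0, br T w (lab L) = 1 & br T w (lab R) = 2].
Proof.
move=> + st; move: {-1}(Nd w L R) (erefl (Nd w L R)) st => t et st.
elim: st et => {r T p t} [u T|u v L' R' p t st IH|u v L' R' p t st IH] et.
- rewrite -et cons_uniq => /andP[un]; rewrite br_out // => /uniq_Nd[_ _ _ _ d] /=.
  rewrite eqxx !lab_labels; split => //.
  by case: ifP => // /d; rewrite lab_labels.
- rewrite cons_uniq => /andP[_ U].
  have wi : w \in inners L' by move: st; rewrite -et => /subt_inners.
  by rewrite !(br_l _ U wi); apply: IH => //=; have [-> _ -> _ _] := uniq_Nd U.
- rewrite cons_uniq => /andP[_ U].
  have wi : w \in inners R' by move: st; rewrite -et => /subt_inners.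
  by rewrite !(br_r _ U wi); apply: IH => //=; have [_ -> _ -> _] := uniq_Nd U.
Qed.

Lemma lca_inners T x y : x \in leaves T -> y \in leaves T -> x != y ->
  lca T x y \in inners T.
Proof.
elim: T => [v|v L IHL R IHR] /=; first by rewrite !inE => /eqP-> /eqP->; rewrite eqxx.
rewrite !mem_cat inE mem_cat => xT yT xy.
case: ifP => [/andP[xL yL]|_]; first by rewrite IHL ?orbT.
by case: ifP => [/andP[xL yL]|_]; [rewrite IHR ?orbT|rewrite eqxx].
Qed.

(** The root lies in branch 0 at every vertex, so the left side says that [w] separates the root,
    [x] and [y]. The induction descends into the subtree that holds [w]; a leaf outside this subtree
    is in branch 0. *)
Lemma lca_br T w x y : uniq (labels T) -> w \in inners T ->
  x \in leaves T -> y \in leaves T -> x != y ->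
  uniq [:: 0; br T w x; br T w y] = (lca T x y == w).
Proof.
elim: T => // v L IHL R IHR U.
have [UL UR vL vR d] := uniq_Nd U.
have dl z : z \in leaves L -> (z \in leaves R) = false.
  by move=> /leaves_labels/d h; apply: contraNF h; exact: leaves_labels.
have dr z : z \in leaves R -> (z \in leaves L) = false.
  by move=> zR; apply/negP => /dl; rewrite zR.
have dR z : z \in labels R -> (z \in labels L) = false.
  by move=> zR; apply/negP => /d; rewrite zR.
rewrite [inners _]/= [leaves _]/= !mem_cat inE mem_cat => wT xT yT xy.
have [wv|wv] := eqVneq w v.
  have lv t : v \notin labels t -> x \in leaves t -> y \in leaves t -> (lca t x y == w) = false.
    move=> vt xt yt; apply/eqP => e; case/negP: vt; rewrite -wv -e.
    by apply: inners_labels; exact: lca_inners.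
  rewrite /= wv eqxx -{}wv.
  case/orP: xT => xT; case/orP: yT => yT;
  rewrite xT yT ?(dl _ xT) ?(dl _ yT) ?(dr _ xT) ?(dr _ yT) /=
    ?lv // ?(leaves_labels xT) ?(leaves_labels yT) ?(dR _ (leaves_labels xT))
    ?(dR _ (leaves_labels yT)) /= ?eqxx //.
rewrite (negPf wv) orFb in wT; case/orP: wT => wT.
  (* If both leaves lie in the subtree without [w], their [lca] is a label of that subtree and
     differs from [w]. *)
  have lw : (lca R x y == w) && (x \in leaves R) && (y \in leaves R) = false.
    apply/negP => /andP[/andP[/eqP e xR] yR].
    by move: (d _ (inners_labels wT)); rewrite -e inners_labels ?lca_inners.
  rewrite !(br_l _ U wT).
  case/orP: xT => xT; case/orP: yT => yT; set l := lca _ _ _;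
    have := erefl l; rewrite {2}/l /= xT yT ?(dl _ xT) ?(dl _ yT) ?(dr _ xT) ?(dr _ yT)
    ?andbF /= => ->.
  - exact: IHL.
  - rewrite [br L w y]br_out ?inE ?eqxx ?orbT ?(eq_sym v) ?(negPf wv) //.
    by rewrite dR // leaves_labels.
  - rewrite [br L w x]br_out ?inE ?eqxx ?orbT ?(eq_sym v) ?(negPf wv) //.
    by rewrite dR // leaves_labels.
  - rewrite !br_out ?inE ?eqxx ?orbT /= ?dR // ?leaves_labels //.
    by move: lw; rewrite xT yT !andbT => ->.
have lw : (lca L x y == w) && (x \in leaves L) && (y \in leaves L) = false.
  apply/negP => /andP[/andP[/eqP e xR] yR].
  by move: (d (lca L x y)); rewrite e (inners_labels wT) -e inners_labels ?lca_inners // => /(_ isT).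
rewrite !(br_r _ U wT).
case/orP: xT => xT; case/orP: yT => yT; set l := lca _ _ _;
  have := erefl l; rewrite {2}/l /= xT yT ?(dl _ xT) ?(dl _ yT) ?(dr _ xT) ?(dr _ yT)
  ?andbF /= => ->.
- rewrite !br_out ?inE ?eqxx ?orbT /= ?d // ?leaves_labels //.
  by move: lw; rewrite xT yT !andbT => ->.
- rewrite [br R w x]br_out ?inE ?eqxx ?orbT ?(eq_sym v) ?(negPf wv) //.
  by rewrite d // leaves_labels.
- rewrite [br R w y]br_out ?inE ?eqxx ?orbT ?(eq_sym v) ?(negPf wv) //.
  by rewrite d // leaves_labels.
- exact: IHR.
Qed.

End BinaryTrees.

(** * Reconstruction of a tree from its leaf order and [lca] *)

Section MoreBinaryTrees.
Variable V : eqType.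
Implicit Types (T L R t : bt V) (u v w x y r p a b : V) (s : seq V).

Lemma head_leaves T x0 : head x0 (leaves T) \in leaves T.
Proof. by case: (leaves T) (size_leaves T) => //= x s _; rewrite mem_head. Qed.

Lemma last_leaves T x0 : last x0 (leaves T) \in leaves T.
Proof. by case: (leaves T) (size_leaves T) => //= x s _; exact: mem_last. Qed.

Lemma lca_l v L R x y : x \in leaves L -> y \in leaves L ->
  lca (Nd v L R) x y = lca L x y.
Proof. by move=> /= -> ->. Qed.

Lemma uniq_cat_notin s1 s2 x : uniq (s1 ++ s2) -> x \in s2 -> x \notin s1.
Proof. by rewrite cat_uniq => /and3P[_ /hasPn h _] /h. Qed.

Lemma lca_r v L R x y : uniq (leaves (Nd v L R)) ->
  x \in leaves R -> y \in leaves R -> lca (Nd v L R) x y = lca R x y.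
Proof. by move=> /uniq_cat_notin d xR yR /=; rewrite (negPf (d _ xR)) /= xR yR. Qed.

Lemma lca_lr v L R x y : uniq (leaves (Nd v L R)) ->
  x \in leaves L -> y \in leaves R -> lca (Nd v L R) x y = v.
Proof.
move=> /uniq_cat_notin d xL yR /=; rewrite (negPf (d _ yR)) andbF.
by rewrite (contraTF (d x) xL).
Qed.

(** The last leaf is on the right, so the leaves on the left are those that meet it only at the
    root: the split can be read off from [lca]. The condition [z != y] restricts to pairs of
    distinct leaves, on which two trees will be compared. *)
Lemma left_leaves v L R x0 : uniq (labels (Nd v L R)) ->
  let y := last x0 (leaves R) in
  leaves L = [seq z <- leaves (Nd v L R) | (z != y) && (lca (Nd v L R) z y == v)].
Proof.
move=> U y; have Ul := uniq_leaves U.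
have yR : y \in leaves R by exact: last_leaves.
have [_ _ vL vR _] := uniq_Nd U.
rewrite [leaves (Nd _ _ _)]/= filter_cat (_ : [seq z <- leaves L | _] = leaves L); last first.
  apply/all_filterP/allP => z zL; rewrite (lca_lr Ul zL yR) eqxx andbT.
  by apply/eqP => e; move: zL; rewrite e (negPf (uniq_cat_notin Ul yR)).
rewrite (_ : [seq z <- leaves R | _] = [::]) ?cats0 //.
apply/eqP; rewrite -[_ == _]negbK -has_filter; apply/negP => /hasP[z zR].
rewrite (lca_r Ul zR yR) => /andP[zy /eqP e]; case/negP: vR.
by rewrite -e inners_labels // lca_inners.
Qed.

(** The [lca] of the first and the last leaf is the root, which determines the root label;
    [left_leaves] then determines the leaves on either side, and [lca] restricts to the subtrees. *)
Lemma leaves_lca_inj T1 T2 : uniq (labels T1) -> uniq (labels T2) ->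
  leaves T1 = leaves T2 ->
  {in leaves T1 &, forall x y, x != y -> lca T1 x y = lca T2 x y} -> T1 = T2.
Proof.
elim: T1 T2 => [v|v L IHL R IHR] [v2|v2 L2 R2] U1 U2 e el.
- by case: e => ->.
- by move: (congr1 size e); rewrite size_cat !size_leaves addSn addnS.
- by move: (congr1 size e); rewrite size_cat !size_leaves addSn addnS.
have [UL UR vL vR d] := uniq_Nd U1; have [UL2 UR2 vL2 vR2 d2] := uniq_Nd U2.
have Ul1 := uniq_leaves U1; have Ul2 := uniq_leaves U2.
pose x := head v (leaves L); pose y := last v (leaves R).
have xE : x = head v (leaves L2).
  move: e; rewrite /x /=; case: (leaves L) (size_leaves L) => // a l _.
  by case: (leaves L2) (size_leaves L2) => // b l2 _ [].
have yE : y = last v (leaves R2).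
  move: (congr1 (last v) e) (size_leaves R) (size_leaves R2); rewrite /y /= !last_cat.
  by case: (leaves R) => // a l; case: (leaves R2).
have xL : x \in leaves L by exact: head_leaves.
have xL2 : x \in leaves L2 by rewrite xE; exact: head_leaves.
have yR : y \in leaves R by exact: last_leaves.
have yR2 : y \in leaves R2 by rewrite yE; exact: last_leaves.
have xy : x != y by apply/eqP => xy; move: (uniq_cat_notin Ul1 yR); rewrite -xy xL.
have xT : x \in leaves (Nd v L R) by rewrite mem_cat xL.
have yT : y \in leaves (Nd v L R) by rewrite mem_cat yR orbT.
have vv : v = v2.
  by move: (el x y xT yT xy); rewrite (lca_lr Ul1 xL yR) (lca_lr Ul2 xL2 yR2).
rewrite -{}vv in U2 e el vL2 vR2 Ul2 *.
have eL : leaves L = leaves L2.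
  rewrite (left_leaves v U1) (left_leaves v U2) -/y -yE -e.
  apply: eq_in_filter => z zT; case: (eqVneq z y) => // zy.
  by rewrite !andTb (el z y).
have eR : leaves R = leaves R2.
  by move: e; rewrite /= eL => /eqP; rewrite eqseq_cat // eqxx => /eqP.
congr Nd; first apply: IHL => // z t zL tL zt.
  rewrite -(lca_l v R zL tL) el ?mem_cat ?zL ?tL //.
  by rewrite (lca_l v R2) // -eL.
apply: IHR => // z t zR tR zt.
rewrite -(lca_r Ul1 zR tR) el ?mem_cat ?zR ?tR ?orbT //.
by rewrite (lca_r Ul2) // -eR.
Qed.

Lemma subseq2_cat x y s1 s2 : subseq [:: x; y] (s1 ++ s2) ->
  [\/ subseq [:: x; y] s1, x \in s1 /\ y \in s2 | subseq [:: x; y] s2].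
Proof.
elim: s1 => [|z s1 IH]; first by move=> h; apply: Or33.
rewrite cat_cons /=; case: eqP => [->|xz].
  rewrite sub1seq mem_cat mem_head => /orP[ys|ys]; last exact: Or32.
  by rewrite sub1seq ys; exact: Or31.
move=> /IH[h|[xs ys]|h]; [exact: Or31|apply: Or32|exact: Or33].
by rewrite inE xs orbT.
Qed.

Lemma subseq_pair_cat x y s1 s2 : x \in s1 -> y \in s2 -> subseq [:: x; y] (s1 ++ s2).
Proof. by move=> xs ys; apply: (@cat_subseq _ [:: x] [:: y]); rewrite sub1seq. Qed.

(** The root label must be the value [w] of [g] at the first and the last leaf, and the right
    subtree must start at the first leaf [y0] with [g i y0 = w]. The hypotheses force the value [w]
    on all pairs across this cut. The last conclusion lets the induction compare the labels of the
    two subtrees. *)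
Lemma bt_of_lca (g : V -> V -> V) s : uniq s -> s != [::] ->
  (forall x y z, subseq [:: x; y; z] s -> g x y = g x z \/ g y z = g x z) ->
  (forall x y z, subseq [:: x; y; z] s -> g x y <> g y z) ->
  (forall x y z (t : V), subseq [:: x; y; z; t] s -> g x y <> g z t) ->
  exists T, [/\ leaves T = s,
    forall x y, subseq [:: x; y] s -> lca T x y = g x y,
    uniq (inners T) &
    forall w, w \in inners T -> exists x y, subseq [:: x; y] s /\ w = g x y].
Proof.
move: {2}(size s) (leqnn (size s)) => n; elim: n s => [|n IH] [|i s] // sn U _.
case: s sn U => [|j0 s] sn U g1 g2 g3.
  by exists (Lf i); split=> // x y /=; case: ifP.
set s' := j0 :: s in U sn g1 g2 g3 *.
pose j := last i s'; pose w := g i j.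
pose P z := g i z == w.
have js : j \in s' by rewrite /j /s' /= mem_last.
have hP : has P s' by apply/hasP; exists j; rewrite // /P eqxx.
have [s1 [y0 [s2 [es Py0 nP]]]] : exists s1 y0 s2,
    [/\ s' = s1 ++ y0 :: s2, P y0 & forall z, z \in s1 -> ~~ P z].
  exists (take (find P s') s'), (nth i s' (find P s')), (drop (find P s').+1 s').
  split; first by rewrite -drop_nth -?has_find // cat_take_drop.
    exact: nth_find.
  have /hasPn h : ~~ has P (take (find P s') s') by rewrite has_take_leq ?ltnn // find_size.
  exact: h.
have jl : j = last i (y0 :: s2) by rewrite /j es last_cat.
have es' : i :: s' = (i :: s1) ++ y0 :: s2 by rewrite es.
rewrite es' in U sn g1 g2 g3 *; rewrite size_cat /= in sn.
have jy : j \in y0 :: s2 by rewrite jl /= mem_last.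
have g1j x : x \in s1 -> g x j = w.
  move=> xs; have [|e|//] := g1 i x j.
    by apply: (@cat_subseq _ [:: i; x] [:: j]); rewrite ?sub1seq //= eqxx sub1seq.
  by move: (nP _ xs); rewrite /P e eqxx.
have gi y : y \in y0 :: s2 -> g i y = w.
  rewrite inE => /orP[/eqP->|ys]; first exact/eqP.
  have [->//|yj] := eqVneq y j.
  have sj : subseq [:: y; j] s2.
    have jE : j = last y s2.
      by rewrite jl /=; case: (s2) ys.
    case/splitPr: ys jE yj => p1 p2; rewrite last_cat /= => jE.
    have := mem_last y p2; rewrite -jE inE => /orP[/eqP->|jp]; first by rewrite eqxx.
    move=> _; rewrite -cat_rcons; apply: subseq_pair_cat => //.
    by rewrite mem_rcons mem_head.
  (* The alternative [g y j = w] would give the pairs [i], [y0] and [y], [j] the same value, against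
     [g3]. *)
  have [|//|e] := g1 i y j.
    apply: (@cat_subseq _ [:: i] [:: y; j]); first by rewrite sub1seq mem_head.
    exact: subseq_trans sj (subseq_cons _ _).
  case: (g3 i y0 y j); last by rewrite e; exact/eqP.
  by apply: (@cat_subseq _ [:: i] [:: y0; y; j]); rewrite ?sub1seq ?mem_head /= ?eqxx ?sub0seq.
have gx x y : x \in i :: s1 -> y \in y0 :: s2 -> g x y = w.
  rewrite inE => /orP[/eqP->|xs] ys; first exact: gi.
  have [|e|->] := g1 i x y; last exact: gi.
    by apply: (@cat_subseq _ [:: i; x] [:: y]); rewrite ?sub1seq //= eqxx sub1seq.
  by move: (nP _ xs); rewrite /P e gi // eqxx.
have sL (u1 : seq V) : subseq u1 (i :: s1) -> subseq u1 ((i :: s1) ++ y0 :: s2).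
  by move=> h; rewrite -[u1]cats0; exact: cat_subseq (sub0seq _).
have sR (u1 : seq V) : subseq u1 (y0 :: s2) -> subseq u1 ((i :: s1) ++ y0 :: s2).
  by move=> h; rewrite -[u1]cat0s; exact: cat_subseq (sub0seq _) h.
have [||||||L [lL lcaL uL iL]] := IH (i :: s1).
- by rewrite /=; lia.
- by move: U; rewrite cat_uniq => /andP[].
- by [].
- by move=> x y z /sL; exact: g1.
- by move=> x y z /sL; exact: g2.
- by move=> x y z t /sL; exact: g3.
have [||||||R [lR lcaR uR iR]] := IH (y0 :: s2).
- by rewrite /=; lia.
- by move: U; rewrite cat_uniq => /and3P[].
- by [].
- by move=> x y z /sR; exact: g1.
- by move=> x y z /sR; exact: g2.
- by move=> x y z t /sR; exact: g3.
have Ul : uniq (leaves (Nd w L R)) by rewrite /= lL lR.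
exists (Nd w L R); split.
- by rewrite /= lL lR.
- move=> x y /subseq2_cat[h|[xs ys]|h].
  + by rewrite lca_l ?lcaL // lL (mem_subseq h) ?inE ?eqxx ?orbT.
  + by rewrite lca_lr ?lL ?lR // gx.
  + by rewrite lca_r ?lcaR // lR (mem_subseq h) ?inE ?eqxx ?orbT.
- rewrite /= mem_cat negb_or cat_uniq uL uR /= andbT -andbA.
  have yt x y (t : V) : subseq [:: x; y] (i :: s1) -> t \in y0 :: s2 ->
      subseq [:: x; y; t] ((i :: s1) ++ y0 :: s2).
    by by move=> h1 h2; apply: (@cat_subseq _ [:: x; y] [:: t]); rewrite ?sub1seq.
  (* If the root label recurred in a subtree, three leaves on both sides of the cut would violate
     [g2]; a label common to both subtrees would violate [g3]. *)
  apply/and3P; split.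
  + apply/negP => /iL[x [y [h e]]]; apply: (g2 x y y0 (yt _ _ _ h (mem_head _ _))).
    by rewrite -e gx ?mem_head // (mem_subseq h) ?inE ?eqxx ?orbT.
  + apply/negP => /iR[x [y [h e]]]; apply: (g2 i x y).
      by apply: (@cat_subseq _ [:: i] [:: x; y]); rewrite ?sub1seq ?mem_head.
    by rewrite -e gx ?mem_head // (mem_subseq h) ?inE ?eqxx ?orbT.
  + apply/hasPn => z /iR[z1 [z2 [hz e]]]; apply/negP => /iL[x1 [x2 [hx ex]]].
    by apply: (g3 _ _ _ _ (cat_subseq hx hz)); rewrite -ex -e.
- move=> x; rewrite [inners _]/= inE mem_cat => /or3P[/eqP->|/iL[y [z [h ->]]]|/iR[y [z [h ->]]]].
  + exists i, j; split=> //.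
    by apply: (@cat_subseq _ [:: i] [:: j]); rewrite ?sub1seq ?mem_head.
  + by exists y, z; split=> //; exact: sL.
  + by exists y, z; split=> //; exact: sR.
Qed.

End MoreBinaryTrees.

(** * Growing a tree by splitting a leaf *)

Section Grafting.
Variable V : eqType.
Implicit Types (T L R t : bt V) (u v w x y r p a b : V) (s : seq V).

Fixpoint graft T a w b : bt V :=
  match T with
  | Lf v => if v == a then Nd w (Lf a) (Lf b) else Lf v
  | Nd v L R => Nd v (graft L a w b) (graft R a w b)
  end.

Lemma graft_id T a w b : a \notin leaves T -> graft T a w b = T.
Proof.
elim: T => [v|v L IHL R IHR] /=; first by rewrite inE eq_sym => /negPf->.
by rewrite mem_cat negb_or => /andP[/IHL-> /IHR->].
Qed.

Lemma graft_leaves T a w b s1 s2 : uniq (leaves T) -> leaves T = s1 ++ a :: s2 ->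
  leaves (graft T a w b) = s1 ++ a :: b :: s2.
Proof.
pose f v := if v == a then [:: a; b] else [:: v].
have fid s : a \notin s -> flatten (map f s) = s.
  elim: s => //= v s IH; rewrite inE negb_or eq_sym => /andP[va /IH->].
  by rewrite /f (negPf va).
have -> : leaves (graft T a w b) = flatten (map f (leaves T)).
  elim: T => [v|v L IHL R IHR] /=; first by rewrite cats0 /f; case: ifP.
  by rewrite map_cat flatten_cat IHL IHR.
move=> + e; rewrite e cat_uniq /= negb_or => /and3P[_ /andP[a1 _] /andP[a2 _]].
by rewrite map_cat flatten_cat /= !fid // /f eqxx.
Qed.

Lemma graft_inners T a w b : uniq (leaves T) -> a \in leaves T ->
  perm_eq (inners (graft T a w b)) (w :: inners T).
Proof.
elim: T => [v|v L IHL R IHR] /=; first by rewrite inE eq_sym => _ ->.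
rewrite cat_uniq mem_cat => /and3P[UL /hasPn d UR] /orP[aL|aR].
  have aR : a \notin leaves R by apply/negP => /d; rewrite /= aL.
  rewrite (graft_id _ _ aR); move/permP: (IHL UL aL) => h; apply/permP => P.
  by move: (h P); rewrite /= !count_cat /= => ->; lia.
have aL : a \notin leaves L by exact: d.
rewrite (graft_id _ _ aL); move/permP: (IHR UR aR) => h; apply/permP => P.
by move: (h P); rewrite /= !count_cat /= => ->; lia.
Qed.

Lemma graft_mem T a w b x : (x \in labels (graft T a w b)) =
  (x \in labels T) || (a \in leaves T) && ((x == w) || (x == b)).
Proof.
elim: T => [v|v L IHL R IHR] /=; last first.
  rewrite !inE !mem_cat IHL IHR; case: (x == v) => //=.
  by case: (a \in leaves L); case: (a \in leaves R) => //=; do ?case: (x \in _) => //=;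
     rewrite ?orbF ?orbT ?orbb.
rewrite !inE (eq_sym a); case: eqVneq => [->|va] /=; rewrite !inE ?orbF //.
by rewrite orbCA.
Qed.

(** An old vertex cannot tell [b] from [a]: both hang where [a] was. *)
Lemma br_graft T a w b w' x : uniq (labels T) -> a \in leaves T ->
  b \notin labels T -> w' != w -> x != w ->
  br (graft T a w b) w' x = br T w' (if x == b then a else x).
Proof.
move=> U aT bT w'w xw; have : a \notin inners T by exact: leaf_not_inner.
move: bT {aT U}; elim: T => [v|v L IHL R IHR] /=.
  by case: eqP => //= _ _ _; rewrite eq_sym (negPf w'w).
rewrite !inE !mem_cat !negb_or => /and3P[bv bL bR] /and3P[av aL aR].
rewrite IHL // IHR // !graft_mem (negPf xw) /=.
have h t : b \notin labels t -> a \notin inners t ->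
    (x \in labels t) || (a \in leaves t) && (x == b) =
    ((if x == b then a else x) \in labels t).
  move=> bt at'; case: (eqVneq x b) => [->|_]; last by rewrite andbF orbF.
  by rewrite (negPf bt) andbT mem_labels (negPf at') orbF.
by rewrite !h.
Qed.

Lemma br_graft_new T a w b x : uniq (labels T) -> a \in leaves T ->
  w \notin labels T ->
  br (graft T a w b) w x = if x == a then 1 else if x == b then 2 else 0.
Proof.
elim: T => [v|v L IHL R IHR].
  by move=> _; rewrite inE eq_sym /= => -> _ /=; rewrite eqxx !inE.
move=> /uniq_Nd[UL UR vL vR d].
rewrite /= inE !mem_cat !negb_or => /orP[aL|aR] /and3P[wv wL wR];
  rewrite eq_sym (negPf wv).
  have aR : a \notin leaves R.
    by apply/negP => /leaves_labels aR; move: (d _ (leaves_labels aL)); rewrite aR.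
  rewrite (graft_id _ _ aR) IHL // [br R _ _]br_notin ?addn0 //.
  by apply: contra wR; exact: inners_labels.
have aL : a \notin leaves L.
  by apply/negP => /leaves_labels/d; rewrite leaves_labels.
rewrite (graft_id _ _ aL) IHR // [br L _ _]br_notin ?add0n //.
by apply: contra wL; exact: inners_labels.
Qed.

(** Some inner vertex has two leaves as children: descend into a subtree with at least two leaves as
    long as there is one. Collapsing this vertex inverts [graft]. *)
Lemma ungraft T : uniq (labels T) -> (1 < size (leaves T))%N ->
  exists T' a w b, [/\ T = graft T' a w b, a \in leaves T', uniq (labels T'),
    (w \notin labels T') && (b \notin w :: labels T') & size (leaves T) = (size (leaves T')).+1].
Proof.
elim: T => // v L IHL R IHR U _.
have [UL UR vL vR d] := uniq_Nd U.
have [sL|sL] := ltnP 1 (size (leaves L)).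
  have [T' [a [w [b [e aT UT /andP[wT bT] sT]]]]] := IHL UL sL.
  have mL x : (x \in labels L) = (x \in labels T') || (x == w) || (x == b).
    by rewrite e graft_mem aT /= orbA.
  exists (Nd v T' R), a, w, b.
  have wL : w \in labels L by rewrite mL eqxx orbT.
  have bL : b \in labels L by rewrite mL eqxx orbT.
  have aL : a \in labels L by rewrite mL (leaves_labels aT).
  have TL x : x \in labels T' -> x \in labels L by rewrite mL => ->.
  split.
  - rewrite /= -e (graft_id (T := R)) //.
    by apply/negP => /leaves_labels; rewrite (negPf (d _ aL)).
  - by rewrite /= mem_cat aT.
  - rewrite /= mem_cat negb_or vR andbT cat_uniq UT UR andbT (contra (TL v)) //=.
    by apply/hasPn => x xR; apply/negP => /TL/d; rewrite xR.
  - apply/andP; split.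
      rewrite /= inE mem_cat !negb_or wT d // !andbT.
      by apply: contraNneq vL => <-.
    rewrite /= !inE mem_cat !negb_or d // andbT.
    move: bT; rewrite inE negb_or => /andP[-> ->]; rewrite andbT /=.
    by apply: contraNneq vL => <-.
  - by rewrite /= !size_cat sT addSn.
have [sR|sR] := ltnP 1 (size (leaves R)).
  have [T' [a [w [b [e aT UT /andP[wT bT] sT]]]]] := IHR UR sR.
  have mR x : (x \in labels R) = (x \in labels T') || (x == w) || (x == b).
    by rewrite e graft_mem aT /= orbA.
  exists (Nd v L T'), a, w, b.
  have dR x : x \in labels R -> x \notin labels L by move=> xR; apply/negP => /d; rewrite xR.
  have wR : w \in labels R by rewrite mR eqxx orbT.
  have bR : b \in labels R by rewrite mR eqxx orbT.
  have aR : a \in labels R by rewrite mR (leaves_labels aT).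
  have TR x : x \in labels T' -> x \in labels R by rewrite mR => ->.
  split.
  - rewrite /= -e (graft_id (T := L)) //.
    by apply/negP => /leaves_labels; rewrite (negPf (dR _ aR)).
  - by rewrite /= mem_cat aT orbT.
  - rewrite /= mem_cat negb_or vL cat_uniq UT UL andbT (contra (TR v)) //=.
    by apply/hasPn => x /TR; exact: dR.
  - apply/andP; split.
      rewrite /= inE mem_cat !negb_or wT dR // !andbT.
      by apply: contraNneq vR => <-.
    rewrite /= !inE mem_cat !negb_or dR //.
    move: bT; rewrite inE negb_or => /andP[-> ->]; rewrite andbT /=.
    by rewrite andbT; apply: contraNneq vR => <-.
  - by rewrite /= !size_cat sT addnS.
(* Both subtrees have a single leaf, hence are leaves, and the root is the vertex sought. *)
case: L sL U {IHL UL vL d} => [a|? ? ?]; last by rewrite /= size_cat !size_leaves addSn addnS.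
case: R sR {IHR UR vR} => [b _|? ? ?]; last by rewrite /= size_cat !size_leaves addSn addnS.
move=> _ /=; rewrite !inE negb_or => /and3P[/andP[va vb] ab _].
exists (Lf a), a, v, b; split=> //=; rewrite ?eqxx ?inE ?eqxx //.
by rewrite va negb_or ![b == _]eq_sym vb ab.
Qed.

End Grafting.

(** * Relabelling and reflecting a tree *)

Section MapMirror.

Fixpoint map_bt (V W : Type) (f : V -> W) (T : bt V) : bt W :=
  match T with
  | Lf v => Lf (f v)
  | Nd v L R => Nd (f v) (map_bt f L) (map_bt f R)
  end.

Fixpoint mirror (V : Type) (T : bt V) : bt V :=
  match T with Lf v => Lf v | Nd v L R => Nd v (mirror R) (mirror L) end.

Lemma leaves_map (V W : eqType) (f : V -> W) T : leaves (map_bt f T) = map f (leaves T).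
Proof. by elim: T => //= v L -> R ->; rewrite map_cat. Qed.

Lemma labels_map (V W : eqType) (f : V -> W) T : labels (map_bt f T) = map f (labels T).
Proof. by elim: T => //= v L -> R ->; rewrite map_cat. Qed.

Lemma lab_map (V W : eqType) (f : V -> W) T : lab (map_bt f T) = f (lab T).
Proof. by case: T. Qed.

Lemma lca_map (V W : eqType) (f : V -> W) T x y : injective f ->
  lca (map_bt f T) (f x) (f y) = f (lca T x y).
Proof.
by move=> fI; elim: T => //= v L -> R ->; rewrite !leaves_map !mem_map //; case: ifP => // _; case: ifP.
Qed.

Lemma subt_map (V W : eqType) (f : V -> W) u T p t : subt u T p t ->
  subt (f u) (map_bt f T) (f p) (map_bt f t).
Proof. by elim=> *; constructor. Qed.

Lemma leaves_mirror (V : eqType) (T : bt V) : leaves (mirror T) = rev (leaves T).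
Proof. by elim: T => //= v L -> R ->; rewrite rev_cat. Qed.

Lemma labels_mirror (V : eqType) (T : bt V) : perm_eq (labels (mirror T)) (labels T).
Proof.
elim: T => //= v L IHL R IHR; rewrite perm_cons.
by apply: perm_trans (perm_cat IHR IHL) _; rewrite perm_catC.
Qed.

Lemma lab_mirror (V : eqType) (T : bt V) : lab (mirror T) = lab T.
Proof. by case: T. Qed.

Lemma lca_mirror (V : eqType) (T : bt V) x y : uniq (leaves T) ->
  lca (mirror T) x y = lca T x y.
Proof.
elim: T => //= v L IHL R IHR; rewrite cat_uniq => /and3P[/IHL-> /hasPn d /IHR->].
rewrite !leaves_mirror !mem_rev.
have [xR|xR] := boolP (x \in leaves R); last by [].
by rewrite (negPf (d _ xR)).
Qed.

Lemma subt_mirror (V : eqType) (u : V) T p t : subt u T p t ->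
  subt u (mirror T) p (mirror t).
Proof. by elim=> *; constructor. Qed.

End MapMirror.

(** * Three-trees as unfolded binary trees *)

Section Unfolding.
Variable G : three_tree.
Implicit Types (T L R t : bt G) (u v w x y r p a b c : G).

(** The cyclic order at an inner vertex is parent, left, right, so that a walk entering from the
    parent visits the left subtree first. *)
Definition node_ok (p : G) (t : bt G) : Prop :=
  adj p (lab t) /\
  match t with
  | Lf v => leaf v
  | Nd v L R => [/\ inner v, nxt v p = lab L, nxt v (lab L) = lab R & nxt v (lab R) = p]
  end.

(* [T] is the part of [G] that one enters along the dart [(u, lab T)]. *)
Definition unfolds (u : G) (T : bt G) : Prop :=
  forall p t, subt u T p t -> node_ok p t.

Lemma leafN_inner v : leaf v = ~~ inner v.
Proof. by rewrite /leaf /inner; case: (degree13 v) => ->. Qed.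

Lemma leaf_adj v x y : leaf v -> adj v x -> adj v y -> y = x.
Proof.
move=> /cards1P[z e] vx vy.
have : x \in [set u | adj v u] by rewrite inE.
have : y \in [set u | adj v u] by rewrite inE.
by rewrite e !inE => /eqP-> /eqP->.
Qed.

Lemma inner_nxt v u : inner v -> adj v u ->
  [/\ adj v (nxt v u), adj v (nxt v (nxt v u)), nxt v (nxt v (nxt v u)) = u &
      uniq [:: u; nxt v u; nxt v (nxt v u)]].
Proof.
move=> /eqP iv vu; have [v1 n1 e] := nxt_cyclic iv vu.
have [v2 n2 _] := nxt_cyclic iv v1.
split=> //=; rewrite !inE negb_or eq_sym n1 [nxt v u == _]eq_sym n2 !andbT.
by apply: contra n1 => /eqP e2; rewrite -{2}e -e2.
Qed.

Lemma inner_adj v u y : inner v -> adj v u -> adj v y ->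
  y \in [:: u; nxt v u; nxt v (nxt v u)].
Proof.
move=> iv vu vy; have [v1 v2 _ U] := inner_nxt iv vu.
have s : [set x in [:: u; nxt v u; nxt v (nxt v u)]] \subset [set x | adj v x].
  by apply/fintype.subsetP => x; rewrite !inE => /or3P[]/eqP->.
have c : #|[set x in [:: u; nxt v u; nxt v (nxt v u)]]| = 3.
  by rewrite cardsE (card_uniqP U).
have : y \in [set x | adj v x] by rewrite inE.
have /eqP <- : [set x in [:: u; nxt v u; nxt v (nxt v u)]] == [set x | adj v x].
  by rewrite eqEcard s c -(eqP iv) leqnn.
by rewrite finset.in_set.
Qed.

Lemma unfolds_l u v L R : unfolds u (Nd v L R) -> unfolds v L.
Proof. by move=> h p t st; apply: h; constructor. Qed.

Lemma unfolds_r u v L R : unfolds u (Nd v L R) -> unfolds v R.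
Proof. by move=> h p t st; apply: h; constructor. Qed.

(** The tour around [T] starts with the dart from [u] into [T], which is omitted here, and ends with
    the same edge traversed backwards. *)
Fixpoint walk_tail (u : G) (T : bt G) : seq (G * G) :=
  match T with
  | Lf v => [:: (v, u)]
  | Nd v L R =>
      (v, lab L) :: walk_tail v L ++ (v, lab R) :: walk_tail v R ++ [:: (v, u)]
  end.

Definition walk u T := (u, lab T) :: walk_tail u T.

Lemma walk_Nd u v L R :
  walk u (Nd v L R) = [:: (u, v)] ++ walk v L ++ walk v R ++ [:: (v, u)].
Proof. by []. Qed.

Lemma walk_path u T : unfolds u T ->
  fpath (@walk_step G) (u, lab T) (walk_tail u T) /\
  last (u, lab T) (walk_tail u T) = (lab T, u).
Proof.
elim: T u => [v|v L IHL R IHR] u h.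
  have [_ lv] := h _ _ (subt_here u (Lf v)).
  by move: lv; rewrite leafN_inner /= /walk_step /= => /negPf->; rewrite eqxx.
have [_ [iv e1 e2 e3]] := h _ _ (subt_here u (Nd v L R)).
have [pL lL] := IHL _ (unfolds_l h); have [pR lR] := IHR _ (unfolds_r h).
split; last by rewrite /= last_cat /= last_cat.
rewrite /= cat_path /= cat_path pL pR lL lR /= /walk_step /= iv e1 e2 e3.
by rewrite !eqxx.
Qed.

(** The last dart of the tour returns to [u], whence the additional entry when [u] is itself a
    leaf. *)
Lemma walk_leaves u T : unfolds u T ->
  [seq f.2 | f <- walk u T & leaf f.2] = leaves T ++ (if leaf u then [:: u] else [::]).
Proof.
elim: T u => [v|v L IHL R IHR] u h.
  have [_ lv] := h _ _ (subt_here u (Lf v)).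
  by rewrite /= lv; case: ifP.
have [_ [iv _ _ _]] := h _ _ (subt_here u (Nd v L R)).
have lv : leaf v = false by rewrite leafN_inner iv.
rewrite walk_Nd !filter_cat !map_cat (IHL _ (unfolds_l h)) (IHR _ (unfolds_r h)).
by rewrite /= lv /= !cats0 catA; case: ifP.
Qed.

Lemma walk_mem u T e : e \in walk u T ->
  (e.1 \in u :: labels T) && (e.2 \in labels T) ||
  (e.2 \in u :: labels T) && (e.1 \in labels T).
Proof.
elim: T u => [v|v L IHL R IHR] u.
  by rewrite !inE => /orP[]/eqP->/=; rewrite ?eqxx ?orbT.
rewrite walk_Nd !mem_cat !mem_seq1.
case/or4P=> [/eqP->|/IHL|/IHR|/eqP->] /=; rewrite !inE ?mem_cat ?eqxx ?orbT //.
  by case/orP=> /andP[/orP[->|->] ->]; rewrite ?orbT.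
by case/orP=> /andP[/orP[->|->] ->]; rewrite ?orbT.
Qed.

Lemma walk_uniq u T : uniq (u :: labels T) -> uniq (walk u T).
Proof.
elim: T u => [v|v L IHL R IHR] u.
  by rewrite /= !inE => /andP[uv _]; rewrite xpair_eqE negb_and uv.
rewrite cons_uniq => /andP[uT UT]; have [UL UR vL vR d] := uniq_Nd UT.
move: uT; rewrite inE mem_cat !negb_or => /and3P[uv uL uR].
have dR x : x \in labels R -> x \notin labels L by move=> xR; apply/negP => /d; rewrite xR.
have out x t : u \notin labels t -> u != v -> (u, x) \notin walk v t /\ (x, u) \notin walk v t.
  move=> ut ux; split; apply/negP => /walk_mem /=;
  by rewrite !inE (negPf ut) (negPf ux) /= ?andbF.
have dd z : z \in labels L -> (z \in labels R) = false by move=> /d/negPf.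
have dj e : e \in walk v R -> e \notin walk v L.
  case: e => x y /walk_mem /= h; apply/negP => /walk_mem /=; move: h; rewrite !inE.
  by case/orP=> /andP[/orP[/eqP->|xR] yR];
    rewrite ?(negPf vL) ?(negPf (dR _ xR)) ?(negPf (dR _ yR)) ?andbF.
have [a1 a2] := out v L uL uv; have [b1 b2] := out v R uR uv.
have UwL : uniq (walk v L) by rewrite IHL //= vL.
have UwR : uniq (walk v R) by rewrite IHR //= vR.
rewrite walk_Nd; move: (walk v L) (walk v R) UwL UwR a1 a2 b1 b2 dj => A B.
move=> UA UB a1 a2 b1 b2 dj.
have -> : uniq ([:: (u, v)] ++ A ++ B ++ [:: (v, u)]) = uniq [:: (u, v), (v, u) & A ++ B].
  by apply/perm_uniq; rewrite /= perm_cons catA -(cat1s (v, u)) perm_catC.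
rewrite 2!cons_uniq inE !mem_cat !negb_or cat_uniq UA UB a1 a2 b1 b2.
by rewrite xpair_eqE negb_and uv /= andbT; apply/hasPn.
Qed.

Section Full.
Variables (r : G) (T : bt G).
Hypotheses (lr : leaf r) (hT : unfolds r T) (UT : uniq (r :: labels T)).
Hypothesis cover : forall x, x \in r :: labels T.

(** A leaf has one neighbour and an inner vertex three; the parent and the children in [T] already
    account for all of them, so every edge joins a parent and a child. *)
Lemma adj_subt x y : adj x y ->
  exists p t, subt r T p t /\ (x = p /\ y = lab t \/ y = p /\ x = lab t).
Proof.
move=> xy; have := cover x; rewrite inE => /orP[/eqP xr|xT].
  have [rl _] := hT (subt_here r T); rewrite xr in xy *.
  exists r, T; split; first exact: subt_here.
  by left; rewrite (leaf_adj lr rl xy).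
have [p [t [st e]]] := subt_ex r xT.
have [pl] := hT st; move: pl; rewrite adj_sym.
case: t st e => [v|v L R] st e; rewrite [lab _]/= in e *; rewrite e => xp.
  by move=> lx; exists p, (Lf v); split=> //; right; rewrite e (leaf_adj lx xp xy).
case=> ix e1 e2 _; have := inner_adj ix xp xy; rewrite e1 e2 !inE.
case/or3P=> /eqP->.
- by exists p, (Nd v L R); split=> //; right; rewrite e.
- exists x, L; have [sL _] := subt_children st; rewrite -e; split=> //; by left.
- exists x, R; have [_ sR] := subt_children st; rewrite -e; split=> //; by left.
Qed.

Lemma subt_walk u t p t' : subt u t p t' ->
  ((p, lab t') \in walk u t) && ((lab t', p) \in walk u t).
Proof.
elim=> {u t p t'} [u [v|v L R]|u v L R p t _|u v L R p t _];
  rewrite /walk /= !inE ?mem_cat ?inE ?mem_cat ?inE ?eqxx ?orbT //.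
- by case/andP=> /orP[->|->] /orP[->|->]; rewrite ?orbT.
- by case/andP=> /orP[->|->] /orP[->|->]; rewrite ?orbT.
Qed.

Lemma adj_walk x y : adj x y -> (x, y) \in walk r T.
Proof. by case/adj_subt=> p [t [/subt_walk/andP[h1 h2] [[-> ->]|[-> ->]]]]. Qed.

(** The tour is a cycle of [walk_step] without repetitions, hence the orbit of its first dart. *)
Lemma leaf_cycle_unfolding : leaf_cycle (leaves T ++ [:: r]).
Proof.
exists (r, lab T); first by have [] := hT (subt_here r T).
have := walk_leaves hT; rewrite lr => <-.
have cw : fcycle (@walk_step G) (walk r T).
  have [pw lw] := walk_path hT.
  by rewrite /walk /= rcons_path pw lw /= /walk_step /=; move: lr; rewrite leafN_inner => /negPf->.
have := orbitE cw (walk_uniq UT) (mem_head _ _).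
by rewrite /= eqxx rot0 => ->.
Qed.

End Full.
End Unfolding.

(** The root [r] is not a label: being a leaf, it has a single neighbour, and [T] is everything that
    lies beyond this edge. *)
Definition unfolding (G : three_tree) (r : G) (T : bt G) : Prop :=
  [/\ leaf r, unfolds r T, uniq (r :: labels T) & forall x, x \in r :: labels T].

Lemma subt_inv (V : eqType) (u : V) (T : bt V) p t : subt u T p t ->
  match T with
  | Lf _ => p = u /\ t = T
  | Nd v L R => (p = u /\ t = T) \/ (subt v L p t \/ subt v R p t)
  end.
Proof. by case=> [v [x|x L R]|??????|??????]; auto. Qed.

Lemma filter_map_rot (A B : Type) (P : pred A) (f : A -> B) (i : nat) (s : seq A) :
  exists j, [seq f x | x <- rot i s & P x] = rot j [seq f x | x <- s & P x].
Proof.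
rewrite -{2}[s](cat_take_drop i) !filter_cat !map_cat.
by exists (size [seq f x | x <- take i s & P x]); rewrite rot_size_cat.
Qed.

Section UnfoldingTheory.
Variables (G : three_tree) (r : G) (T : bt G).
Hypothesis hrT : unfolding r T.
Implicit Types (u v w x y p a b c : G) (s q : seq G).

(** The tour contains every dart, so the orbit of another dart is the same cycle read from another
    start. *)
Lemma leaf_cycle_rot s : leaf_cycle s -> exists i, s = rot i (leaves T ++ [:: r]).
Proof.
have [lr hT UT cover] := hrT.
case=> -[x y] /= xy ->; have ew := adj_walk lr hT cover xy.
have cw : fcycle (@walk_step G) (walk r T).
  have [pw lw] := walk_path hT; rewrite /walk /= rcons_path pw lw /= /walk_step /=.
  by move: lr; rewrite leafN_inner => /negPf->.
rewrite (orbitE cw (walk_uniq UT) ew).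
have [j ->] := filter_map_rot (fun f : G * G => leaf f.2) snd (index (x, y) (walk r T)) (walk r T).
by exists j; rewrite (walk_leaves hT) lr.
Qed.

Lemma subt_of_inner w : w \in inners T -> exists p L R, subt r T p (Nd w L R).
Proof.
elim: T r => [//|v L IHL R IHR] u; rewrite /= inE mem_cat.
case/or3P=> [/eqP->|/(IHL v)[p [L' [R' st]]]|/(IHR v)[p [L' [R' st]]]].
- by exists u, L, R; constructor.
- by exists p, L', R'; constructor.
- by exists p, L', R'; constructor.
Qed.

Lemma subt_of_leaf w : w \in leaves T -> exists p, subt r T p (Lf w).
Proof.
elim: T r => [v|v L IHL R IHR] u /=; first by rewrite inE => /eqP->; exists u; constructor.
by rewrite mem_cat => /orP[/(IHL v)|/(IHR v)] [p st]; exists p; constructor.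
Qed.

Lemma inner_inners w : inner w = (w \in inners T).
Proof.
have [lr hT UT cover] := hrT; apply/idP/idP => [|/subt_of_inner[p [L [R /hT[_ []//]]]]].
apply: contraTT => wT; rewrite -leafN_inner.
have := cover w; rewrite inE mem_labels (negPf wT) orbF => /orP[/eqP->//|].
by case/subt_of_leaf=> p /hT[].
Qed.

Lemma leaf_leaves w : leaf w = (w \in leaves T ++ [:: r]).
Proof.
have [lr hT UT cover] := hrT; rewrite leafN_inner inner_inners mem_cat mem_seq1.
apply/idP/idP.
  by have := cover w; rewrite inE mem_labels => /or3P[->|->|->]; rewrite ?orbT.
have /= /andP[rT U] := UT.
case/orP=> [|/eqP->]; first exact: leaf_not_inner.
by apply: contra rT; exact: inners_labels.
Qed.

Lemma br_adj w x y : adj x y -> x != w -> y != w -> br T w x = br T w y.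
Proof.
have [lr hT UT cover] := hrT.
case/(adj_subt lr hT cover)=> p [t [st [[-> ->]|[-> ->]]]] h1 h2.
  exact: (br_edge UT st).
by rewrite (br_edge UT st).
Qed.

Lemma br_path w x q : path (@adj G) x q -> w \notin x :: q ->
  {in x :: q, forall v, br T w v = br T w x}.
Proof.
elim: q x => [|y q IH] x /=; first by move=> _ _ v; rewrite inE => /eqP->.
move=> /andP[xy py]; rewrite inE negb_or => /andP[wx wq] v.
rewrite inE => /orP[/eqP->//|vq]; rewrite (IH y) //.
rewrite (br_adj xy) //; first by rewrite eq_sym.
by move: wq; rewrite inE negb_or eq_sym => /andP[].
Qed.

Lemma simple_path_ex x y : exists q, simple_path x y q.
Proof.
have /connectP[p pp ->] := adj_connected x y.
by case: (shortenP pp) => q qq Uq _; exists q.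
Qed.

(** A simple path from [w] never returns to [w], so after its first step it stays in one branch. The
    neighbours of [w] lie in different branches; hence two paths meet outside [w] iff their ends lie
    in the same branch. *)
Lemma three_paths_br w a b c : w \in inners T -> a != w -> b != w -> c != w ->
  three_paths w a b c <-> uniq [:: br T w a; br T w b; br T w c].
Proof.
have [lr hT UT cover] := hrT => wT aw bw cw.
have [p [L [R st]]] := subt_of_inner wT.
have [b0 b1 b2] := br_node UT st.
have [/= wp [iw e1 e2 _]] := hT _ _ st; rewrite adj_sym in wp.
have step x q : simple_path w x q -> x != w -> exists u q',
    [/\ q = u :: q', adj w u, path (@adj G) u q', w \notin u :: q' & last u q' = x].
  case: q => [|u q] [/= pq lq]; first by rewrite lq eqxx.
  by move: pq => /andP[wu pq] /andP[U _] _; exists u, q.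
have nb u v : adj w u -> adj w v -> br T w u = br T w v -> u = v.
  move=> /(inner_adj iw wp) wu /(inner_adj iw wp).
  move: wu; rewrite e1 e2 !inE => /or3P[]/eqP-> /or3P[]/eqP->//; rewrite ?b0 ?b1 ?b2 //.
have sep x y q q' : simple_path w x q -> simple_path w y q' -> x != w -> y != w ->
    share_only w q q' <-> br T w x != br T w y.
  move=> hq hq' xw yw; have [u [s [eq wu ps ws ls]]] := step _ _ hq xw.
  have [u' [s' [eq' wu' ps' ws' ls']]] := step _ _ hq' yw.
  have hx : br T w x = br T w u by apply: br_path ws _ _; rewrite // -ls mem_last.
  have hy : br T w y = br T w u' by apply: br_path ws' _ _; rewrite // -ls' mem_last.
  split=> [h|h v].
    rewrite hx hy; apply/eqP => /nb e.
    have : u = w by apply: h; rewrite ?eq ?eq' ?inE ?eqxx ?orbT // e // eqxx orbT.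
    by move=> uw; move: wu; rewrite uw adj_irr.
  rewrite inE => /orP[/eqP//|vq]; rewrite inE => /orP[/eqP//|vq'].
  have h1 : br T w v = br T w u by apply: (br_path ps ws); rewrite -eq.
  have h2 : br T w v = br T w u' by apply: (br_path ps' ws'); rewrite -eq'.
  by move: h; rewrite hx hy -h1 -h2 eqxx.
have E : uniq [:: br T w a; br T w b; br T w c] <->
    [/\ br T w a != br T w b, br T w a != br T w c & br T w b != br T w c].
  rewrite /= !inE negb_or andbT; split; first by case/andP=> /andP[].
  by case=> -> -> ->.
rewrite E; split=> [[q1 [q2 [q3 [[h1 h2 h3] [s12 s13 s23]]]]]|[h12 h13 h23]].
  by split; [apply/(sep _ _ _ _ h1 h2)|apply/(sep _ _ _ _ h1 h3)|apply/(sep _ _ _ _ h2 h3)].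
have [q1 h1] := simple_path_ex w a; have [q2 h2] := simple_path_ex w b.
have [q3 h3] := simple_path_ex w c.
exists q1, q2, q3; split; split=> //.
- by apply/(sep _ _ _ _ h1 h2).
- by apply/(sep _ _ _ _ h1 h3).
- by apply/(sep _ _ _ _ h2 h3).
Qed.

End UnfoldingTheory.

(** * Existence of unfoldings *)

Section UnfoldingExists.
Variable G : three_tree.
Implicit Types (u v w x y r : G) (p q : seq G).

Definition adj_off u := [rel x y : G | [&& adj x y, x != u & y != u]].

Lemma adj_off_sym u : connect_sym (adj_off u).
Proof.
apply: sym_connect_sym => x y /=; rewrite adj_sym.
by case: (x != u); case: (y != u); rewrite ?andbT ?andbF.
Qed.

Lemma adj_off_path u x p : path (adj_off u) x p -> path (@adj G) x p.
Proof. by apply: sub_path => y z /and3P[]. Qed.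

Lemma adj_off_notin u x p : path (adj_off u) x p -> x != u -> u \notin x :: p.
Proof.
elim: p x => [|y p IH] x /=; first by rewrite inE eq_sym.
by case/andP=> /and3P[_ _ yu] /IH h xu; rewrite inE negb_or eq_sym xu h.
Qed.

Lemma path_adj_off u x p : path (@adj G) x p -> u \notin x :: p -> path (adj_off u) x p.
Proof.
elim: p x => [|y p IH] x //= /andP[xy pp].
rewrite !inE !negb_or => /and3P[ux uy up].
by rewrite xy ![_ == u]eq_sym ux uy IH // inE negb_or uy.
Qed.

(** A path between two different neighbours of [v] that avoids [v] would close up through [v] to a
    cycle of length at least 3. *)
Lemma nbrs_separated v x y : adj v x -> adj v y -> connect (adj_off v) x y -> x = y.
Proof.
move=> vx vy /connectP[p pp yE]; case/shortenP: pp yE => q pq Uq _ yE.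
have xv : x != v by apply/eqP => e; move: vx; rewrite e adj_irr.
have nv := adj_off_notin pq xv.
have : (size (v :: x :: q) <= 2)%N.
  apply: (@adj_acyclic G); rewrite /ucycle; apply/andP; split.
    rewrite /= vx rcons_path (adj_off_path pq) /=.
    by rewrite -yE adj_sym.
  by rewrite cons_uniq nv.
by case: q yE {pq Uq nv} => // ->.
Qed.

(** The labels of the tree are the component of [v] after removal of [u], and the induction is on
    its size. At an inner [v] the two subtrees come from the components of its other neighbours
    after removal of [v]. *)
Lemma unfolds_ex n u v : adj u v -> (#|connect (adj_off u) v| <= n)%N ->
  exists T, [/\ lab T = v, unfolds u T, uniq (labels T) &
    forall x, (x \in labels T) = connect (adj_off u) v x].
Proof.
elim: n u v => [|n IH] u v uv cn.
  move: cn; rewrite leqn0 => /eqP/card0_eq/(_ v).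
  by rewrite [_ \in _]connect0.
have vu : v != u by apply/eqP => e; move: uv; rewrite e adj_irr.
have vu' : adj v u by rewrite adj_sym.
(* A path from [v'] that avoids [v] avoids [u] too, since otherwise it would join two neighbours of
   [v]. Thus the components are nested, and strictly so because [v] is lost. *)
have branch v' x : adj v v' -> v' != u -> connect (adj_off v) v' x ->
    connect (adj_off u) v x && (x != v).
  move=> vv' v'u /connectP[p pp xE].
  have v'v : v' != v by apply/eqP => e; move: vv'; rewrite e adj_irr.
  have nv := adj_off_notin pp v'v.
  apply/andP; split; last by apply: contraNneq nv => <-; rewrite xE mem_last.
  apply: (@connect_trans _ _ v'); first by apply: connect1; rewrite /= vv' vu.
  apply/connectP; exists p => //; apply: path_adj_off (adj_off_path pp) _.
  apply/negP => up; case/eqP: v'u; apply: (nbrs_separated vv' vu').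
  exact: (path_connect pp).
have sub v' : adj v v' -> v' != u -> (#|connect (adj_off v) v'| <= n)%N.
  move=> vv' v'u; rewrite -ltnS; apply: leq_trans cn; apply: proper_card.
  apply/properP; split; first by apply/fintype.subsetP => x /(branch _ _ vv' v'u)/andP[].
  exists v; first exact: connect0.
  by apply/negP => /(branch _ _ vv' v'u); rewrite eqxx andbF.
have cover x : connect (adj_off u) v x -> x != v -> exists v',
    [/\ adj v v', v' != u & connect (adj_off v) v' x].
  case/connectP=> p pp xE xv; case/shortenP: pp xE => -[|v' q] /= pq Uq _ xE.
    by rewrite xE eqxx in xv.
  move: pq Uq => /andP[/and3P[vv' _ v'u] pq] /andP[nv _].
  exists v'; split=> //; apply/connectP; exists q => //.
  exact: path_adj_off (adj_off_path pq) nv.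
case: (degree13 v) => dv.
  have lv : leaf v by apply/eqP.
  exists (Lf v); split=> //.
    by move=> p t st; have [-> ->] := subt_inv st.
  move=> x; rewrite inE; apply/eqP/idP => [->|h]; first exact: connect0.
  apply/eqP; apply: contraT => xv; have [v' [vv' v'u _]] := cover _ h xv.
  by rewrite (leaf_adj lv vu' vv') eqxx in v'u.
have iv : inner v by apply/eqP.
have [v1 v2 e U] := inner_nxt iv vu'.
pose y := nxt v u; pose z := nxt v y.
rewrite -/y -/z in v1 v2 e U.
have [yu zu yz] : [/\ y != u, z != u & y != z].
  move: U; rewrite /= !inE negb_or ![u == _]eq_sym => /and3P[/andP[-> ->] -> _].
  by [].
have [L [lL hL UL mL]] := IH v y v1 (sub _ v1 yu).
have [R [lR hR UR mR]] := IH v z v2 (sub _ v2 zu).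
exists (Nd v L R); split=> //.
- move=> p t st.
  have [[-> ->]|[/hL//|/hR//]] := subt_inv st.
  by split=> //; rewrite lL lR.
- rewrite /= mem_cat negb_or cat_uniq UL UR andbT.
  have nv v' : adj v v' -> v' != u -> ~~ connect (adj_off v) v' v.
    by move=> h1 h2; apply/negP => /(branch _ _ h1 h2); rewrite eqxx andbF.
  rewrite mL mR !nv //=; apply/hasPn => x; rewrite mR => zx; apply/negP => /=.
  rewrite mL => yx; move/eqP: yz; apply; apply: (nbrs_separated v1 v2).
  by apply: connect_trans yx _; rewrite adj_off_sym.
- move=> x; rewrite /= inE mem_cat mL mR; apply/or3P/idP.
    by case=> [/eqP->|/(branch _ _ v1 yu)/andP[]|/(branch _ _ v2 zu)/andP[]]; rewrite ?connect0.
  move=> h; have [->|xv] := eqVneq x v; first exact: Or31.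
  have [v' [vv' v'u c]] := cover _ h xv.
  have := inner_adj iv vu' vv'; rewrite -/y -/z !inE (negPf v'u) /=.
  by case/orP=> /eqP e'; rewrite e' in c; [apply: Or32|apply: Or33].
Qed.

Lemma unfolding_ex r : leaf r -> exists T, unfolding r T.
Proof.
move=> lr; have [v rv] : exists v, adj r v.
  by move: (lr) => /cards1P[v e]; exists v; have := set11 v; rewrite -e inE.
have [T [lT hT UT mT]] := unfolds_ex rv (leqnn _).
exists T; split=> //.
  rewrite cons_uniq UT andbT mT; apply/negP => /connectP[p pp rE].
  have vr : v != r by apply/eqP => e; move: rv; rewrite e adj_irr.
  by have := adj_off_notin pp vr; rewrite rE mem_last.
move=> x; rewrite inE mT; have [//|xr] := eqVneq x r.
have /connectP[p pp xE] := adj_connected r x.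
case/shortenP: pp xE => -[|v' q] /= pq Uq _ xE; first by rewrite xE eqxx in xr.
move: pq Uq => /andP[rv' pq] /andP[nr _].
rewrite (leaf_adj lr rv rv') in pq xE nr.
by apply/connectP; exists q => //; exact: path_adj_off.
Qed.

(** Unfold from any edge and descend to the left: the last vertex is a leaf. *)
Lemma leaf_ex : (0 < #|G|)%N -> exists r : G, leaf r.
Proof.
move=> /card_gt0P[u _]; have [v uv] : exists v, adj u v.
  have : (0 < degree (@adj G) u)%N by case: (degree13 u) => ->.
  by rewrite /degree => /card_gt0P[v]; rewrite inE; exists v.
have [T [_ hT _ _]] := unfolds_ex uv (leqnn _).
elim: T u hT {uv} => [x|x L IHL R _] u hT; last exact: IHL (unfolds_l hT).
by exists x; have [] := hT _ _ (subt_here u (Lf x)).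
Qed.

End UnfoldingExists.

(** * The 3-tree of a labelled binary tree *)

Section Realization.
Variables (V : finType) (r : V) (T : bt V).
Hypotheses (UT : uniq (r :: labels T)) (cover : forall x, x \in r :: labels T).
Implicit Types (u v w x y p : V) (t : bt V).

(** The lists are ordered: parent, left, right is the cyclic order that [nnxt] reads off with
    [next]. *)
Fixpoint nbrs u t v : seq V :=
  match t with
  | Lf x => if v == x then [:: u] else [::]
  | Nd x L R => if v == x then [:: u; lab L; lab R] else nbrs x L v ++ nbrs x R v
  end.

Definition all_nbrs v := if v == r then [:: lab T] else nbrs r T v.

Lemma nbrs_out u t v : v \notin labels t -> nbrs u t v = [::].
Proof.
elim: t u => [x|x L IHL R IHR] u /=; first by rewrite inE => /negPf->.
by rewrite inE mem_cat !negb_or => /and3P[/negPf-> /IHL-> /IHR->].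
Qed.

Lemma nbrs_subt u t p t' : uniq (labels t) -> subt u t p t' ->
  nbrs u t (lab t') =
  match t' with Lf _ => [:: p] | Nd _ L R => [:: p; lab L; lab R] end.
Proof.
move=> + st; elim: st => {u t p t'} [u [x|x L R] _|u v L R p t st IH U|u v L R p t st IH U].
- by rewrite /= eqxx.
- by rewrite /= eqxx.
- have [UL _ vL _ d] := uniq_Nd U; have [_ tL] := subt_labels st.
  have {}tL : lab t \in labels L by exact/tL/lab_labels.
  rewrite /=; case: eqP => [e|_]; first by rewrite -e tL in vL.
  by rewrite IH // nbrs_out ?cats0 // d.
- have [_ UR _ vR d] := uniq_Nd U; have [_ tR] := subt_labels st.
  have {}tR : lab t \in labels R by exact/tR/lab_labels.
  rewrite /=; case: eqP => [e|_]; first by rewrite -e tR in vR.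
  by rewrite IH // [nbrs v L _]nbrs_out //; apply/negP => /d; rewrite tR.
Qed.

Lemma subt_parent u t p t' : subt u t p t' -> p = u /\ t' = t \/
  exists q L R, subt u t q (Nd p L R) /\ (t' = L \/ t' = R).
Proof.
elim=> {u t p t'} [u t|u v L R p t _ IH|u v L R p t _ IH]; first by left.
- right; case: IH => [[-> ->]|[q [L' [R' [st h]]]]].
    by exists u, L, R; split; [constructor|left].
  by exists q, L', R'; split=> //; constructor.
- right; case: IH => [[-> ->]|[q [L' [R' [st h]]]]].
    by exists u, L, R; split; [constructor|right].
  by exists q, L', R'; split=> //; constructor.
Qed.

Lemma subt_lab_neq p t : subt r T p t -> lab t != r.
Proof.
move=> /subt_labels[_ tT]; have /= /andP[rT _] := UT.
by apply: contraNneq rT => <-; exact/tT/lab_labels.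
Qed.

Lemma all_nbrs_subt p t : subt r T p t ->
  all_nbrs (lab t) = match t with Lf _ => [:: p] | Nd _ L R => [:: p; lab L; lab R] end.
Proof.
move=> st; rewrite /all_nbrs (negPf (subt_lab_neq st)).
by apply: nbrs_subt st; have /= /andP[_] := UT.
Qed.

Lemma vertex_subt x : x = r \/ exists p t, subt r T p t /\ lab t = x.
Proof.
have := cover x; rewrite inE => /orP[/eqP->|xT]; first by left.
by right; exact: subt_ex.
Qed.

Definition nadj x y := y \in all_nbrs x.

Lemma nadjP x y : nadj x y <->
  exists p t, subt r T p t /\ (x = p /\ y = lab t \/ y = p /\ x = lab t).
Proof.
rewrite /nadj; split.
  case: (vertex_subt x) => [->|[p [t [st <-]]]].
    rewrite /all_nbrs eqxx inE => /eqP->.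
    by exists r, T; split; [constructor|left].
  rewrite (all_nbrs_subt st); case: t st => [v|v L R] st; rewrite !inE.
    by move/eqP->; exists p, (Lf v); split=> //; right.
  have [sL sR] := subt_children st.
  case/or3P=> /eqP->; [exists p, (Nd v L R)|exists v, L|exists v, R]; split=> //.
  - by right.
  - by left.
  - by left.
case=> p [t [st [[-> ->]|[-> ->]]]]; last first.
  by rewrite (all_nbrs_subt st); case: t {st} => *; rewrite mem_head.
case: (subt_parent st) => [[-> ->]|[q [L [R [sq h]]]]].
  by rewrite /all_nbrs eqxx mem_head.
by rewrite (all_nbrs_subt sq) !inE; case: h => ->; rewrite eqxx ?orbT.
Qed.

Lemma nadj_sym : symmetric nadj.
Proof.
by move=> x y; apply/idP/idP => /nadjP[p [t [st h]]]; apply/nadjP; exists p, t;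
  split=> //; case: h; auto.
Qed.

Lemma subt_neq p t : subt r T p t -> p != lab t.
Proof.
move=> st; case: (subt_parent st) => [[-> ->]|[q [L [R [sq h]]]]].
  by rewrite eq_sym; apply: subt_lab_neq; exact: subt_here.
have [b0 b1 b2] := br_node UT sq; have [_ sT] := subt_labels sq.
have /uniq_Nd[_ _ pL pR _] : uniq (labels (Nd p L R)).
  by apply: subt_uniq sq _; have /= /andP[] := UT.
by apply/eqP => e; case: h => et; move: (lab_labels t); rewrite -e et ?(negPf pL) ?(negPf pR).
Qed.

Lemma nadj_irr : irreflexive nadj.
Proof.
move=> x; apply/negP => /nadjP[p [t [/subt_neq + [[-> e]|[-> e]]]]];
by rewrite -e eqxx.
Qed.

Lemma nadj_connected x y : connect nadj x y.
Proof.
have rc z : connect nadj r z.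
  have := cover z; rewrite inE => /orP[/eqP->|]; first exact: connect0.
  have : forall p t, subt r T p t -> nadj p (lab t).
    by move=> p t st; apply/nadjP; exists p, t; split=> //; left.
  elim: (T) (r) => [v|v L IHL R IHR] u h.
    by rewrite inE => /eqP->; apply: connect1; apply: h (subt_here _ _).
  rewrite /= inE mem_cat => zT.
  have uv : connect nadj u v by apply: connect1; apply: h (subt_here _ _).
  case/or3P: zT => [/eqP->//|zL|zR]; apply: connect_trans uv _.
    by apply: IHL zL => p t st; apply: h; constructor.
  by apply: IHR zR => p t st; apply: h; constructor.
by apply: connect_trans (rc y); rewrite (sym_connect_sym nadj_sym).
Qed.

Lemma nadj_br w x y : nadj x y -> x != w -> y != w -> br T w x = br T w y.
Proof.
case/nadjP=> p [t [st [[-> ->]|[-> ->]]]] h1 h2; first exact: (br_edge UT st).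
by rewrite (br_edge UT st).
Qed.

Lemma nadj_nbr_inj w x y : nadj w x -> nadj w y -> br T w x = br T w y -> x = y.
Proof.
rewrite /nadj; case: (vertex_subt w) => [->|[p [t [st <-]]]].
  by rewrite /all_nbrs eqxx !inE => /eqP-> /eqP->.
rewrite (all_nbrs_subt st); case: t st => [v|v L R] st.
  by rewrite !inE => /eqP-> /eqP->.
have [b0 b1 b2] := br_node UT st.
by rewrite !inE => /or3P[]/eqP-> /or3P[]/eqP->//; rewrite ?b0 ?b1 ?b2.
Qed.

(** The part of a cycle between the two neighbours of [w] avoids [w] and so stays in one branch,
    whereas different neighbours of [w] lie in different branches. *)
Lemma nadj_acyclic (c : seq V) : ucycle nadj c -> (size c <= 2)%N.
Proof.
case: c => [|w [|x [|y c]]] //; case/andP => + U.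
rewrite /= rcons_path => /and4P[wx xy pc lw].
rewrite nadj_sym in lw; have := nadj_nbr_inj wx lw.
have -> : br T w x = br T w (last x (y :: c)).
  have wc : w \notin [:: x, y & c] by move: U; rewrite cons_uniq => /andP[].
  have : path nadj x (y :: c) by rewrite /= xy.
  move: wc {U pc lw wx xy}; elim: (y :: c) x => //= z s IH x wc /andP[xz ps].
  move: wc; rewrite !inE !negb_or => /and3P[wx wz ws].
  rewrite (nadj_br xz) 1?[_ == w]eq_sym //.
  by apply: IH ps; rewrite inE negb_or wz.
move/(_ erefl) => e; move: U; rewrite cons_uniq => /andP[_].
by rewrite cons_uniq e [last _ _]/= mem_last.
Qed.

Lemma nadj_degree v : degree nadj v = size (all_nbrs v) /\ uniq (all_nbrs v).
Proof.
have U : uniq (all_nbrs v).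
  case: (vertex_subt v) => [->|[p [t [st <-]]]]; first by rewrite /all_nbrs eqxx.
  rewrite (all_nbrs_subt st); case: t st => [//|x L R] st.
  have [b0 b1 b2] := br_node UT st; apply: (@map_uniq _ _ (br T x)).
  by rewrite /= b0 b1 b2.
by split=> //; rewrite /degree -(card_uniqP U); apply: eq_card => y; rewrite !inE.
Qed.

Lemma nadj_degree13 v : degree nadj v = 1 \/ degree nadj v = 3.
Proof.
rewrite (nadj_degree v).1; case: (vertex_subt v) => [->|[p [t [st <-]]]].
  by rewrite /all_nbrs eqxx; left.
by rewrite (all_nbrs_subt st); case: t {st} => *; [left|right].
Qed.

Definition nnxt v u := next (all_nbrs v) u.

Lemma nnxt_cyclic v u : degree nadj v = 3 -> nadj v u ->
  [/\ nadj v (nnxt v u), nnxt v u != u & nnxt v (nnxt v (nnxt v u)) = u].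
Proof.
rewrite /nadj /nnxt; have [-> U] := nadj_degree v.
case: (all_nbrs v) U => [|x [|y [|z []]]] //=; rewrite !inE negb_or !andbT.
move=> /andP[/andP[/negPf xy /negPf xz] /negPf yz] _.
have [yx zx zy] : [/\ (y == x) = false, (z == x) = false & (z == y) = false].
  by split; rewrite eq_sym.
by case/or3P=> /eqP->; rewrite ?eqxx ?xy ?xz ?yz ?yx ?zx ?zy ?eqxx ?orbT ?xy ?xz ?yz ?yx ?zx ?zy
  ?eqxx ?xy ?xz ?yz ?yx ?zx ?zy ?eqxx.
Qed.


Definition realization : three_tree :=
  ThreeTree nadj_sym nadj_irr nadj_connected nadj_acyclic nadj_degree13 nnxt_cyclic.

Lemma realization_unfolding : @unfolding realization r T.
Proof.
have dr : @leaf realization r.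
  by rewrite /leaf /= (nadj_degree r).1 /all_nbrs eqxx.
split=> // p t st; split; first by apply/nadjP; exists p, t; split=> //; left.
have e := all_nbrs_subt st; case: t st e => [v|v L R] st e.
  by rewrite /leaf /= (nadj_degree v).1 e.
have U := (nadj_degree v).2; rewrite e /= !inE negb_or andbT in U.
case/andP: U => /andP[n1 n2] n3.
rewrite /inner /= (nadj_degree v).1 /nnxt e /= !eqxx; split=> //.
  by rewrite [_ == p]eq_sym (negPf n1) ?eqxx.
by rewrite [_ == p]eq_sym (negPf n2) [_ == lab L]eq_sym (negPf n3) ?eqxx.
Qed.

End Realization.

(** * Rotations of sequences *)

Definition rotation (A : Type) (s t : seq A) := exists k, t = rot k s.

Section Rotations.
Variable A : eqType.
Implicit Types s t u : seq A.

Lemma rotation_small s t : rotation s t -> exists2 k, (k <= size s)%N & t = rot k s.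
Proof.
case=> k ->; case: (leqP k (size s)) => [ks|sk]; first by exists k.
by exists 0 => //; rewrite rot0 rot_oversize // ltnW.
Qed.

Lemma rotation_sym s t : rotation s t -> rotation t s.
Proof. by case=> k ->; exists (size s - k); have := rotK k s; rewrite /rotr size_rot. Qed.

Lemma rotation_trans s t u : rotation s t -> rotation t u -> rotation s u.
Proof.
move=> /rotation_small[k ks ->] /rotation_small[l ls ->].
rewrite size_rot in ls; rewrite rot_add_mod //; by eexists.
Qed.

Lemma rotation_map (B : Type) (f : A -> B) s t :
  rotation s t -> rotation (map f s) (map f t).
Proof. by case=> k ->; exists k; rewrite map_rot. Qed.

Lemma rotation_rev s t : rotation s t -> rotation (rev s) (rev t).
Proof.
by case=> k ->; rewrite rev_rot; apply: rotation_sym; exists k; rewrite rotrK.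
Qed.

Lemma rotation_catC s t : rotation (s ++ t) (t ++ s).
Proof. by exists (size s); rewrite rot_size_cat. Qed.

(** Without repetitions, the position of the first entry determines the rotation. *)
Lemma rotation_cons_eq x s t : uniq (x :: s) -> rotation (x :: s) (x :: t) -> t = s.
Proof.
move=> U [k]; have [ks|sk] := leqP (size (x :: s)) k; first by rewrite rot_oversize // => -[].
move=> e; have : index x (x :: s) = k.
  have : x = nth x (x :: s) k by move: e; rewrite /rot (drop_nth x) // => -[].
  by move=> {1}->; rewrite index_uniq.
by rewrite /= eqxx => k0; move: e; rewrite -k0 rot0 => -[].
Qed.

End Rotations.

(** * Isomorphism of trees that separate leaves alike *)

Section TreeIsomorphism.
Variables (G G' : three_tree) (psi : G -> G').
Hypotheses (bij : bijective psi) (psi_leaf : forall v, leaf (psi v) = leaf v).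
Hypothesis psi_paths : forall w a b c, inner w -> leaf a -> leaf b -> leaf c ->
  uniq [:: a; b; c] -> three_paths w a b c ->
  three_paths (psi w) (psi a) (psi b) (psi c).

Lemma psi_inner v : inner (psi v) = inner v.
Proof. by rewrite -[LHS]negbK -[RHS]negbK -!leafN_inner psi_leaf. Qed.

(** The vertex [lca T x y] separates [r], [x] and [y]; its image separates their images, and by
    [lca_br] only their [lca] does so. *)
Lemma unfolding_lca (r : G) T T' : unfolding r T -> unfolding (psi r) T' ->
  {in leaves T &, forall x y, x != y -> lca T' (psi x) (psi y) = psi (lca T x y)}.
Proof.
move=> h h' x y xT yT xy; have [lr hT UT cover] := h; have [lr' hT' UT' _] := h'.
have wT := lca_inners xT yT xy; set w := lca T x y in wT *.
have inj := bij_inj bij.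
have /andP[rT UlT] := UT; have /andP[rT' UlT'] := UT'.
have lf z : z \in leaves T -> leaf z by move=> zT; rewrite (leaf_leaves h) mem_cat zT.
have lT z : z \in leaves T -> z != r.
  by move=> zT; apply: contraNneq rT => <-; exact: leaves_labels.
have fw : inner w by rewrite (inner_inners h).
have wl z : leaf z -> z != w by move=> lz; apply: contraTneq lz => ->; rewrite leafN_inner fw.
have lT' z : z \in leaves T -> psi z \in leaves T'.
  move=> zT; have := lf _ zT; rewrite -psi_leaf (leaf_leaves h') mem_cat mem_seq1.
  by rewrite (inj_eq inj) (negPf (lT _ zT)) orbF.
have wT' : psi w \in inners T' by rewrite -(inner_inners h') psi_inner.
have : three_paths w r x y.
  apply/(three_paths_br h wT); rewrite ?wl ?lr ?lf //.
  by rewrite (br_out _ rT) (lca_br UlT) // eqxx.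
move/psi_paths; rewrite fw lr !lf // => /(_ isT isT isT isT).
have -> : uniq [:: r; x; y] by rewrite /= !inE negb_or ![r == _]eq_sym !lT //= xy.
move=> /(_ isT) /(three_paths_br h' wT').
rewrite !(inj_eq inj) !wl ?lr ?lf // => /(_ isT isT isT).
rewrite (br_out _ rT') (lca_br UlT') ?lT' ?(inj_eq inj) //.
by move/eqP.
Qed.

(* [tw] is the identity if [psi] preserves the order of the leaves and [mirror]
   if it reverses it. *)
Lemma unfolding_image (tw : forall V : Type, bt V -> bt V) (r : G) T T' :
  unfolding r T -> unfolding (psi r) T' ->
  leaves T' = map psi (leaves (tw G T)) ->
  (forall x, (x \in leaves (tw G T)) = (x \in leaves T)) ->
  perm_eq (labels (tw G T)) (labels T) ->
  (forall x y, lca (tw G T) x y = lca T x y) ->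
  T' = map_bt psi (tw G T).
Proof.
move=> h h' el ml pl ll; have [_ _ /andP[_ UT] _] := h; have [_ _ /andP[_ UT'] _] := h'.
have inj := bij_inj bij.
apply: leaves_lca_inj => //.
- by rewrite labels_map map_inj_uniq // (perm_uniq pl).
- by rewrite leaves_map.
- move=> x' y'; rewrite el => /mapP[x xT ->] /mapP[y yT ->].
  rewrite (inj_eq inj) lca_map // ll => xy.
  by apply: (unfolding_lca h h'); rewrite -?ml.
Qed.

(** Both trees are unfolded from corresponding leaves. With the root fixed, rotations of the leaf
    cycle leave a single linear order up to reversal, so the second unfolding is the image of the
    first or of its mirror image. Edges and cyclic orders are read off from this equality. *)
Lemma tree_isomorphism (s : seq G) (s' : seq G') (r : G) : leaf r ->
  leaf_cycle s -> leaf_cycle s' ->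
  rotation (map psi s) s' \/ rotation (map psi (rev s)) s' ->
  (forall x y, adj x y -> adj (psi x) (psi y)) /\
  (preserves_orders psi \/ reverses_orders psi).
Proof.
move=> lr ls ls' rs.
have [T h] := unfolding_ex lr.
have lr' : leaf (psi r) by rewrite psi_leaf.
have [T' h'] := unfolding_ex lr'.
have [_ hT UT cover] := h; have [_ hT' UT' _] := h'.
have /andP[rT UlT] := UT; have /andP[rT' UlT'] := UT'.
have inj := bij_inj bij.
have st : rotation s (r :: leaves T).
  apply: rotation_sym; apply: rotation_trans (rotation_sym (rotation_catC (leaves T) [:: r])) _.
  exact: leaf_cycle_rot.
have st' : rotation s' (psi r :: leaves T').
  apply: rotation_sym; apply: rotation_trans (rotation_sym (rotation_catC (leaves T') [:: psi r])) _.
  exact: leaf_cycle_rot.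
have Ul' : uniq (psi r :: leaves T').
  rewrite cons_uniq uniq_leaves // andbT.
  by apply: contra rT'; exact: leaves_labels.
have fin (tw : forall V : Type, bt V -> bt V) :
  T' = map_bt psi (tw G T) -> (forall t, lab (tw G t) = lab t) ->
  (forall p t, subt r T p t -> subt r (tw G T) p (tw G t)) ->
  forall x y, adj x y -> adj (psi x) (psi y).
  move=> e lt stw x y /(adj_subt lr hT cover)[p [t [/stw/(subt_map psi) + xy]]].
  rewrite -e => /hT'[+ _]; rewrite lab_map lt.
  by case: xy => [[-> ->]|[-> ->]] //; rewrite adj_sym.
have nx w u : inner w -> adj w u -> exists p L R, subt r T p (Nd w L R) /\ u \in [:: p; lab L; lab R].
  rewrite (inner_inners h) => /(@subt_of_inner _ r T)[p [L [R sp]]] wu.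
  have [wp [iw e1 e2 e3]] := hT _ _ sp.
  exists p, L, R; split=> //; rewrite -e2 -e1; apply: inner_adj => //.
  by rewrite adj_sym.
case: rs => rs.
  have e : leaves T' = map psi (leaves T).
    apply: (@rotation_cons_eq _ (psi r)).
      by rewrite (map_inj_uniq inj (r :: leaves T)) cons_uniq uniq_leaves // andbT;
         apply: contra rT; exact: leaves_labels.
    apply: rotation_trans st'; apply: rotation_trans rs; apply: rotation_sym.
    exact: rotation_map st.
  have {}e : T' = map_bt psi T by exact: (unfolding_image (tw := fun _ => id) h h').
  split; first exact: (fin (fun _ => id)).
  left=> w u iw wu; have [p [L [R [sp up]]]] := nx _ _ iw wu.
  have [_ [_ e1 e2 e3]] := hT _ _ sp.
  have := subt_map psi sp; rewrite -e => /hT'[_ [_]]; rewrite !lab_map => f1 f2 f3.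
  by move: up; rewrite !inE => /or3P[]/eqP->; rewrite ?e1 ?e2 ?e3.
have e : leaves T' = map psi (leaves (mirror T)).
  rewrite leaves_mirror; apply: (@rotation_cons_eq _ (psi r)).
    rewrite (map_inj_uniq inj (r :: rev (leaves T))) cons_uniq mem_rev rev_uniq.
    by rewrite uniq_leaves // andbT; apply: contra rT; exact: leaves_labels.
  apply: rotation_trans st'; apply: rotation_trans rs.
  have q : rotation (r :: rev (leaves T)) (rev s).
    apply: (@rotation_trans _ _ (rev (r :: leaves T))).
      by rewrite rev_cons -cats1; exact: (rotation_catC [:: r]).
    by apply: rotation_rev; exact: rotation_sym.
  exact: (rotation_map psi q).
have {}e : T' = map_bt psi (mirror T).
  apply: (unfolding_image h h' e).
  - by move=> x; rewrite leaves_mirror mem_rev.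
  - exact: labels_mirror.
  - by move=> x y; rewrite lca_mirror // uniq_leaves.
split; first by apply: (fin mirror) => //; [exact: lab_mirror|move=> *; exact: subt_mirror].
right=> w u iw wu; have [p [L [R [sp up]]]] := nx _ _ iw wu.
have [_ [_ e1 e2 e3]] := hT _ _ sp.
have := subt_map psi (subt_mirror sp); rewrite -e => /hT'[_ [_]].
rewrite !lab_map !lab_mirror => f1 f2 f3.
by move: up; rewrite !inE => /or3P[]/eqP->; rewrite ?e1 ?e2 ?e3.
Qed.

End TreeIsomorphism.

(** * Plane geometry *)

Local Open Scope classical_set_scope.
Local Open Scope ring_scope.

Section Plane.
Variable R : realType.
Implicit Types (a b c d p q u v w x y z : plane R) (A B K : set (plane R)).

Definition cx a : R := a 0 0.
Definition cy a : R := a 0 1.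

(** Twice the signed area of the triangle, positive when [a], [b], [c] are in counterclockwise
    order. *)
Definition det a b c : R := (cx b - cx a) * (cy c - cy a) - (cy b - cy a) * (cx c - cx a).

Lemma plane_eq a b : cx a = cx b -> cy a = cy b -> a = b.
Proof.
move=> ex ey; apply/rowP => -[[|[|//]] i].
  by rewrite (_ : Ordinal i = 0) //; apply: val_inj.
by rewrite (_ : Ordinal i = 1) //; apply: val_inj.
Qed.

Definition pt (x y : R) : plane R := \row_(i < 2) (if i == 0 then x else y).

Lemma cx_pt (x y : R) : cx (pt x y) = x. Proof. by rewrite /cx mxE. Qed.
Lemma cy_pt (x y : R) : cy (pt x y) = y. Proof. by rewrite /cy mxE. Qed.
Lemma cxD a b : cx (a + b) = cx a + cx b. Proof. by rewrite /cx mxE. Qed.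
Lemma cyD a b : cy (a + b) = cy a + cy b. Proof. by rewrite /cy mxE. Qed.
Lemma cxZ (t : R) a : cx (t *: a) = t * cx a. Proof. by rewrite /cx mxE. Qed.
Lemma cyZ (t : R) a : cy (t *: a) = t * cy a. Proof. by rewrite /cy mxE. Qed.
Lemma cxN a : cx (- a) = - cx a. Proof. by rewrite /cx mxE. Qed.
Lemma cyN a : cy (- a) = - cy a. Proof. by rewrite /cy mxE. Qed.
Lemma cx0 : cx 0 = 0. Proof. by rewrite /cx mxE. Qed.
Lemma cy0 : cy 0 = 0. Proof. by rewrite /cy mxE. Qed.

Definition cE := (cx_pt, cy_pt, cxD, cyD, cxZ, cyZ, cxN, cyN, cx0, cy0).

Lemma det_rot a b c : det b c a = det a b c.
Proof. by rewrite /det; ring. Qed.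

Lemma det_swap a b c : det b a c = - det a b c.
Proof. by rewrite /det; ring. Qed.

Lemma det_swapr a b c : det a c b = - det a b c.
Proof. by rewrite /det; ring. Qed.

Lemma det_sum a b c w : det a b w + det b c w + det c a w = det a b c.
Proof. by rewrite /det; ring. Qed.

Lemma det_aa a c : det a a c = 0.
Proof. by rewrite /det; ring. Qed.

Lemma det_aba a b : det a b a = 0.
Proof. by rewrite /det; ring. Qed.

Lemma det_abb a b : det a b b = 0.
Proof. by rewrite /det; ring. Qed.

Lemma det_conv a b x y (t : R) :
  det a b (t *: x + (1 - t) *: y) = t * det a b x + (1 - t) * det a b y.
Proof. by rewrite /det !cE; ring. Qed.

Lemma collinear_det a b c : collinear a b c <-> det a b c = 0.
Proof.
split=> [[p [v [_ h]]]|h].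
  have [ta ->] := h a (mem_head _ _).
  have [tb ->] : exists t, b = p + t *: v by apply: h; rewrite !inE eqxx orbT.
  have [tc ->] : exists t, c = p + t *: v by apply: h; rewrite !inE eqxx !orbT.
  by rewrite /det !cE; ring.
have line (u v w : plane R) : u != v -> det u v w = 0 ->
    exists t : R, w = u + t *: (v - u).
  move=> uv; rewrite /det => e.
  have [ux|ux] := eqVneq (cx v - cx u) 0.
    have vy : cy v - cy u != 0.
      apply: contraNneq uv => vy; apply/eqP/plane_eq; lra.
    exists ((cy w - cy u) / (cy v - cy u)).
    move: e; rewrite ux mul0r sub0r => /eqP; rewrite oppr_eq0 mulf_eq0 (negPf vy) /= => /eqP e.
    by apply: plane_eq; rewrite !cE ?ux ?mulr0 ?divfK //; lra.
  exists ((cx w - cx u) / (cx v - cx u)); apply: plane_eq; rewrite !cE ?divfK //; first by lra.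
  have {}e : cy w - cy u = (cx w - cx u) * (cy v - cy u) / (cx v - cx u).
    by apply: (mulfI ux); rewrite [RHS]mulrC divfK //; lra.
  rewrite mulrAC -e; lra.
have [ab|ab] := eqVneq a b.
  have [ac|ac] := eqVneq a c.
    (* Three equal points lie on a line of any direction. *)
    exists a, (pt 1 0); split.
      by apply/eqP => /(congr1 cx); rewrite !cE; apply/eqP; exact: oner_neq0.
    by move=> x; rewrite !inE -ab -ac !orbb => /eqP->; exists 0; rewrite scale0r addr0.
  exists a, (c - a); split; first by rewrite subr_eq0 eq_sym.
  move=> x; rewrite !inE -ab orbA orbb => /orP[]/eqP->.
    by exists 0; rewrite scale0r addr0.
  by exists 1; rewrite scale1r addrC subrK.
exists a, (b - a); split; first by rewrite subr_eq0 eq_sym.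
move=> x; rewrite !inE => /or3P[]/eqP->.
- by exists 0; rewrite scale0r addr0.
- by exists 1; rewrite scale1r addrC subrK.
- exact: line.
Qed.

Lemma conv_hull_sub A : A `<=` conv_hull A.
Proof. exact: sub_gen_smallest. Qed.

Lemma convex_setP A : convex_set A <->
  forall x y (t : R), 0 <= t <= 1 -> A x -> A y -> A (t *: x + (1 - t) *: y).
Proof.
split=> [cA x y t /andP[t0 t1] Ax Ay|h x y l /set_mem Ax /set_mem Ay].
  by have /set_mem := cA x y (Itv01 t0 t1) (mem_set Ax) (mem_set Ay).
by apply/mem_set/(h _ _ l%:num) => //; rewrite ge0 le1.
Qed.

Lemma conv_hull_convex A : convex_set (conv_hull A).
Proof.
apply/convex_setP => x y t t01 Ax Ay K [cK AK].
by apply: (iffLR (convex_setP K) cK) => //; [apply: Ax|apply: Ay].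
Qed.

Lemma conv_hull_min A K : convex_set K -> A `<=` K -> conv_hull A `<=` K.
Proof. exact: smallest_sub. Qed.

Lemma conv_hull_mono A B : A `<=` B -> conv_hull A `<=` conv_hull B.
Proof.
move=> AB; apply: conv_hull_min; first exact: conv_hull_convex.
by apply: subset_trans AB _; exact: conv_hull_sub.
Qed.

Lemma conv_hull_det_ge0 A a b : (forall q, A q -> 0 <= det a b q) ->
  forall x, conv_hull A x -> 0 <= det a b x.
Proof.
move=> h; apply: (@conv_hull_min A [set x | 0 <= det a b x]) => //.
apply/convex_setP => x y t /andP[t0 t1] /= hx hy; rewrite det_conv.
by rewrite addr_ge0 // mulr_ge0 // subr_ge0.
Qed.

(** The factors [det b c w], [det c a w], [det a b w] are the barycentric coordinates of [w] with
    respect to [a], [b], [c], scaled by [det a b c], and [det p q] is affine. *)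
Lemma det_plucker a b c p q w :
  det p q w * det a b c = det b c w * det p q a + det c a w * det p q b + det a b w * det p q c.
Proof. by rewrite /det; ring. Qed.

(** The point is a convex combination of [a] and of the point [y] where the line from [a] through
    [x] meets [bc]; the coefficients come from barycentric coordinates. *)
Lemma conv_hull_triangle A a b c x : A a -> A b -> A c -> 0 < det a b c ->
  0 <= det a b x -> 0 <= det b c x -> 0 <= det c a x -> conv_hull A x.
Proof.
move=> Aa Ab Ac d0 hab hbc hca.
have cv := iffLR (convex_setP _) (@conv_hull_convex A).
have s := det_sum a b c x.
have Ha := conv_hull_sub Aa; have Hb := conv_hull_sub Ab; have Hc := conv_hull_sub Ac.
(* This is the case [x = a], in which [y] is undetermined and its denominator vanishes. *)
have [e|ne] := eqVneq (det b c x) (det a b c).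
  suff -> : x = a by [].
  have e1 : det a b x = 0 by lra.
  have e2 : det c a x = 0 by lra.
  have nz := lt0r_neq0 d0.
  have ex : (cx x - cx a) * det a b c = 0.
    have -> : (cx x - cx a) * det a b c =
      det a b x * (cx c - cx a) + det c a x * (cx b - cx a) by rewrite /det; ring.
    by rewrite e1 e2 !mul0r addr0.
  have ey : (cy x - cy a) * det a b c = 0.
    have -> : (cy x - cy a) * det a b c =
      det a b x * (cy c - cy a) + det c a x * (cy b - cy a) by rewrite /det; ring.
    by rewrite e1 e2 !mul0r addr0.
  move/eqP: ex; rewrite mulf_eq0 (negPf nz) orbF subr_eq0 => /eqP ex.
  by move/eqP: ey; rewrite mulf_eq0 (negPf nz) orbF subr_eq0 => /eqP ey; exact: plane_eq.
have D : det c a x + det a b x != 0.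
  by apply: contraNneq ne => e0; apply/eqP; lra.
have Dp : 0 < det c a x + det a b x by rewrite lt0r D addr_ge0.
pose t := det c a x / (det c a x + det a b x).
pose y := t *: b + (1 - t) *: c.
have t01 : 0 <= t <= 1.
  by rewrite /t divr_ge0 ?(ltW Dp) //= ler_pdivrMr // mul1r lerDl.
have Hy : conv_hull A y by exact: cv.
pose r := det b c x / det a b c.
have r01 : 0 <= r <= 1.
  by rewrite /r divr_ge0 ?(ltW d0) //= ler_pdivrMr // mul1r; lra.
suff -> : x = r *: a + (1 - r) *: y by exact: cv.
have nz := lt0r_neq0 d0.
have r1 : 1 - r = (det c a x + det a b x) / det a b c.
  by rewrite /r -{1}(divff nz) -mulrBl; congr (_ / _); lra.
have E1 : (1 - r) * t = det c a x / det a b c.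
  by rewrite r1 /t; field; rewrite D nz.
have E2 : (1 - r) * (1 - t) = det a b x / det a b c.
  by rewrite r1 /t; field; rewrite D nz.
have C (u0 u1 u2 : R) : r * u0 + (1 - r) * (t * u1 + (1 - t) * u2) =
    (det b c x * u0 + det c a x * u1 + det a b x * u2) / det a b c.
  transitivity (r * u0 + ((1 - r) * t) * u1 + ((1 - r) * (1 - t)) * u2); first by ring.
  by rewrite E1 E2 /r; field.
by apply: plane_eq; rewrite /y !cE C; apply: (mulIf nz); rewrite divfK // /det; ring.
Qed.

(* For [w] on none of the three side lines, this says that [w] lies in the
   triangle [abc], whatever its orientation. *)
Definition inT w a b c : bool :=
  ((0 < det a b w) == (0 < det b c w)) && ((0 < det b c w) == (0 < det c a w)).

Lemma det_neg a b c : det a b c != 0 -> (0 < det b a c) = ~~ (0 < det a b c).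
Proof. by move=> h; rewrite det_swap oppr_gt0 -leNgt le_eqVlt (negPf h). Qed.

Lemma det_neq_swap a b c : det a b c != 0 -> det b a c != 0.
Proof. by rewrite det_swap oppr_eq0. Qed.

Lemma inT_rot w a b c : inT w b c a = inT w a b c.
Proof. by rewrite /inT; do 3!case: (0 < _). Qed.

Lemma inT_swap w a b c : det a b w != 0 -> det b c w != 0 -> det c a w != 0 ->
  inT w b a c = inT w a b c.
Proof.
move=> h1 h2 h3; rewrite /inT (det_neg h1) (det_neg h3) (det_neg h2).
by do 3!case: (0 < _).
Qed.

(** The three determinants add up to [det a b c], so their common sign is positive. *)
Lemma inT_pos w a b c : 0 < det a b c -> inT w a b c ->
  [/\ 0 < det a b w, 0 < det b c w & 0 < det c a w].
Proof.
move=> d0 /andP[/eqP e1 /eqP e2]; have s := det_sum a b c w.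
have [h|h] := ltP 0 (det a b w); first by rewrite h in e1; split; rewrite ?h -?e2 -?e1.
have h2 : det b c w <= 0 by rewrite leNgt -e1 -leNgt.
have h3 : det c a w <= 0 by rewrite leNgt -e2 -e1 -leNgt.
lra.
Qed.

Lemma triangle_inT A w a b c : A = [set a; b; c] -> det a b c != 0 ->
  det a b w != 0 -> det b c w != 0 -> det c a w != 0 ->
  conv_hull A w <-> inT w a b c.
Proof.
wlog d0 : b c A / 0 < det a b c => [hw|] eA nz nab nbc nca.
  have [d0|d0] := ltP 0 (det a b c); first exact: (hw b c).
  have d1 : 0 < det a c b.
    by rewrite det_rot det_swap oppr_gt0 lt_neqAle nz.
  have eA' : A = [set a; c; b] by rewrite eA; apply/seteqP; split=> z /=; tauto.
  rewrite -(inT_swap nab nbc nca) -(inT_rot _ b a c).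
  exact: (hw c b A d1 eA' (lt0r_neq0 d1) (det_neq_swap nca) (det_neq_swap nbc) (det_neq_swap nab)).
split=> [h|/(inT_pos d0)[h1 h2 h3]].
  have pos p q : det p q w != 0 -> (forall z, A z -> 0 <= det p q z) -> 0 < det p q w.
    by move=> n hz; rewrite lt0r n (conv_hull_det_ge0 hz).
  have dbc : 0 < det b c a by rewrite det_rot.
  have dca : 0 < det c a b by rewrite -det_rot.
  have p1 : 0 < det a b w.
    by apply: pos nab _ => z; rewrite eA => -[[]|] ->; rewrite ?det_aba ?det_abb //; exact: ltW.
  have p2 : 0 < det b c w.
    by apply: pos nbc _ => z; rewrite eA => -[[]|] ->; rewrite ?det_aba ?det_abb //; exact: ltW.
  have p3 : 0 < det c a w.
    by apply: pos nca _ => z; rewrite eA => -[[]|] ->; rewrite ?det_aba ?det_abb //; exact: ltW.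
  by rewrite /inT p1 p2 p3.
by apply: (@conv_hull_triangle A a b c); rewrite ?eA ?ltW //=; tauto.
Qed.

Lemma conv_hull_pair_det a b x : conv_hull [set a; b] x -> det a b x = 0.
Proof.
move=> h; apply/eqP; rewrite eq_le.
rewrite [0 <= _](conv_hull_det_ge0 _ h) ?andbT => [|z /= [] ->]; rewrite ?det_aba ?det_abb //.
rewrite -oppr_ge0 -det_swap (conv_hull_det_ge0 _ h) // => z /= [] ->; rewrite ?det_aba ?det_abb //.
Qed.

Lemma det_near a b x : 0 < det a b x -> \forall y \near x, 0 < det a b y.
Proof.
move=> h; have c : {for x, continuous (det a b)}.
  have cc (i : 'I_2) : {for x, continuous (fun y : plane R => y 0 i)}.
    by move=> ?; exact: coord_continuous.
  rewrite /det /cx /cy; apply: continuousB; apply: continuousM; try exact: cst_continuous.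
    by apply: continuousB; [exact: cc|exact: cst_continuous].
  by apply: continuousB; [exact: cc|exact: cst_continuous].
by have := c _ (lt_nbhsr h).
Qed.

(** The vector [v] is [b - a] turned to the right. Moving from the segment along [v] makes [det a b]
    negative, by a multiple of the squared length of [b - a], and thus leaves the hull at once. *)
Lemma conv_hull_pair_boundary B a b : B a -> B b -> a != b ->
  (forall q, B q -> 0 <= det a b q) ->
  conv_hull [set a; b] `<=` boundary (conv_hull B).
Proof.
move=> Ba Bb ab side x hx; split.
  by apply: subset_closure; apply: conv_hull_mono hx => z /= [] ->.
move=> ix; pose v := pt (cy b - cy a) (cx a - cx b).
have cnt : x + t *: v @[t --> (0 : R)] --> x + 0 *: v.
  by apply: cvgD; [exact: cvg_cst|apply: cvgZr_tmp; exact: cvg_id].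
have n0 : \forall t \near (0 : R), conv_hull B (x + t *: v).
  by apply: cnt; rewrite scale0r addr0.
have [t [/= t0 ht]] : exists t, 0 < t /\ conv_hull B (x + t *: v).
  case: n0 => e /= e0 he; exists (e / 2); split; first by rewrite divr_gt0.
  apply: he; rewrite /ball_ /= sub0r normrN gtr0_norm ?divr_gt0 //.
  by rewrite ltr_pdivrMr // ltr_pMr // ltr1n.
have := conv_hull_det_ge0 side ht.
have -> : det a b (x + t *: v) = det a b x - t * ((cx b - cx a) ^+ 2 + (cy b - cy a) ^+ 2).
  by rewrite /det /v !cE; ring.
rewrite (conv_hull_pair_det hx) sub0r oppr_ge0 pmulr_rle0 // => le0.
have e1 : (cx b - cx a) ^+ 2 = 0.
  by apply/eqP; rewrite eq_le sqr_ge0 andbT; have := sqr_ge0 (cy b - cy a); lra.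
have e2 : (cy b - cy a) ^+ 2 = 0.
  by apply/eqP; rewrite eq_le sqr_ge0 andbT; have := sqr_ge0 (cx b - cx a); lra.
move/eqP: e1; rewrite sqrf_eq0 subr_eq0 => /eqP e1.
move/eqP: e2; rewrite sqrf_eq0 subr_eq0 => /eqP e2.
by case/eqP: ab; apply: plane_eq.
Qed.

(** With points strictly on both sides, the triangles [abc] and [bad] together contain a
    neighbourhood of the midpoint of [ab]. *)
Lemma conv_hull_pair_interior B a b c d : B a -> B b -> B c -> B d ->
  0 < det a b c -> det a b d < 0 ->
  ~ (conv_hull [set a; b] `<=` boundary (conv_hull B)).
Proof.
move=> Ba Bb Bc Bd hc hd sub.
pose h : R := 2^-1; pose m := h *: a + (1 - h) *: b.
have half : 0 <= h <= 1.
  by rewrite /h; apply/andP; split; lra.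
have hm : conv_hull [set a; b] m.
  have cv := iffLR (convex_setP _) (@conv_hull_convex [set a; b]).
  by apply: (cv _ _ _ half); apply: conv_hull_sub; [left|right].
have [_] := sub _ hm; apply.
have h1 : 0 < det b c m.
  by rewrite /m /h det_conv det_rot det_aba; lra.
have h2 : 0 < det c a m.
  by rewrite /m /h det_conv det_abb -det_rot; lra.
have h3 : 0 < det a d m.
  have -> : det a d m = - det a b d * 2^-1 by rewrite /m /h det_conv /det; field.
  lra.
have h4 : 0 < det d b m.
  have -> : det d b m = - det a b d * 2^-1 by rewrite /m /h det_conv /det; field.
  lra.
rewrite /interior /=; near=> y.
have k1 : 0 < det b c y by near: y; exact: det_near.
have k2 : 0 < det c a y by near: y; exact: det_near.
have k3 : 0 < det a d y by near: y; exact: det_near.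
have k4 : 0 < det d b y by near: y; exact: det_near.
have [k|k] := lerP 0 (det a b y).
  exact: (conv_hull_triangle Ba Bb Bc hc k (ltW k1) (ltW k2)).
apply: (conv_hull_triangle Bb Ba Bd); rewrite ?ltW //.
- by rewrite det_swap; lra.
- by rewrite det_swap; lra.
Unshelve. all: by end_near.
Qed.

End Plane.

(** * Counterclockwise sequences of points *)

Section Counterclockwise.
Variable R : realType.
Implicit Types (a b c p q w x y z : plane R) (s t : seq (plane R)).

(** All triples in list order turn left, not merely consecutive ones; in this form the condition
    passes to subsequences and excludes polygons that wind around more than once. *)
Fixpoint ccw s : bool :=
  if s is x :: s' then pairwise (fun y z => 0 < det x y z) s' && ccw s' else true.

Lemma pairwise_subseq2 (T : eqType) (r : rel T) (s : seq T) :
  pairwise r s <-> forall x y : T, subseq [:: x; y] s -> r x y.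
Proof.
split=> [ps x y sub|]; first by have /= := subseq_pairwise sub ps; rewrite !andbT.
elim: s => //= u s IH h; apply/andP; split.
  by apply/allP => v vs; apply: h; rewrite eqxx sub1seq.
by apply: IH => x y sub; apply: h; case: ifP => // _; exact: subseq_trans (subseq_cons _ _) sub.
Qed.

Lemma ccwP s : ccw s <-> forall x y z, subseq [:: x; y; z] s -> 0 < det x y z.
Proof.
elim: s => [|u s IH] //; split.
  move=> /= /andP[/pairwise_subseq2 ps /IH cs] x y z.
  by case: ifP => [/eqP-> /ps|_ /cs].
move=> h; rewrite /=; apply/andP; split.
  by apply/pairwise_subseq2 => y z sub; apply: h; rewrite /= eqxx.
by apply/IH => x y z sub; apply: h; exact: subseq_trans sub (subseq_cons _ _).
Qed.

Lemma ccw_subseq s t : subseq s t -> ccw t -> ccw s.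
Proof.
by move=> st /ccwP h; apply/ccwP => x y z sub; apply: h; exact: subseq_trans sub st.
Qed.

Lemma ccw_rcons s x : ccw (rcons s x) = ccw s && pairwise (fun y z => 0 < det y z x) s.
Proof.
have E (A P C Q : bool) : (A && P) && (C && Q) = (P && C) && (A && Q).
  by case: A P C Q => [] [] [] [].
by elim: s => //= y s ->; rewrite pairwise_rcons E.
Qed.

Lemma ccw_rot k s : ccw s -> ccw (rot k s).
Proof.
have r1 x t : ccw (x :: t) = ccw (rcons t x).
  rewrite ccw_rcons /= andbC; congr (_ && _).
  by apply: eq_pairwise => y z; rewrite (det_rot x).
elim: k s => [|k IH] s; first by rewrite rot0.
have [ks|sk] := ltnP k (size s); last by rewrite rot_oversize // ltnW.
rewrite -add1n rotD; last by rewrite add1n.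
move=> cs; have := IH _ cs; case: (rot k s) => [|x t] //.
by rewrite rot1_cons -r1.
Qed.

Lemma ccw_next s p q : uniq s -> ccw s -> p \in s -> q \in s ->
  0 <= det p (next s p) q.
Proof.
move=> U cs ps qs; have [i l e] := rot_to ps.
rewrite -(next_rot i) // e; move: qs; rewrite -(mem_rot i) e.
have := ccw_rot i cs; rewrite e.
case: l {e} => [|y l] /=; first by rewrite eqxx det_aa.
rewrite eqxx !inE => /andP[/andP[/allP h _] _] /or3P[/eqP->|/eqP->|/h/ltW //].
  by rewrite det_aba.
by rewrite det_abb.
Qed.

Lemma ccw_head s p x y : ccw (p :: s) -> subseq [:: x; y] s -> 0 < det p x y.
Proof. by move=> /andP[/pairwise_subseq2 h _]; exact: h. Qed.

Definition convex_position s := forall p a b c, p \in s -> a \in s -> b \in s -> c \in s ->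
  p != a -> p != b -> p != c -> ~ [/\ 0 < det a b p, 0 < det b c p & 0 < det c a p].

Definition generic s := forall a b c, a \in s -> b \in s -> c \in s ->
  uniq [:: a; b; c] -> det a b c != 0.

(** The points are sorted by angle as seen from the first one, [p0]. This order is transitive, since
    a failure would put [p0] inside a triangle of other points; three later points turn left, since
    otherwise the middle one would be inside the triangle of [p0] and the other two. *)
Lemma ccw_ordering s : uniq s -> generic s -> convex_position s ->
  exists2 t, perm_eq t s & ccw t.
Proof.
case: s => [|p0 l] U gen conv; first by exists [::].
pose le := fun x y => (x == y) || (0 < det p0 x y).
have pl x : x \in l -> p0 != x.
  by move=> xl; apply: contraTneq U => ->; rewrite /= xl.
have il x : x \in l -> x \in p0 :: l by rewrite inE orbC => ->.
have gen2 x y : x \in l -> y \in l -> x != y -> det p0 x y != 0.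
  by move=> xl yl xy; apply: gen; rewrite ?mem_head ?il //= !inE negb_or !pl //= xy.
have tot : {in l &, total le}.
  move=> x y xl yl; rewrite /le (eq_sym y x).
  have [//|xy /=] := eqVneq x y.
  have := gen2 _ _ xl yl xy; rewrite (det_swapr p0 x) oppr_gt0.
  by case: ltgtP.
have tr : {in l & &, transitive le}.
  move=> y x z yl xl zl /orP[/eqP->//|xy] /orP[/eqP<-|yz]; first by rewrite /le xy orbT.
  apply/orP; have [|xz] := eqVneq x z; [by left|right].
  have := gen2 _ _ xl zl xz; rewrite neq_lt => /orP[zx|//].
  case: (@conv p0 x y z); rewrite ?mem_head ?il ?pl //; split.
  - by rewrite (det_rot p0).
  - by rewrite (det_rot p0).
  - by rewrite (det_rot p0) det_swapr oppr_gt0.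
pose t := sort le l.
have pt : perm_eq t l by rewrite perm_sort.
have tl x : x \in t -> x \in l by rewrite (perm_mem pt).
have Ut : uniq t by rewrite (perm_uniq pt); case/andP: U.
have p2 x y : subseq [:: x; y] t -> 0 < det p0 x y.
  move=> sub; have : le x y.
    apply: (iffLR (pairwise_subseq2 le t) _ _ _ sub).
    rewrite -(sorted_pairwise_in (P := mem l)) //; last by apply/allP.
    exact: (sort_sorted_in tot (allss l)).
  case/orP=> // /eqP xy; move: (subseq_uniq sub Ut).
  by rewrite /= xy inE eqxx.
exists (p0 :: t); first by rewrite perm_cons.
apply/ccwP => x y z; rewrite [subseq _ _]/=; case: ifP => [/eqP->|_ sub]; first exact: p2.
have s12 : subseq [:: x; y] t by apply: subseq_trans sub; rewrite /= !eqxx.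
have s13 : subseq [:: x; z] t.
  by apply: subseq_trans sub; rewrite /= eqxx; case: (z == y) => //=; rewrite eqxx.
have s23 : subseq [:: y; z] t by apply: subseq_trans sub; exact: subseq_cons.
have Us := subseq_uniq sub Ut.
have [xt yt zt] : [/\ x \in t, y \in t & z \in t].
  by split; apply: (mem_subseq sub); rewrite !inE eqxx ?orbT.
have : det x y z != 0 by apply: gen; rewrite ?il ?tl.
rewrite neq_lt => /orP[neg|//].
move: Us; rewrite /= !inE negb_or andbT => /andP[/andP[xy xz] yz].
case: (@conv y p0 x z); rewrite ?mem_head ?il ?tl //; rewrite 1?eq_sym ?pl ?tl //.
split; first exact: p2.
- by rewrite det_swapr oppr_gt0.
- by rewrite -(det_rot z); exact: p2.
Qed.

(* Fan triangulation from the first point. *)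
Lemma ccw_fan s w : uniq s -> ccw s -> (2 < size s)%N ->
  (forall a b, a \in s -> b \in s -> a != b -> det a b w != 0) ->
  conv_hull [set` s] w ->
  exists a b c, [/\ a \in s, b \in s, c \in s, uniq [:: a; b; c] & inT w a b c].
Proof.
move=> U cs sz gen hw.
have edge a : a \in s -> 0 < det a (next s a) w.
  move=> as_; rewrite lt0r (conv_hull_det_ge0 _ hw) ?andbT; last first.
    by move=> q qs; exact: ccw_next.
  apply: gen; rewrite ?mem_next //.
  apply/eqP => e; have := cycle_next U.
  have [i l el] := rot_to as_; move: e; rewrite -(next_rot i) // el.
  have : uniq (a :: l) by rewrite -el rot_uniq.
  have : size (a :: l) = size s by rewrite -el size_rot.
  by case: l {el} => [|b l] /=; [move=> e; rewrite -e in sz|rewrite eqxx => _ U' e'; move: U'; rewrite -e' mem_head].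
have : cycle (fun a b => 0 < det a b w) s by apply: cycle_from_next.
case: s U cs sz gen hw {edge} => [|p0 [|p1 l]] //= U cs sz gen hw.
case/andP=> h1; rewrite rcons_path => /andP[hp hl].
have /andP[p0l Ul] : (p0 \notin p1 :: l) && uniq (p1 :: l) by [].
(* Along the polygon, [det p0 q w] is positive at the first [q] and negative at the last; the edge
   where the sign changes gives the triangle. *)
have main : forall m q, {subset q :: m <= p1 :: l} ->
    path (fun a b => 0 < det a b w) q m -> 0 < det p0 q w -> 0 < det (last q m) p0 w ->
    exists a b, [/\ subseq [:: a; b] (q :: m), 0 < det p0 a w, 0 < det a b w & 0 < det b p0 w].
  elim=> [|b m IH] q sub /=.
    by move=> _ h; rewrite det_swap oppr_gt0 => /(lt_trans h); rewrite ltxx.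
  case/andP=> qb pm hq hl'; have [hb|hb] := ltP 0 (det p0 b w).
    have subm : {subset b :: m <= p1 :: l} by move=> z zm; apply: sub; rewrite inE zm orbT.
    have [a [c [sub' ha hac hc]]] := IH b subm pm hb hl'.
    by exists a, c; split=> //; exact: subseq_trans sub' (subseq_cons _ _).
  have bl : b \in p1 :: l by apply: sub; rewrite !inE eqxx orbT.
  exists q, b; split=> //; first by rewrite !eqxx sub0seq.
  rewrite det_swap oppr_gt0 lt_neqAle hb andbT; apply: gen; rewrite ?mem_head //.
    by rewrite inE bl orbT.
  by apply: contraNneq p0l => ->.
have [a [b [sub ha hab hb]]] := main l p1 (fun _ => id) hp h1 hl.
have [al bl] : a \in p1 :: l /\ b \in p1 :: l.
  by split; apply: (mem_subseq sub); rewrite !inE eqxx ?orbT.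
exists p0, a, b; split; rewrite ?mem_head //; try by rewrite inE ?al ?bl orbT.
  have := subseq_uniq sub Ul; rewrite /= !inE andbT negb_or => ->.
  by rewrite !andbT; apply/andP; split; apply: contraNneq p0l => ->.
by rewrite /inT ha hab hb.
Qed.

End Counterclockwise.

(** * Cyclic orders determined by neighbours *)

Section CyclicOrders.
Variable T : eqType.
Implicit Types (s t : seq T) (x y : T).

(** A sequence without repetitions is the trajectory of its first entry under [next]. *)
Lemma next_eq_rotation s t : uniq s -> uniq t -> s =i t ->
  {in s, forall x, next s x = next t x} -> rotation t s.
Proof.
move=> Us Ut st e; case: s Us st e => [|x l] Us st e.
  by case: t {Ut} st e => [|y t] st; [exists 0|have := st y; rewrite inE eqxx].
have [i l' et] := rot_to (etrans (esym (st x)) (mem_head x l)).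
exists i; rewrite et; congr cons.
have sz : size l = size l'.
  have : size (x :: l) = size (rot i t).
    by rewrite size_rot; apply/perm_size; rewrite uniq_perm.
  by rewrite et => -[].
have pl : fpath (next (x :: l)) x l.
  by have := cycle_next Us; rewrite /= rcons_path => /andP[].
have Ul' : uniq (x :: l') by rewrite -et rot_uniq.
have pl' : fpath (next (x :: l')) x l'.
  by have := cycle_next Ul'; rewrite /= rcons_path => /andP[].
have [n en] := fpathP pl; have [n' en'] := fpathP pl'.
have nn : n = n' by move: (congr1 size en) (congr1 size en'); rewrite !size_traject -sz => -> ->.
rewrite [LHS]en [RHS]en' -{}nn.
have ne z : z \in x :: l -> next (x :: l) z = next (x :: l') z.
  by move=> zl; rewrite e // -et next_rot.
have main m z : z \in x :: l -> traject (next (x :: l)) z m = traject (next (x :: l')) z m.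
  by elim: m z => // m IH z zl; rewrite !trajectS IH ?mem_next // ne.
by rewrite ne ?mem_head // main // -ne ?mem_head // mem_next mem_head.
Qed.

Lemma next_next_neq s x : uniq s -> (2 < size s)%N -> x \in s ->
  next s (next s x) != x /\ next s x != x.
Proof.
move=> U sz xs; have [i l e] := rot_to xs.
have Ul : uniq (x :: l) by rewrite -e rot_uniq.
have sl : (2 < size (x :: l))%N by rewrite -e size_rot.
rewrite -!(next_rot i U) e.
case: l Ul sl {e} => [|y [|z l]] // Ul _.
move: Ul; rewrite /= !inE !negb_or => /andP[/and3P[xy xz _] _].
by rewrite eqxx (eq_sym y x) (negPf xy) eqxx eq_sym xz.
Qed.

(** Once a step of [s] goes forward in [t], so does the following one: a step back would return to
    the previous entry, which is impossible in a cycle of at least three. Hence the direction is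
    constant. *)
Lemma neighbors_rotation s t : uniq s -> uniq t -> s =i t -> (2 < size s)%N ->
  {in s, forall x, next s x = next t x \/ next t (next s x) = x} ->
  rotation t s \/ rotation (rev t) s.
Proof.
move=> Us Ut st sz h.
have [/allP allN|/allPn[x xs nx]] := boolP (all (fun x => next t (next s x) == x) s).
  right; apply: next_eq_rotation; rewrite ?rev_uniq //; first by move=> x; rewrite mem_rev.
  move=> x xs; rewrite next_rev //; have /eqP e := allN _ xs.
  by rewrite -{2}e prev_next.
left; apply: next_eq_rotation => //.
have step y : y \in s -> next s y = next t y -> next s (next s y) = next t (next s y).
  move=> ys e; have [//|e'] := h _ (etrans (mem_next s y) ys).
  have [n2 _] := next_next_neq Us sz ys.
  have /(congr1 (prev t)) := e'; rewrite prev_next // {2}e prev_next // => e2.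
  by rewrite e2 eqxx in n2.
have ex : next s x = next t x by case: (h _ xs) => // e; rewrite e eqxx in nx.
have [i l e] := rot_to xs.
have pl : fpath (next s) x l.
  have := cycle_next Us; rewrite -(rot_cycle i) e /= rcons_path.
  by move=> /andP[].
have main : forall m y, y \in s -> next s y = next t y -> fpath (next s) y m ->
    {in y :: m, forall z, next s z = next t z}.
  elim=> [|z m IH] y ys ey /=; first by move=> _ z; rewrite inE => /eqP->.
  move=> /andP[/eqP yz pm] u; rewrite inE => /orP[/eqP->//|um].
  by apply: (IH z) um => //; rewrite -yz ?mem_next //; exact: step.
by move=> y ys; apply: (main l x) => //; rewrite -e mem_rot.
Qed.

End CyclicOrders.

(** * Black points and their hull cycles *)

Section Hulls.
Variables (R : realType) (X : {fset plane R}).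
Implicit Types (a b c x y : X) (A : {set X}).

Lemma fsval_inj : injective (@fsval _ X).
Proof. exact: val_inj. Qed.

Lemma hull_image A (B : set (plane R)) : (forall x, x \in A <-> B (fsval x)) ->
  (forall p, B p -> exists x, p = fsval x) -> hull A = conv_hull B.
Proof.
move=> h hB; congr conv_hull; apply/seteqP; split=> p /=.
  by case=> x /h Bx <-.
by move=> Bp; have [x e] := hB _ Bp; exists x => //; apply/h; rewrite -e.
Qed.

Lemma hull_pair a b : hull [set a; b]%SET = conv_hull [set fsval a; fsval b].
Proof.
apply: hull_image => [x|p /= [] ->]; [|by exists a|by exists b].
rewrite !inE /=; split=> [/orP[]/eqP->|[]/fsval_inj->]; rewrite ?eqxx ?orbT //; by [left|right].
Qed.

Lemma triangle_hull a b c : triangle a b c = conv_hull [set fsval a; fsval b; fsval c].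
Proof.
apply: hull_image => [x|p /= [[]|] ->]; [|by exists a|by exists b|by exists c].
rewrite !inE /= -orbA; split=> [/or3P[]/eqP->|[[]|]/fsval_inj->]; rewrite ?eqxx ?orbT //;
  by [left; left|left; right|right].
Qed.

Lemma hull_mem_mono A (B : {set X}) p : A \subset B -> hull A p -> hull B p.
Proof.
move=> /fintype.subsetP AB; apply: conv_hull_mono => q [x /= xA <-].
by exists x => //; exact: AB.
Qed.

End Hulls.

Section Diagrams.
Variables (R : realType) (d : nat) (X : tdiagram R d).
Implicit Types (a b c w x y : X) (A : {set X}) (s t : seq X).

Lemma diagram_det a b c : uniq [:: a; b; c] -> det (fsval a) (fsval b) (fsval c) != 0.
Proof.
rewrite /= !inE negb_or andbT => /andP[/andP[ab ac] bc].
apply/eqP => /collinear_det; apply: general_position; split=> //.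
Qed.

Lemma distinct3P a b c : distinct3 a b c <-> uniq [:: a; b; c].
Proof.
rewrite /= !inE negb_or andbT; split=> [[-> -> ->] //|/andP[/andP[]]]; by split.
Qed.

Lemma diagram_inT w a b c : w \notin black X -> a \in black X -> b \in black X ->
  c \in black X -> uniq [:: a; b; c] ->
  triangle a b c (fsval w) <-> inT (fsval w) (fsval a) (fsval b) (fsval c).
Proof.
move=> wB aB bB cB U; rewrite triangle_hull.
have nw x : x \in black X -> w != x by move=> xB; apply: contraNneq wB => ->.
have := U; rewrite /= !inE negb_or andbT => /andP[/andP[ab ac] bc].
have dw x y : x \in black X -> y \in black X -> x != y -> det (fsval x) (fsval y) (fsval w) != 0.
  move=> xB yB xy; apply: diagram_det.
  by rewrite /= !inE negb_or xy ![_ == w]eq_sym !nw.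
have ca : c != a by rewrite eq_sym.
exact: (triangle_inT erefl (diagram_det U) (dw _ _ aB bB ab) (dw _ _ bB cB bc) (dw _ _ cB aB ca)).
Qed.

Lemma diagram_ccw : exists t, [/\ uniq t, t =i black X & ccw (map (@fsval _ (points X)) t)].
Proof.
have U : uniq (map (@fsval _ (points X)) (enum (black X))) by rewrite map_inj_uniq ?enum_uniq //; exact: fsval_inj.
have [||t' pt ct] := ccw_ordering U.
- move=> p q r /mapP[a _ ->] /mapP[b _ ->] /mapP[c _ ->].
  rewrite -[[:: _; _; _]]/(map (@fsval _ (points X)) [:: a; b; c]) map_inj_uniq; last exact: fsval_inj.
  exact: diagram_det.
- move=> p q r z /mapP[x + ->] /mapP[a + ->] /mapP[b + ->] /mapP[c + ->].
  rewrite !mem_enum !(inj_eq (@fsval_inj _ X)) => xB aB bB cB xa xb xc [h1 h2 h3].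
  apply: (black_convex_position xB).
  have mB y : y \in black X -> x != y -> [set fsval u | u in [set` (black X :\ x)%SET]] (fsval y).
    by move=> yB xy; exists y => //=; rewrite !inE eq_sym xy.
  apply: (conv_hull_triangle (mB _ aB xa) (mB _ bB xb) (mB _ cB xc)); rewrite ?ltW //.
  by rewrite -(det_sum _ _ _ (fsval x)); do 2?[apply: addr_gt0 => //].
have [t e] : exists t, t' = map (@fsval _ (points X)) t.
  have : {subset t' <= map (@fsval _ (points X)) (enum (black X))} by move=> p; rewrite (perm_mem pt).
  elim: (t') => [|p l IH] sub; first by exists [::].
  have [x _ ex] := mapP (sub p (mem_head _ _)).
  have [l' el] : exists t, l = map (@fsval _ (points X)) t by apply: IH => q ql; apply: sub; rewrite inE ql orbT.
  by exists (x :: l'); rewrite /= -ex -el.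
exists t; split; rewrite -?e //.
  by rewrite -(map_inj_uniq (@fsval_inj _ X)) -e (perm_uniq pt).
by move=> x; rewrite -(mem_map (@fsval_inj _ X)) -e (perm_mem pt) mem_map ?mem_enum //; exact: fsval_inj.
Qed.

Lemma size_black s : uniq s -> s =i black X -> size s = (d + 3)%N.
Proof.
by move=> U e; rewrite -(card_black X) -(card_uniqP U); apply: eq_card.
Qed.

End Diagrams.

Section HullCycles.
Variables (R : realType) (d : nat) (X : tdiagram R d).
Implicit Types (a b c w x y : X) (A : {set X}) (s t : seq X).

(** Triangulating by a fan reduces the hulls in an equivalence by diagonals to triangles, which a
    characteristic tree controls. *)
Lemma hull_fan w A : w \notin black X -> A \subset black X ->
  hull A (fsval w) <-> exists a b c, [/\ a \in A, b \in A, c \in A,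
    uniq [:: a; b; c] & triangle a b c (fsval w)].
Proof.
move=> wB /fintype.subsetP AB; split; last first.
  case=> a [b [c [aA bA cA _]]]; apply: hull_mem_mono.
  by apply/fintype.subsetP => x; rewrite !inE -orbA => /or3P[]/eqP->.
have [t [Ut et ct]] := diagram_ccw X; have sz := size_black Ut et.
have t2 : (2 < size t)%N by rewrite sz addn3.
pose tA := [seq x <- t | x \in A].
have mA x : (x \in tA) = (x \in A).
  by rewrite mem_filter et; case: (boolP (x \in A)) => // /AB->.
have UA : uniq tA by exact: filter_uniq.
have nw x : x \in black X -> x != w by move=> xB; apply: contraNneq wB => <-.
(* At most two points span at most a segment, which contains no white point by general position.
   They are completed to two distinct black points so that it applies. *)
have [small|big] := leqP (size tA) 2.
  have [a [b [aB bB ab sub]]] : exists a b, [/\ a \in black X, b \in black X, a != b &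
      forall x, x \in A -> x = a \/ x = b].
    have nx x : x \in t -> [/\ next t x \in black X & x != next t x].
      move=> xt; rewrite -et mem_next xt eq_sym; split=> //.
      by have [] := next_next_neq Ut t2 xt.
    case: tA mA UA small => [|a [|b [|]]] // mA UA _.
    - have [x xt] : exists x, x \in t.
        by case: (t) sz => [|x ?]; [rewrite addn3|exists x; rewrite mem_head].
      have [h1 h2] := nx _ xt; exists x, (next t x); split=> //; first by rewrite -et.
      by move=> y; rewrite -mA.
    - have aA : a \in A by rewrite -mA mem_head.
      have at_ : a \in t by rewrite et AB.
      have [h1 h2] := nx _ at_; exists a, (next t a); split=> //; first by rewrite -et.
      by move=> y; rewrite -mA inE => /eqP->; left.
    - exists a, b; split.
      + by apply: AB; rewrite -mA mem_head.
      + by apply: AB; rewrite -mA !inE eqxx orbT.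
      + by move: UA; rewrite /= inE => /andP[].
      + by move=> y; rewrite -mA !inE => /orP[]/eqP->; [left|right].
  move=> hw; have : hull [set a; b]%SET (fsval w).
    by apply: hull_mem_mono hw; apply/fintype.subsetP => x /sub[]->; rewrite !inE eqxx ?orbT.
  rewrite hull_pair => /conv_hull_pair_det /eqP e.
  have U : uniq [:: a; b; w] by rewrite /= !inE negb_or ab !nw.
  by rewrite (negPf (diagram_det U)) in e.
move=> hw.
have [|||||p [q [r [/mapP[a aA ->] /mapP[b bA ->] /mapP[c cA ->] U h]]]] := @ccw_fan R (map (@fsval _ (points X)) tA) (fsval w).
- by rewrite map_inj_uniq //; exact: fsval_inj.
- by apply: ccw_subseq ct; apply: map_subseq; exact: filter_subseq.
- by rewrite size_map.
- move=> p q /mapP[a aA ->] /mapP[b bA ->] ab; apply: diagram_det.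
  rewrite !mA in aA bA; rewrite /= !inE negb_or !nw ?AB //.
  by rewrite -(inj_eq (@fsval_inj _ X)) ab.
- move: hw; rewrite /hull => hw.
  have -> // : [set` map (@fsval _ (points X)) tA] = [set fsval x | x in [set` A]].
  apply/seteqP; split=> p /=.
    by move=> /mapP[x xA ->]; exists x; rewrite -?mA.
  by case=> x xA <-; apply/mapP; exists x; rewrite ?mA.
rewrite !mA in aA bA cA.
have Uabc : uniq [:: a; b; c] by rewrite -(map_inj_uniq (@fsval_inj _ X)).
by exists a, b, c; split=> //; apply/(diagram_inT wB (AB _ aA) (AB _ bA) (AB _ cA) Uabc).
Qed.

Lemma ccw_hull_cycle t : uniq t -> t =i black X -> ccw (map (@fsval _ (points X)) t) ->
  hull_cycle t.
Proof.
move=> Ut et ct; split=> // a at_; have t2 : (2 < size t)%N by rewrite (size_black Ut et) addn3.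
have an : a != next t a by rewrite eq_sym; have [] := next_next_neq Ut t2 at_.
rewrite hull_pair; apply: conv_hull_pair_boundary.
- by exists a => //=; rewrite -et.
- by exists (next t a) => //=; rewrite -et mem_next.
- by rewrite (inj_eq (@fsval_inj _ X)).
- move=> q [x /= xB <-]; rewrite -(next_map (@fsval_inj _ X)) //.
  have Um : uniq (map (@fsval _ (points X)) t) by rewrite map_inj_uniq //; exact: fsval_inj.
  have xt : x \in t by rewrite et.
  exact: (ccw_next Um ct (map_f _ at_) (map_f _ xt)).
Qed.

Lemma hull_cycle_rot k s : hull_cycle s -> hull_cycle (rot k s).
Proof.
case=> U e h; split; rewrite ?rot_uniq //; first by move=> x; rewrite mem_rot.
by move=> a; rewrite mem_rot next_rot //; exact: h.
Qed.

Lemma hull_cycle_rev s : hull_cycle s -> hull_cycle (rev s).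
Proof.
case=> U e h; split; rewrite ?rev_uniq //; first by move=> x; rewrite mem_rev.
move=> a; rewrite mem_rev next_rev // => as_.
have := h (prev s a); rewrite mem_prev next_prev // => /(_ as_).
by rewrite (_ : [set prev s a; a]%SET = [set a; prev s a]%SET) // finset.setUC.
Qed.

(** A hull edge [ab] cannot have black points strictly on both sides. In counterclockwise order from
    [a], the points before [b] are on one side of [ab] and those after it on the other, so [b] must
    be a neighbour of [a] in [t]. *)
Lemma hull_cycle_ccw s t : uniq t -> t =i black X ->
  ccw (map (@fsval _ (points X)) t) -> hull_cycle s -> rotation t s \/ rotation (rev t) s.
Proof.
move=> Ut et ct [Us es h].
have st : s =i t by move=> x; rewrite es et.
have s2 : (2 < size s)%N by rewrite (size_black Us es) addn3.
apply: neighbors_rotation => //.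
move=> a as_; have bs : next s a \in s by rewrite mem_next.
have ab : a != next s a by rewrite eq_sym; have [] := next_next_neq Us s2 as_.
have side c e : c \in t -> e \in t ->
    ~ (0 < det (fsval a) (fsval (next s a)) (fsval c) /\
       det (fsval a) (fsval (next s a)) (fsval e) < 0).
  move=> ct' et' [h1 h2]; have := h _ as_; rewrite hull_pair.
  have mB x : x \in black X -> [set fsval u | u in [set` black X]] (fsval x) by exists x.
  apply: conv_hull_pair_interior h1 h2; apply: mB; by rewrite -et // -st.
move: (next s a) ab bs side => b ab bs side.
have at_ : a \in t by rewrite -st.
have [i l el] := rot_to at_.
have bl : b \in l.
  have : b \in rot i t by rewrite mem_rot -st.
  by rewrite el inE eq_sym (negPf ab).
rewrite -!(next_rot i Ut) el.
have mt x : x \in l -> x \in t by move=> xl; rewrite -(mem_rot i) el inE xl orbT.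
have Ul : uniq (a :: l) by rewrite -el rot_uniq.
have cl : ccw (map (@fsval _ (points X)) (a :: l)) by rewrite -el map_rot; exact: ccw_rot.
case/splitPr: bl el mt Ul cl => l1 l2 el mt Ul cl.
have /ccwP cl3 := cl.
have l1b c : c \in l1 -> det (fsval a) (fsval b) (fsval c) < 0.
  move=> cl1; rewrite det_swapr oppr_lt0; apply: cl3.
  rewrite -[[:: _; _; _]]/(map (@fsval _ (points X)) [:: a; c; b]); apply: map_subseq.
  by rewrite /= eqxx; apply: subseq_pair_cat; rewrite ?mem_head.
have l2b c : c \in l2 -> 0 < det (fsval a) (fsval b) (fsval c).
  move=> cl2; apply: cl3.
  rewrite -[[:: _; _; _]]/(map (@fsval _ (points X)) [:: a; b; c]); apply: map_subseq.
  rewrite /= eqxx -cat_rcons; apply: subseq_pair_cat => //.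
  by rewrite mem_rcons mem_head.
case: l1 => [|c1 l1] in el mt Ul cl cl3 l1b *; first by left; rewrite /= eqxx.
case: l2 => [|c2 l2] in el mt Ul cl cl3 l2b *; last first.
  case: (side c2 c1); rewrite ?mt ?l1b ?l2b ?mem_head ?inE ?eqxx //.
  by rewrite mem_cat !inE eqxx !orbT.
right; rewrite -(next_rot (size (a :: c1 :: l1)) Ul) -cat_cons rot_size_cat.
by rewrite /= eqxx.
Qed.

End HullCycles.

(** * Uniqueness of the tree and of the diagram *)

Section Uniqueness.
Variables (R : realType) (d : nat).

Lemma hull_cycle_unique (X : tdiagram R d) (s s' : seq X) : hull_cycle s -> hull_cycle s' ->
  rotation s s' \/ rotation (rev s) s'.
Proof.
move=> hs hs'; have [t [Ut et ct]] := diagram_ccw X.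
have [h|h] := hull_cycle_ccw Ut et ct hs; have [h'|h'] := hull_cycle_ccw Ut et ct hs'.
- by left; apply: rotation_trans h'; exact: rotation_sym.
- by right; apply: rotation_trans h'; apply: rotation_sym; exact: rotation_rev.
- right; apply: rotation_trans h'; rewrite -[t]revK; apply: rotation_rev.
  exact: rotation_sym.
- by left; apply: rotation_trans h'; exact: rotation_sym.
Qed.

Lemma hull_cycle_rotation (X : tdiagram R d) (s s' : seq X) :
  hull_cycle s -> rotation s s' -> hull_cycle s'.
Proof. by move=> h [k ->]; exact: hull_cycle_rot. Qed.

Lemma characteristic_leaf (X : tdiagram R d) (G : three_tree) (phi : X -> G) x :
  characteristic_tree phi -> leaf (phi x) = (x \in black X).
Proof. by case=> _ /(_ x) h _ _; move: h; case: ifP => // _; rewrite leafN_inner => ->. Qed.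

(** The map is forced by [phi] and [phi']. It is shown to send edges to edges; applied with the two
    trees exchanged, this also gives the converse in [characteristic_unique]. *)
Lemma characteristic_adj (X : tdiagram R d) (G G' : three_tree) (phi : X -> G) (phi' : X -> G') :
  characteristic_tree phi -> characteristic_tree phi' ->
  exists psi : G -> G', [/\ bijective psi, forall x : X, psi (phi x) = phi' x,
    forall x y, adj x y -> adj (psi x) (psi y) &
    preserves_orders psi \/ reverses_orders psi].
Proof.
move=> h h'; have [[g phiK gK] _ [s hs ls] tp] := h.
have [bij' _ [s' hs' ls'] tp'] := h'.
pose psi := phi' \o g.
have psiE x : psi (phi x) = phi' x by rewrite /psi /= phiK.
have bij : bijective psi by apply: bij_comp => //; exists phi.
have [r lr] : exists r : G, leaf r.
  apply: leaf_ex; apply/card_gt0P.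
  have : (0 < #|black X|)%N by rewrite card_black addn3.
  by case/card_gt0P => x _; exists (phi x).
have psi_leaf v : leaf (psi v) = leaf v.
  by rewrite -[v]gK psiE (characteristic_leaf _ h) (characteristic_leaf _ h').
have psi_paths w a b c : inner w -> leaf a -> leaf b -> leaf c ->
    uniq [:: a; b; c] -> three_paths w a b c ->
    three_paths (psi w) (psi a) (psi b) (psi c).
  rewrite -[inner w]negbK -leafN_inner -[w]gK -[a]gK -[b]gK -[c]gK !psiE.
  rewrite !(characteristic_leaf _ h) => wB aB bB cB U.
  have dd : distinct3 (g a) (g b) (g c).
    by apply/distinct3P; rewrite -(map_inj_uniq (can_inj phiK)).
  by move=> /(tp _ _ _ _ wB aB bB cB dd)/(tp' _ _ _ _ wB aB bB cB dd).
have rs : rotation (map psi (map phi s)) (map phi' s') \/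
          rotation (map psi (rev (map phi s))) (map phi' s').
  have mE u : map psi (map phi u) = map phi' u by rewrite -map_comp; exact: eq_map.
  case: (hull_cycle_unique hs hs') => q; [left|right].
    by rewrite mE; exact: rotation_map.
  by rewrite -map_rev mE; exact: rotation_map.
have [h1 h2] := tree_isomorphism bij psi_leaf psi_paths lr ls ls' rs.
by exists psi.
Qed.

Lemma characteristic_unique (X : tdiagram R d) (G G' : three_tree) (phi : X -> G)
    (phi' : X -> G') : characteristic_tree phi -> characteristic_tree phi' ->
  exists psi : G -> G', [/\ graph_iso psi, forall x : X, psi (phi x) = phi' x &
    preserves_orders psi \/ reverses_orders psi].
Proof.
move=> h h'; have [psi [bij psiE padj po]] := characteristic_adj h h'.
have [psi' [_ psiE' padj' _]] := characteristic_adj h' h.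
exists psi; split=> //; split=> // x y; apply/idP/idP => [|/padj//].
have [[g _ gK] _ _ _] := h.
move=> /padj'; have e z : psi' (psi z) = z by rewrite -[z]gK psiE psiE'.
by rewrite !e.
Qed.

(** Points are matched through the vertices of [G]. The leaf cycles of [G] agree up to rotation,
    which transports hull cycles, and membership in hulls is reduced to triangles by [hull_fan]. *)
Lemma characteristic_equivalent (X Y : tdiagram R d) (G : three_tree) (phi : X -> G)
    (phi' : Y -> G) : characteristic_tree phi -> characteristic_tree phi' ->
  equivalent_by_diagonals X Y.
Proof.
move=> h h'; have [[g phiK gK] _ [s hs ls] tp] := h.
have [[g' phiK' gK'] _ [s' hs' ls'] tp'] := h'.
pose psi := g' \o phi.
have psiE x : phi' (psi x) = phi x by rewrite /psi /= gK'.
have bij : bijective psi by apply: (@bij_comp _ _ _ g' phi); [exists phi'|exists g].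
have blackE x : (psi x \in black Y) = (x \in black X).
  by rewrite -(characteristic_leaf _ h') psiE (characteristic_leaf _ h).
exists psi; split=> //.
- have [r lr] : exists r : G, leaf r.
    apply: leaf_ex; apply/card_gt0P.
    have : (0 < #|black X|)%N by rewrite card_black addn3.
    by case/card_gt0P => x _; exists (phi x).
  have [T hT] := unfolding_ex lr.
  have q : rotation (map psi s) s'.
    have -> : s' = map g' (map phi' s') by rewrite -map_comp map_id_in // => y _ /=; rewrite phiK'.
    rewrite /psi map_comp; apply: rotation_map.
    apply: (@rotation_trans _ _ (leaves T ++ [:: r])); first by apply: rotation_sym; exact: leaf_cycle_rot ls.
    exact: leaf_cycle_rot ls'.
  move=> u hu; case: (hull_cycle_unique hs hu) => k.
    apply: hull_cycle_rotation hs' _; apply: rotation_trans (rotation_sym q) _.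
    exact: rotation_map.
  apply: hull_cycle_rotation (hull_cycle_rev hs') _.
  apply: rotation_trans (rotation_sym (rotation_rev q)) _.
  by rewrite -map_rev; exact: rotation_map.
- move=> w A wB [u [k [[Uu eu _] eA]]].
  have AB : A \subset black X.
    by apply/fintype.subsetP => x; rewrite eA inE => /mem_take; rewrite eu.
  have AB' : (psi @: A)%SET \subset black Y.
    apply/fintype.subsetP => y /imsetP[x xA ->]; rewrite blackE.
    exact: (fintype.subsetP AB).
  have wB' : psi w \notin black Y by rewrite blackE.
  have inj := bij_inj bij.
  have tri a b c : a \in A -> b \in A -> c \in A -> uniq [:: a; b; c] ->
      triangle a b c (fsval w) <-> triangle (psi a) (psi b) (psi c) (fsval (psi w)).
    move=> aA bA cA U.
    have [aB bB cB] : [/\ a \in black X, b \in black X & c \in black X].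
      by split; exact: (fintype.subsetP AB).
    rewrite tp //; last exact/distinct3P.
    rewrite tp' ?blackE // ?psiE //; apply/distinct3P.
    by rewrite (map_inj_uniq inj [:: a; b; c]).
  rewrite (hull_fan wB AB) (hull_fan wB' AB'); split.
    case=> a [b [c [aA bA cA U /(tri _ _ _ aA bA cA U) t]]].
    exists (psi a), (psi b), (psi c); split; rewrite ?imset_f //.
    by rewrite (map_inj_uniq inj [:: a; b; c]).
  case=> a' [b' [c' [/imsetP[a aA ->] /imsetP[b bA ->] /imsetP[c cA ->] U t]]].
  exists a, b, c; rewrite (map_inj_uniq inj [:: a; b; c]) in U; split=> //.
  exact/tri.
Qed.

End Uniqueness.

(** * Triples in list order and triangles in a quadrangle *)

Section OrderedTriples.
Variable T : eqType.
Implicit Types (a b c x y z : T) (s : seq T).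

Lemma ordered2 s x y : x \in s -> y \in s -> x != y ->
  subseq [:: x; y] s \/ subseq [:: y; x] s.
Proof.
elim: s => // u s IH; rewrite !inE /= => xs ys xy.
have [xu|xu] := eqVneq x u.
  by left; rewrite sub1seq; move: ys; rewrite -xu eq_sym (negPf xy).
have [yu|yu] := eqVneq y u.
  by right; rewrite sub1seq; move: xs; rewrite -yu (negPf xy).
by apply: IH => //; [move: xs; rewrite (negPf xu)|move: ys; rewrite (negPf yu)].
Qed.

(** Swaps and rotations reach all orders of three entries, so a symmetric property can be checked in
    list order, where orientations are known. *)
Lemma ordered3 (P : T -> T -> T -> Prop) s :
  (forall a b c, uniq [:: a; b; c] -> P a b c -> P b a c) ->
  (forall a b c, P a b c -> P b c a) ->
  (forall a b c, subseq [:: a; b; c] s -> P a b c) ->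
  forall a b c, a \in s -> b \in s -> c \in s -> uniq [:: a; b; c] -> P a b c.
Proof.
move=> swap rot3; elim: s => // u s IH h.
have h1 x y : x \in s -> y \in s -> uniq [:: u; x; y] -> P u x y.
  move=> xs ys U; have xy : x != y by move: U => /and3P[_ + _]; rewrite inE.
  have [q|q] := ordered2 xs ys xy; first by apply: h; rewrite /= eqxx.
  apply/rot3/rot3; apply: swap; last by apply/rot3; apply: h; rewrite /= eqxx.
  by move: U; rewrite /= !inE !negb_or !andbT ![x == _]eq_sym ![y == _]eq_sym
    => /andP[/andP[-> ->] ->].
move=> a b c; rewrite !inE => as_ bs cs U.
have := U; rewrite /= !inE !negb_or !andbT => /andP[/andP[ab ac] bc].
have [e|au] := eqVneq a u.
  subst u; apply: h1 => //; first by move: bs; rewrite eq_sym (negPf ab).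
  by move: cs; rewrite eq_sym (negPf ac).
have [e|bu] := eqVneq b u.
  subst u; apply/rot3/rot3; apply: h1.
  - by move: cs; rewrite eq_sym (negPf bc).
  - by move: as_; rewrite (negPf ab).
  - by rewrite /= !inE negb_or bc eq_sym ab eq_sym ac.
have [e|cu] := eqVneq c u.
  subst u; apply/rot3; apply: h1.
  - by move: as_; rewrite (negPf ac).
  - by move: bs; rewrite (negPf bc).
  - by rewrite /= !inE negb_or ab !(eq_sym c) ac bc.
apply: IH => //; first by move=> x y z q; apply: h; exact: subseq_trans q (subseq_cons _ _).
- by move: as_; rewrite (negPf au).
- by move: bs; rewrite (negPf bu).
- by move: cs; rewrite (negPf cu).
Qed.

End OrderedTriples.

Section Quadruples.
Variable R : realType.
Implicit Types (p x y z w : plane R).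

Lemma inT_ccw x y z w : 0 < det x y z -> det x z w != 0 ->
  inT w x y z = [&& 0 < det x y w, 0 < det y z w & ~~ (0 < det x z w)].
Proof.
move=> d0 nz; apply/idP/idP.
  by move=> /(inT_pos d0)[-> ->]; rewrite det_neg.
by rewrite -(det_neg nz) /inT => /and3P[-> -> ->].
Qed.

Lemma inT_det_gt0 a b p q r w : 0 < det p q r -> inT w p q r -> det a b w != 0 ->
  0 <= det a b p -> 0 <= det a b q -> 0 <= det a b r -> 0 < det a b w.
Proof.
move=> d0 /(inT_pos d0)[h1 h2 h3] nz ha hb hc; rewrite lt0r nz /=.
rewrite -(pmulr_lge0 _ d0) det_plucker.
by rewrite !addr_ge0 // mulr_ge0 // ltW.
Qed.

(* A generic point lies in none of the four triangles or in exactly two, one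
   from each triangulation of the quadrangle. *)
Lemma inT_quadruple p x y z w : ccw [:: p; x; y; z] ->
  {in [:: p; x; y; z] &, forall a b, a != b -> det a b w != 0} -> uniq [:: p; x; y; z] ->
  inT w x y z =
  [|| [&& inT w p x y, ~~ inT w p y z & ~~ inT w p x z],
      [&& inT w p y z, ~~ inT w p x y & ~~ inT w p x z] |
      [&& inT w p x z, ~~ inT w p x y & ~~ inT w p y z]] /\
  [/\ inT w p x y -> inT w p x z \/ inT w x y z,
      inT w p y z -> inT w p x z \/ inT w x y z,
      inT w p x y -> ~~ inT w p y z & inT w p x y -> ~~ (0 < det p z w)].
Proof.
move=> /ccwP C nz U.
have [pxy pxz pyz xyz] : [/\ 0 < det p x y, 0 < det p x z, 0 < det p y z & 0 < det x y z].
  split; apply: C; apply/subseqP.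
  - by exists [:: true; true; true; false].
  - by exists [:: true; true; false; true].
  - by exists [:: true; false; true; true].
  - by exists [:: false; true; true; true].
move: U; rewrite /= !inE !negb_or !andbT => /andP[/and3P[px py pz] /andP[/andP[xy xz] yz]].
have n a b : a \in [:: p; x; y; z] -> b \in [:: p; x; y; z] -> a != b -> det a b w != 0.
  by move=> h1 h2; exact: nz.
have [np nx ny nzz] : [/\ p \in [:: p; x; y; z], x \in [:: p; x; y; z],
    y \in [:: p; x; y; z] & z \in [:: p; x; y; z]].
  by rewrite !inE !eqxx !orbT.
have {n nz} [n1 n2 n3 n4 [n5 n6]] : [/\ det p x w != 0, det p y w != 0, det p z w != 0,
    det x y w != 0 & det y z w != 0 /\ det x z w != 0].
  by split; [exact: n|exact: n|exact: n|exact: n|split; exact: n].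
have zp : det z p w != 0 by exact: det_neq_swap.
have s1 : det z p x = det p x z by rewrite -[LHS]det_rot.
have s2 : det z p y = det p y z by rewrite -[LHS]det_rot.
have s3 : det y z p = det p y z by rewrite (det_rot p).
have s4 : det x y p = det p x y by rewrite (det_rot p).
have s5 : det y z x = det x y z by rewrite (det_rot x).
(* A point of one of the four triangles lies on the inner side of those edges of the quadrangle that
   do not bound this triangle. With these facts the claim depends only on the signs of six
   determinants and is checked by cases. *)
have P1 : inT w p x y -> (0 < det p z w) = false /\ 0 < det y z w.
  move=> h; split.
    apply/negP; rewrite -(negbK (_ < _)) -det_neg //; apply/negP/negPn.
    by apply: (inT_det_gt0 pxy h); rewrite ?det_abb ?det_aba ?s1 ?s2 //; exact: ltW.
  by apply: (inT_det_gt0 pxy h); rewrite ?det_aba ?s3 ?s5 //; exact: ltW.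
have P2 : inT w p y z -> 0 < det p x w /\ 0 < det x y w.
  move=> h; split; first by apply: (inT_det_gt0 pyz h); rewrite ?det_aba //; exact: ltW.
  by apply: (inT_det_gt0 pyz h); rewrite ?det_abb ?s4 //; exact: ltW.
have P3 : inT w p x z -> 0 < det x y w /\ 0 < det y z w.
  move=> h; split; first by apply: (inT_det_gt0 pxz h); rewrite ?det_aba ?s4 //; exact: ltW.
  by apply: (inT_det_gt0 pxz h); rewrite ?det_abb ?s3 ?s5 //; exact: ltW.
have P4 : inT w x y z -> 0 < det p x w /\ (0 < det p z w) = false.
  move=> h; split; first by apply: (inT_det_gt0 xyz h); rewrite ?det_abb //; exact: ltW.
  apply/negP; rewrite -(negbK (_ < _)) -det_neg //; apply/negP/negPn.
  by apply: (inT_det_gt0 xyz h); rewrite ?det_aba ?s1 ?s2 //; exact: ltW.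
move: P1 P2 P3 P4; rewrite !inT_ccw //.
case: (0 < det p x w); case: (0 < det p y w); case: (0 < det p z w); case: (0 < det x y w);
case: (0 < det y z w); case: (0 < det x z w) => /= P1 P2 P3 P4;
  try (by case: (P1 isT)); try (by case: (P2 isT)); try (by case: (P3 isT));
  try (by case: (P4 isT)); by split=> //; split=> //; auto.
Qed.

End Quadruples.

(** * The tree of a t-diagram *)

Lemma br_le2 (V : eqType) (T : bt V) w x : uniq (labels T) -> (br T w x <= 2)%N.
Proof.
elim: T => // v L IHL R IHR U; have [UL UR vL vR dd] := uniq_Nd U.
rewrite /=; case: ifP => _; first by do 2!case: ifP => // _.
have [wL|wL] := boolP (w \in inners L); last by rewrite br_notin // IHR.
rewrite [br R w x]br_notin ?addn0 ?IHL //.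
by apply: contra (dd _ (inners_labels wL)); exact: inners_labels.
Qed.

(** The counterpart of [inT_quadruple] for branches, with [p] in branch 0. The bound matters: three
    different values among 0, 1, 2 include 0, so exactly one pair avoids it. *)
Lemma uniq3_br (bx by_ bz : nat) : (bx <= 2)%N -> (by_ <= 2)%N -> (bz <= 2)%N ->
  uniq [:: bx; by_; bz] =
  [|| [&& uniq [:: 0; bx; by_], ~~ uniq [:: 0; by_; bz] & ~~ uniq [:: 0; bx; bz]]%N,
      [&& uniq [:: 0; by_; bz], ~~ uniq [:: 0; bx; by_] & ~~ uniq [:: 0; bx; bz]]%N |
      [&& uniq [:: 0; bx; bz], ~~ uniq [:: 0; bx; by_] & ~~ uniq [:: 0; by_; bz]]%N].
Proof. by case: bx => [|[|[]]] //; case: by_ => [|[|[]]] //; case: bz => [|[|[]]]. Qed.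

Lemma uniq3_rot (T : eqType) (a b c : T) : uniq [:: b; c; a] = uniq [:: a; b; c].
Proof. exact: (rot_uniq 1 [:: a; b; c]). Qed.

Lemma uniq3_swap (T : eqType) (a b c : T) : uniq [:: b; a; c] = uniq [:: a; b; c].
Proof.
by rewrite /= !inE !negb_or !andbT (eq_sym b a) -!andbA; congr (_ && _); rewrite andbC.
Qed.

Section Existence.
Variables (R : realType) (d : nat) (X : tdiagram R d).
Implicit Types (a b c w x y z p : X).

Let pin w a b c := inT (fsval w) (fsval a) (fsval b) (fsval c).

Lemma white_ex a b c : a \in black X -> b \in black X -> c \in black X ->
  uniq [:: a; b; c] -> exists w, [/\ w \notin black X, pin w a b c &
    forall w', w' \notin black X -> pin w' a b c -> w' = w].
Proof.
move=> aB bB cB U; have dd : distinct3 a b c by exact/distinct3P.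
have [w [[wB wt] wu]] := triangle_white aB bB cB dd.
exists w; split=> //; first by apply/(diagram_inT wB aB bB cB U).
move=> w' wB' /(diagram_inT wB' aB bB cB U) wt'.
by apply/esym/wu.
Qed.

(** The default [a] is never reached for three distinct black points. *)
Definition white_of a b c : X :=
  odflt a [pick w | (w \notin black X) && pin w a b c].

Lemma white_ofP a b c : a \in black X -> b \in black X -> c \in black X ->
  uniq [:: a; b; c] -> white_of a b c \notin black X /\
  forall w, w \notin black X -> (white_of a b c == w) = pin w a b c.
Proof.
move=> aB bB cB U; have [w [wB wt wu]] := white_ex aB bB cB U.
rewrite /white_of; case: pickP => /= [w' /andP[wB' wt']|/(_ w)]; last by rewrite wB wt.
split=> // w2 wB2; apply/eqP/idP => [<- //|h].
by rewrite (wu _ wB' wt') (wu _ wB2 h).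
Qed.

Lemma diagram_det_white w a b : w \notin black X -> a \in black X -> b \in black X ->
  a != b -> det (fsval a) (fsval b) (fsval w) != 0.
Proof.
move=> wB aB bB ab; apply: diagram_det; rewrite /= !inE negb_or ab andbT.
by apply/andP; split; apply: contraNneq wB => <-.
Qed.

Lemma card_diagram : #|{: X}| = (2 * d + 4)%N.
Proof. by rewrite -(card_points X) cardfE. Qed.

Lemma diagram_tree : exists (p : X) T, [/\ uniq (p :: labels T),
  forall x, x \in p :: labels T, hull_cycle (leaves T ++ [:: p]),
  forall x, (x \in inners T) = (x \notin black X) &
  forall w a b c, w \notin black X -> a \in black X -> b \in black X -> c \in black X ->
    uniq [:: a; b; c] -> pin w a b c = uniq [:: br T w a; br T w b; br T w c]].
Proof.
have [t [Ut et ct]] := diagram_ccw X; have sz := size_black Ut et.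
case: t Ut et ct sz => [|p l] U et ct sz; first by rewrite addn3 in sz.
pose g x y := white_of p x y.
have lB x : x \in l -> x \in black X by move=> xl; rewrite -et inE xl orbT.
have pB : p \in black X by rewrite -et mem_head.
have lS (u : seq X) : subseq u l -> uniq (p :: u).
  by move=> h; apply: subseq_uniq U; rewrite /= eqxx.
have mS (u : seq X) x : subseq u l -> x \in u -> x \in black X.
  by move=> h xu; apply/lB/(mem_subseq h).
have gP x y : x \in l -> y \in l -> x != y -> g x y \notin black X /\
    forall w, w \notin black X -> (g x y == w) = pin w p x y.
  move=> xl yl xy; apply: (white_ofP pB (lB _ xl) (lB _ yl)).
  have /andP[pl _] := U; rewrite /= !inE negb_or xy !andbT.
  by apply/andP; split; apply: contraNneq pl => ->.
have gS x y (u : seq X) : subseq u l -> x \in u -> y \in u -> x != y ->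
    g x y \notin black X /\ forall w, w \notin black X -> (g x y == w) = pin w p x y.
  by move=> h xu yu; apply: gP; apply: (mem_subseq h).
have Q x y z w : subseq [:: x; y; z] l -> w \notin black X ->
    pin w x y z =
    [|| [&& pin w p x y, ~~ pin w p y z & ~~ pin w p x z],
        [&& pin w p y z, ~~ pin w p x y & ~~ pin w p x z] |
        [&& pin w p x z, ~~ pin w p x y & ~~ pin w p y z]] /\
    [/\ pin w p x y -> pin w p x z \/ pin w x y z,
        pin w p y z -> pin w p x z \/ pin w x y z,
        pin w p x y -> ~~ pin w p y z &
        pin w p x y -> ~~ (0 < det (fsval p) (fsval z) (fsval w))].
  move=> sub wB; apply: inT_quadruple.
  - rewrite -[[:: _; _; _; _]]/(map (@fsval _ (points X)) [:: p; x; y; z]).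
    by apply: ccw_subseq ct; apply: map_subseq; rewrite /= eqxx.
  - rewrite -[[:: _; _; _; _]]/(map (@fsval _ (points X)) [:: p; x; y; z]).
    move=> q r /mapP[a aI ->] /mapP[b bI ->] ab; apply: diagram_det_white => //.
    + by move: aI; rewrite in_cons => /orP[/eqP->//|/(mS _ _ sub)].
    + by move: bI; rewrite in_cons => /orP[/eqP->//|/(mS _ _ sub)].
  - rewrite -[[:: _; _; _; _]]/(map (@fsval _ (points X)) [:: p; x; y; z]).
    by rewrite map_inj_uniq ?lS //; exact: fsval_inj.
have three x y z : subseq [:: x; y; z] l -> [/\ x != y, x != z & y != z].
  move/lS; rewrite /= !inE !negb_or !andbT => /andP[_ /andP[/andP[-> ->] ->]] //.
(* If neither equation held, the white points of [pxy] and [pyz] would both lie in [xyz] and hence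
   coincide, although these two triangles share no white point. *)
have g1 x y z : subseq [:: x; y; z] l -> g x y = g x z \/ g y z = g x z.
  move=> sub; have [xy xz yz] := three _ _ _ sub.
  have [xi yi zi] : [/\ x \in [:: x; y; z], y \in [:: x; y; z] & z \in [:: x; y; z]].
    by rewrite !inE !eqxx !orbT.
  have [gxy gxyP] := gS _ _ _ sub xi yi xy; have [gxz gxzP] := gS _ _ _ sub xi zi xz.
  have [gyz gyzP] := gS _ _ _ sub yi zi yz.
  have [_ [q1 _ _ _]] := Q _ _ _ _ sub gxy; have [_ [_ q2 _ _]] := Q _ _ _ _ sub gyz.
  case: q1; first by rewrite -gxyP.
    by rewrite -gxzP // => /eqP; left.
  move=> t1; case: q2; first by rewrite -gyzP.
    by rewrite -gxzP // => /eqP; right.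
  move=> t2.
  have [w [wB wt wu]] := white_ex (mS _ _ sub xi) (mS _ _ sub yi) (mS _ _ sub zi)
     (subseq_uniq (subseq_cons [:: x; y; z] p) (lS _ sub)).
  have e : g x y = g y z by rewrite (wu _ gxy t1) (wu _ gyz t2).
  have [_ [_ _ q3 _]] := Q _ _ _ _ sub gxy.
  by move: q3; rewrite -gxyP // eqxx => /(_ isT); rewrite -gyzP // -e eqxx.
have g2 x y z : subseq [:: x; y; z] l -> g x y <> g y z.
  move=> sub e; have [xy xz yz] := three _ _ _ sub.
  have [xi yi zi] : [/\ x \in [:: x; y; z], y \in [:: x; y; z] & z \in [:: x; y; z]].
    by rewrite !inE !eqxx !orbT.
  have [gxy gxyP] := gS _ _ _ sub xi yi xy; have [gyz gyzP] := gS _ _ _ sub yi zi yz.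
  have [_ [_ _ q3 _]] := Q _ _ _ _ sub gxy.
  by move: q3; rewrite -gxyP // eqxx => /(_ isT); rewrite -gyzP // -e eqxx.
(* The line [pz] separates the triangles [pxy] and [pzu]. *)
have g3 x y z (u : X) : subseq [:: x; y; z; u] l -> g x y <> g z u.
  move=> sub e.
  have s1 : subseq [:: x; y; z] l.
    by apply: subseq_trans sub; apply/subseqP; exists [:: true; true; true; false].
  have s2 : subseq [:: x; z; u] l.
    by apply: subseq_trans sub; apply/subseqP; exists [:: true; false; true; true].
  have [xy xz yz] := three _ _ _ s1; have [_ _ zu] := three _ _ _ s2.
  have xi : x \in [:: x; y; z] by rewrite !inE eqxx.
  have yi : y \in [:: x; y; z] by rewrite !inE eqxx orbT.
  have zi : z \in [:: x; z; u] by rewrite !inE eqxx orbT.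
  have ui : u \in [:: x; z; u] by rewrite !inE eqxx !orbT.
  have [gxy gxyP] := gS _ _ _ s1 xi yi xy; have [gzu gzuP] := gS _ _ _ s2 zi ui zu.
  have [_ [_ _ _ q4]] := Q _ _ _ _ s1 gxy.
  have /negP[] : ~~ (0 < det (fsval p) (fsval z) (fsval (g x y))).
    by apply: q4; rewrite -gxyP.
  have d0 : 0 < det (fsval p) (fsval z) (fsval u).
    apply: (iffLR (ccwP _) ct); rewrite -[[:: _; _; _]]/(map (@fsval _ (points X)) [:: p; z; u]).
    apply: map_subseq; rewrite /= eqxx; apply: subseq_trans s2; exact: subseq_cons.
  have : pin (g x y) p z u by rewrite e -gzuP.
  by move=> /(inT_pos d0)[].
have nl : l != [::] by case: (l) sz => //=; rewrite addn3.
have Ul : uniq l by case/andP: U.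
have [T [lT lcaT iU iT]] := bt_of_lca Ul nl g1 g2 g3.
have iW w : w \in inners T -> w \notin black X.
  case/iT=> x [y [sub ->]].
  have xy : x != y by move: (subseq_uniq sub Ul); rewrite /= inE andbT.
  by apply: (gS _ _ _ sub _ _ xy).1; rewrite !inE eqxx ?orbT.
have UT : uniq (p :: labels T).
  rewrite cons_uniq (perm_uniq (labels_perm T)) cat_uniq iU lT Ul andbT /= mem_labels lT negb_or.
  apply/andP; split; last by apply/hasPn => w /iW; apply: contra => /lB.
  by move: U => /= /andP[-> _] /=; apply/negP => /iW; rewrite pB.
(* The [d + 2] leaves force [d + 1] inner labels; together with [p] these are [2 * d + 4] different
   points, hence all points of the diagram. *)
have cover x : x \in p :: labels T.
  have sub : {subset p :: labels T <= enum {: X}} by move=> y _; rewrite mem_enum.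
  have [|_ ->] := uniq_min_size UT sub; last by rewrite mem_enum.
  rewrite -cardE card_diagram /= (perm_size (labels_perm T)) size_cat.
  by have := size_leaves T; rewrite lT; move: sz => /=; lia.
have inE' x : (x \in inners T) = (x \notin black X).
  apply/idP/idP => [/iW//|xW]; move: (cover x).
  rewrite inE mem_labels lT => /or3P[/eqP e|/lB e|//]; first by rewrite e pB in xW.
  by rewrite e in xW.
exists p, T; split=> //.
  rewrite lT; apply: (@hull_cycle_rotation _ _ _ (p :: l)); last exact: (rotation_catC [:: p]).
  exact: ccw_hull_cycle.
have UlT : uniq (labels T) by case/andP: UT.
have bp w : br T w p = 0%N by apply: br_out; case/andP: UT.
have pinE w x y : w \notin black X -> subseq [:: x; y] l ->
    pin w p x y = uniq [:: 0%N; br T w x; br T w y].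
  move=> wB sub; have xy : x != y by move: (subseq_uniq sub Ul); rewrite /= inE andbT.
  have [xl yl] : x \in l /\ y \in l by split; apply: (mem_subseq sub); rewrite !inE eqxx ?orbT.
  by rewrite lca_br ?inE' ?lT // lcaT // (gP _ _ xl yl xy).2.
move=> w a b c wB aB bB cB Uabc.
(* Triangles with vertex [p] are settled by [pinE], that is, by the choice of [lca]. For ordered
   triples without [p] both sides are expressed through those triangles, by [inT_quadruple] and by
   [uniq3_br]. *)
move: a b c aB bB cB Uabc; suff H a b c : a \in p :: l -> b \in p :: l -> c \in p :: l ->
    uniq [:: a; b; c] -> (uniq [:: a; b; c] -> a \in black X -> b \in black X -> c \in black X ->
      pin w a b c = uniq [:: br T w a; br T w b; br T w c]).
  by move=> a b c aB bB cB Uabc; apply: H; rewrite ?et.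
apply: (@ordered3 _ (fun a b c => uniq [:: a; b; c] -> a \in black X -> b \in black X ->
  c \in black X -> pin w a b c = uniq [:: br T w a; br T w b; br T w c])).
- move=> {}a {}b {}c U1 IH U2 bB aB cB.
  have [ab bc ca] : [/\ a != b, b != c & c != a].
    by move: U1; rewrite /= !inE negb_or !andbT (eq_sym c) => /andP[/andP[]].
  have e : pin w b a c = pin w a b c by apply: inT_swap; exact: diagram_det_white.
  by rewrite e (IH U1 aB bB cB); exact/esym/uniq3_swap.
- move=> {}a {}b {}c IH U2 bB cB aB.
  have e : pin w b c a = pin w a b c by exact: inT_rot.
  have U1 : uniq [:: a; b; c] by rewrite -uniq3_rot.
  by rewrite e (IH U1 aB bB cB); exact/esym/uniq3_rot.
- move=> {}a {}b {}c sub Uabc _ _ _; rewrite [subseq _ _]/= in sub.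
  case: ifP sub => [/eqP-> sub|_ sub].
    by rewrite (pinE w _ _ wB sub) bp.
  have sub' u v : subseq [:: u; v] [:: a; b; c] -> subseq [:: u; v] l.
    by move=> h; exact: subseq_trans h sub.
  have [-> _] := Q a b c w sub wB.
  rewrite uniq3_br ?br_le2 // !pinE //; apply: sub'; apply/subseqP.
  + by exists [:: true; false; true].
  + by exists [:: false; true; true].
  + by exists [:: true; true; false].
Qed.

Lemma characteristic_ex : exists (G : three_tree) (phi : X -> G), characteristic_tree phi.
Proof.
have [p [T [UT cover hc iE pE]]] := diagram_tree.
have hG := realization_unfolding UT cover; set G := realization UT cover in hG.
exists G, (id : X -> G); split.
- by exists id.
- move=> x; case: ifP => xB; last by rewrite (inner_inners hG) iE xB.
  have -> : leaf (x : G) = ~~ inner (x : G) by exact: leafN_inner.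
  by rewrite (inner_inners hG) iE xB.
- exists (leaves T ++ [:: p]) => //; rewrite map_id.
  by have [lr hT _ cv] := hG; exact: leaf_cycle_unfolding lr hT UT.
- move=> w a b c wB aB bB cB /distinct3P U.
  have nw x : x \in black X -> x != w by move=> xB; apply: contraNneq wB => <-.
  rewrite (diagram_inT wB aB bB cB U) -/(pin w a b c) pE //.
  by apply: iff_sym; apply: (three_paths_br hG); rewrite ?iE ?nw.
Qed.

End Existence.

(** * Realizing a tree by points *)

Section Perturbation.
Variable R : realType.
Implicit Types (p q u w x y z m : plane R) (s : seq (plane R)).

(** For [e <= 1] the perturbing terms together are at most [e] times the sum of the absolute values
    of [c1] and [c2]; the added 1 keeps the denominator positive. *)
Lemma near0_pos (c0 c1 c2 : R) : 0 < c0 ->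
  exists2 dl : R, 0 < dl & forall e, 0 < e < dl -> 0 < c0 + e * c1 + e ^+ 2 * c2.
Proof.
move=> h; have D : 0 < `|c1| + `|c2| + 1 by rewrite ltr_wpDl // addr_ge0.
exists (Num.min 1 (c0 / (`|c1| + `|c2| + 1))).
  by rewrite lt_min ltr01 divr_gt0.
move=> e; rewrite lt_min ltr_pdivlMr // => /andP[e0 /andP[e1 ec]].
have h1 : - (e * `|c1|) <= e * c1.
  by rewrite -mulrN ler_pM2l // lerNl -normrN ler_norm.
have h2 : - (e * `|c2|) <= e ^+ 2 * c2.
  apply: (@le_trans _ _ (- (e ^+ 2 * `|c2|))).
    by rewrite lerN2 ler_wpM2r // expr2 ger_pMl // ltW.
  by rewrite -mulrN ler_pM2l ?exprn_gt0 // lerNl -normrN ler_norm.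
by move: ec; rewrite !mulrDr mulr1; lra.
Qed.

(** For small [e] the lowest nonvanishing coefficient decides the sign. *)
Lemma near0_nonzero (c0 c1 c2 : R) : (c0 != 0) || (c1 != 0) || (c2 != 0) ->
  exists2 dl : R, 0 < dl & forall e, 0 < e < dl ->
    [/\ c0 + e * c1 + e ^+ 2 * c2 != 0,
        0 < c0 -> 0 < c0 + e * c1 + e ^+ 2 * c2 &
        c0 = 0 -> 0 < c1 -> 0 < c0 + e * c1 + e ^+ 2 * c2].
Proof.
have [c0p _|c0n _|c00] := ltgtP c0 0.
- have [dl d0 h] := @near0_pos (- c0) (- c1) (- c2) ltac:(lra).
  exists dl => // e /h he; split; [|lra|lra].
  by apply: ltr0_neq0; lra.
- have [dl d0 h] := @near0_pos c0 c1 c2 c0n.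
  by exists dl => // e /h he; split=> //; rewrite lt0r_neq0.
rewrite c00 /=; have [c1n _|c1p _|c10] := ltgtP c1 0.
- have [dl d0 h] := @near0_pos (- c1) (- c2) 0 ltac:(lra).
  exists dl => // e ed; have he := h e ed; have /andP[e0 _] := ed.
  split; [|lra|lra].
  have -> : 0 + e * c1 + e ^+ 2 * c2 = - (e * (- c1 + e * - c2 + e ^+ 2 * 0)) by ring.
  by rewrite oppr_eq0 mulf_neq0 ?lt0r_neq0.
- have [dl d0 h] := @near0_pos c1 c2 0 c1p.
  exists dl => // e ed; have he := h e ed; have /andP[e0 _] := ed.
  have E : 0 + e * c1 + e ^+ 2 * c2 = e * (c1 + e * c2 + e ^+ 2 * 0) by ring.
  by split=> [|//|_ _]; rewrite E ?lt0r_neq0 // mulr_gt0.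
rewrite c10 /= => c2n; exists 1 => // e /andP[e0 _].
rewrite mulr0 !add0r; split=> //.
by rewrite mulf_neq0 // expf_neq0 // lt0r_neq0.
Qed.

Lemma near0_all (I : eqType) (s : seq I) (P : I -> R -> Prop) :
  (forall i, i \in s -> exists2 dl : R, 0 < dl & forall e, 0 < e < dl -> P i e) ->
  exists2 dl : R, 0 < dl & forall e, 0 < e < dl -> forall i, i \in s -> P i e.
Proof.
elim: s => [|i s IH] h; first by exists 1.
have [d1 p1 h1] := h i (mem_head _ _).
have [d2 p2 h2] : exists2 dl : R, 0 < dl & forall e, 0 < e < dl -> forall i, i \in s -> P i e.
  by apply: IH => j js; apply: h; rewrite inE js orbT.
exists (Num.min d1 d2); first by rewrite lt_min p1.
move=> e; rewrite lt_min => /andP[e0 /andP[e1 e2]] j; rewrite inE => /orP[/eqP->|js].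
  by apply: h1; rewrite e0.
by apply: h2 => //; rewrite e0.
Qed.

(* Move a little from [m] along a curve with initial velocity [u]; the curve is
   a parabola, so it meets each of the given lines in finitely many points. *)
Lemma perturb s m u : u != 0 -> exists w, forall p q, p \in s -> q \in s -> p != q ->
  [/\ det p q w != 0, 0 < det p q m -> 0 < det p q w &
      det p q m = 0 -> 0 < det p q (p + u) -> 0 < det p q w].
Proof.
(* The vector [v] is [u] turned by a right angle. If the linear and the quadratic coefficient both
   vanished, [q - p] would be parallel to both vectors and hence 0. *)
move=> u0; pose v := pt (- cy u) (cx u).
pose W (e : R) := m + e *: u + e ^+ 2 *: v.
have E p q e : det p q (W e) =
    det p q m + e * det p q (p + u) + e ^+ 2 * det p q (p + v).
  by rewrite /W /v /det !cE; ring.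
have [|dl d0 h] := @near0_all _ s (fun p e => forall q, q \in s -> p != q ->
  [/\ det p q (W e) != 0, 0 < det p q m -> 0 < det p q (W e) &
      det p q m = 0 -> 0 < det p q (p + u) -> 0 < det p q (W e)]); last first.
  exists (W (dl / 2)) => p q ps qs pq; apply: h => //.
  by rewrite divr_gt0 //= ltr_pdivrMr // ltr_pMr // ltr1n.
move=> p ps; apply: (@near0_all _ s (fun q e => p != q -> _)) => q qs.
have [<-|pq] := eqVneq p q; first by exists 1.
have [|dl d0 h] := @near0_nonzero (det p q m) (det p q (p + u)) (det p q (p + v)).
  apply/norP => -[/norP[_ /negPn/eqP e1] /negPn/eqP e2].
  have uu : 0 < cx u ^+ 2 + cy u ^+ 2.
    rewrite lt0r addr_ge0 ?sqr_ge0 // andbT paddr_eq0 ?sqr_ge0 // !sqrf_eq0.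
    by apply: contra u0 => /andP[/eqP x0 /eqP y0]; apply/eqP/plane_eq; rewrite !cE.
  have ex : (cx q - cx p) * (cx u ^+ 2 + cy u ^+ 2) = 0.
    have -> : (cx q - cx p) * (cx u ^+ 2 + cy u ^+ 2) =
      det p q (p + v) * cx u + det p q (p + u) * cy u by rewrite /det /v !cE; ring.
    by rewrite e1 e2 !mul0r addr0.
  have ey : (cy q - cy p) * (cx u ^+ 2 + cy u ^+ 2) = 0.
    have -> : (cy q - cy p) * (cx u ^+ 2 + cy u ^+ 2) =
      det p q (p + v) * cy u - det p q (p + u) * cx u by rewrite /det /v !cE; ring.
    by rewrite e1 e2 !mul0r subr0.
  move/eqP: ex; rewrite mulf_eq0 (gt_eqF uu) orbF subr_eq0 => /eqP ex.
  move/eqP: ey; rewrite mulf_eq0 (gt_eqF uu) orbF subr_eq0 => /eqP ey.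
  by case/eqP: pq; apply: plane_eq.
by exists dl => // e /h; rewrite -E.
Qed.

(** Let [y] and [q] be the neighbours of [p]. The line through [p] parallel to [qy] works, because
    its determinant at [z] is [det p y z + det p z q]. With only two points, a perpendicular to the
    segment serves. *)
Lemma ccw_support s p : uniq s -> ccw s -> p \in s -> (1 < size s)%N ->
  exists2 u, u != 0 & forall z, z \in s -> z != p -> 0 < det p (p + u) z.
Proof.
move=> U cs ps sz; have [i l e] := rot_to ps.
have Ul : uniq (p :: l) by rewrite -e rot_uniq.
have cl : ccw (p :: l) by rewrite -e ccw_rot.
have sl : (1 < size (p :: l))%N by rewrite -e size_rot.
suff [u hu] : exists u, forall z, z \in l -> 0 < det p (p + u) z.
  exists u.
    case: l {Ul cl e} sl hu => // y l _ /(_ y (mem_head _ _)).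
    by apply: contraTneq => ->; rewrite addr0 det_aa ltxx.
  by move=> z; rewrite -(mem_rot i) e inE => /orP[/eqP->|/hu//]; rewrite eqxx.
case: l {e} sl Ul cl => [|y [|y' l]] // _ Ul cl.
  exists (pt (cy y - cy p) (cx p - cx y)) => z; rewrite inE => /eqP->.
  have -> : det p (p + pt (cy y - cy p) (cx p - cx y)) y =
    (cx y - cx p) ^+ 2 + (cy y - cy p) ^+ 2 by rewrite /det !cE; ring.
  rewrite lt0r addr_ge0 ?sqr_ge0 // andbT paddr_eq0 ?sqr_ge0 // !sqrf_eq0 !subr_eq0.
  move: Ul; rewrite /= inE andbT; apply: contra => /andP[/eqP ex /eqP ey].
  by apply/eqP/plane_eq.
pose q := last y' l; exists (y - q) => z zl.
have -> : det p (p + (y - q)) z = det p y z + det p z q by rewrite /det !cE; ring.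
have qE : q \in y' :: l by exact: mem_last.
have yq : y != q by apply: contraTneq qE => <-; move: Ul; rewrite /= !inE => /and3P[_].
have h1 : z != y -> 0 < det p y z.
  move=> zy; apply: (ccw_head cl); apply: (@subseq_pair_cat _ y z [:: y]); first exact: mem_head.
  by rewrite in_cons (negPf zy) in zl.
have h2 : z != q -> 0 < det p z q.
  move=> zq; apply: (ccw_head cl).
  have -> : [:: y, y' & l] = rcons (belast y (y' :: l)) q by rewrite -lastI.
  rewrite -cats1; apply: subseq_pair_cat; last by rewrite inE.
  by rewrite lastI mem_rcons in_cons -/q (negPf zq) in zl.
have [zy|zy] := eqVneq z y.
  by rewrite zy det_abb add0r -zy h2 // zy.
have [zq|zq] := eqVneq z q; first by rewrite {2}zq det_abb addr0 h1.
by rewrite addr_gt0 // ?h1 ?h2.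
Qed.

End Perturbation.

(** * Adding a black and a white point *)

Section Splitting.
Variable R : realType.
Implicit Types (a b p q u w x y z : plane R) (s l ws : seq (plane R)).

Lemma generic_cons s x : uniq s -> (1 < size s)%N -> generic s ->
  (forall p q, p \in s -> q \in s -> p != q -> det p q x != 0) ->
  uniq (x :: s) /\ generic (x :: s).
Proof.
move=> U sz gs h; have xs : x \notin s.
  apply/negP => xs; have [i l e] := rot_to xs.
  have : size (x :: l) = size s by rewrite -e size_rot.
  have : uniq (x :: l) by rewrite -e rot_uniq.
  case: l e => [_ _ e|y l e]; first by rewrite -e in sz.
  rewrite /= inE negb_or => /andP[/andP[xy _] _] _.
  have ys : y \in s by rewrite -(mem_rot i) e !inE eqxx orbT.
  by have := h _ _ xs ys xy; rewrite det_aba eqxx.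
split; first by rewrite /= xs.
have xp p : p \in s -> x != p by move=> ps; apply: contraNneq xs => ->.
move=> a b c; rewrite !inE => /orP[/eqP->|aS] /orP[/eqP->|bS] /orP[/eqP->|cS];
  rewrite /= !inE ?eqxx ?orbT //= ?andbF //= ?negb_or ?andbT => /andP[/andP[ab ac] bc].
- by rewrite -det_rot; apply: h.
- by rewrite det_rot; apply: h => //; rewrite eq_sym.
- exact: h.
- by apply: gs; rewrite //= !inE negb_or ab ac bc.
Qed.

(** The point [b] is [a] moved slightly along a supporting line, and [w] is the midpoint of [ab]
    moved slightly inwards. Strict inequalities at the starting point survive; for a line through
    the starting point, the direction of motion decides. Thus [b] is on the same side as [a] of all
    lines through other points, [w] is so for the lines through points of [l], and [w] lies in every
    triangle [aby]. *)
Lemma split_point a l ws : uniq (a :: l ++ ws) -> generic (a :: l ++ ws) ->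
  ccw (a :: l) -> l != [::] ->
  exists b w, [/\ uniq [:: w, b, a & l ++ ws] /\ generic [:: w, b, a & l ++ ws],
    ccw [:: a, b & l],
    {in l ++ ws &, forall x y, x != y -> (0 < det x y b) = (0 < det x y a)},
    {in l &, forall x y, x != y -> (0 < det x y w) = (0 < det x y a)} &
    0 < det a b w /\ forall y, y \in l -> 0 < det b y w /\ 0 < det y a w].
Proof.
move=> U gS cl ln.
have Ul : uniq (a :: l) by move: U; rewrite -cat_cons cat_uniq => /andP[].
have szl : (1 < size (a :: l))%N by case: l ln {U gS cl Ul}.
have szS : (1 < size (a :: l ++ ws))%N.
  by apply: leq_trans szl _; rewrite /= size_cat ltnS leq_addr.
have [u u0 hu] := ccw_support Ul cl (mem_head _ _) szl.
have [b hb] := perturb (a :: l ++ ws) a u0.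
have bdet p q ps qs pq := let: And3 h _ _ := hb p q ps qs pq in h.
have [Ub gb] := generic_cons U szS gS bdet.
have la z : z \in l -> z \in a :: l ++ ws by move=> zl; rewrite inE mem_cat zl orbT.
have za z : z \in l -> z != a by move=> zl; apply: contraTneq Ul => <-; rewrite /= zl.
have aS : a \in a :: l ++ ws by exact: mem_head.
(* The line [za] passes through the starting point [a], so the velocity [u] decides. *)
have F2 z : z \in l -> 0 < det a b z.
  move=> zl; have [_ _ h] := hb z a (la _ zl) aS (za _ zl).
  rewrite (det_rot z); apply: h; first by rewrite det_abb.
  have -> : det z a (z + u) = det a (a + u) z by rewrite /det !cE; ring.
  by apply: hu; rewrite ?za // inE zl orbT.
have F1 : {in l ++ ws &, forall x y, x != y -> (0 < det x y b) = (0 < det x y a)}.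
  move=> x y xS yS xy.
  have xa : x \in a :: l ++ ws by rewrite inE xS orbT.
  have ya : y \in a :: l ++ ws by rewrite inE yS orbT.
  have nz : det x y a != 0.
    have aN : a \notin l ++ ws by case/andP: U.
    apply: gS => //; rewrite /= !inE negb_or xy !andbT.
    by apply/andP; split; apply: contraNneq aN => <-.
  have [_ h1 _] := hb _ _ xa ya xy.
  have yx : y != x by rewrite eq_sym.
  have [_ h2 _] := hb _ _ ya xa yx.
  apply/idP/idP => // h; have := nz; rewrite neq_lt => /orP[n|//].
  by move: h2; rewrite !(det_swap x y) !oppr_gt0 => /(_ n)/(lt_trans h); rewrite ltxx.
have cab : ccw [:: a, b & l].
  move: cl; rewrite /= => /andP[pw cl'].
  apply/andP; split; first by apply/andP; split=> //; apply/allP.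
  apply/andP; split=> //.
  apply/pairwise_subseq2 => y z sub; rewrite -(det_rot b).
  have [yl zl] : y \in l /\ z \in l by split; apply: (mem_subseq sub); rewrite !inE eqxx ?orbT.
  have yz : y != z.
    have Ul' : uniq l by case/andP: Ul.
    by move: (subseq_uniq sub Ul'); rewrite /= inE andbT.
  rewrite F1 ?mem_cat ?yl ?zl // (det_rot a).
  by move/pairwise_subseq2: pw; apply.
have ab : b != a by apply: contraTneq Ub => ->; rewrite /= mem_head.
pose h : R := 2^-1; pose m := h *: a + (1 - h) *: b.
have h0 : 0 < h by rewrite /h.
have h1 : 0 < 1 - h by rewrite /h; lra.
(* This is [b - a] turned to the left, hence towards the inner side of the new edge. *)
pose v := pt (cy a - cy b) (cx b - cx a).
have vE : det a b (a + v) = (cx b - cx a) ^+ 2 + (cy b - cy a) ^+ 2.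
  by rewrite /v /det !cE; ring.
have vp : 0 < det a b (a + v).
  rewrite vE lt0r addr_ge0 ?sqr_ge0 // andbT paddr_eq0 ?sqr_ge0 // !sqrf_eq0 !subr_eq0.
  by apply: contra ab => /andP[/eqP ex /eqP ey]; apply/eqP/plane_eq.
have v0 : v != 0 by apply: contraTneq vp => ->; rewrite addr0 det_aba ltxx.
have [w hw] := perturb (b :: a :: l ++ ws) m v0.
have szb : (1 < size [:: b, a & l ++ ws])%N by [].
have wdet p q ps qs pq := let: And3 h _ _ := hw p q ps qs pq in h.
have wpos p q ps qs pq := let: And3 _ h _ := hw p q ps qs pq in h.
have aB : a \in [:: b, a & l ++ ws] by rewrite !inE eqxx orbT.
have bB : b \in [:: b, a & l ++ ws] by exact: mem_head.
have lB z : z \in l -> z \in [:: b, a & l ++ ws] by move=> zl; rewrite in_cons la ?orbT.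
have bz z : z \in l -> b != z.
  by move=> zl; apply: contraTneq Ub => ->; rewrite cons_uniq in_cons mem_cat zl orbT.
exists b, w; split=> //.
- exact: generic_cons Ub szb gb wdet.
- have pos x y : x \in l -> y \in l -> x != y -> 0 < det x y a -> 0 < det x y w.
    move=> xl yl xy d; apply: wpos; rewrite ?lB //.
    have : 0 < det x y b by rewrite F1 // mem_cat ?xl ?yl.
    by move=> d'; rewrite /m det_conv addr_gt0 // mulr_gt0.
  move=> x y xl yl xy; apply/idP/idP; last exact: pos.
  apply: contraTT; rewrite -!leNgt => d.
  have yx : y != x by rewrite eq_sym.
  have nz : det y x a != 0.
    have aN : a \notin l by case/andP: Ul.
    apply: (gS _ _ _ (la _ yl) (la _ xl) aS); rewrite /= !inE negb_or yx !andbT.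
    by apply/andP; split; apply: contraNneq aN => <-.
  rewrite -oppr_ge0 -det_swap ltW //; apply: pos => //.
  by rewrite lt0r nz /= det_swap oppr_ge0.
- have ba : a != b by rewrite eq_sym.
  have [_ _ k] := hw a b aB bB ba; split.
    apply: k => //.
    by rewrite /m det_conv det_aba det_abb !mulr0 addr0.
  move=> y yl; split.
    apply: (wpos _ _ bB (lB _ yl) (bz _ yl)).
    by rewrite /m det_conv det_aba mulr0 addr0 mulr_gt0 // (det_rot a) F2.
  apply: (wpos _ _ (lB _ yl) aB (za _ yl)).
  by rewrite /m det_conv det_abb mulr0 add0r mulr_gt0 // -(det_rot y) F2.
Qed.

End Splitting.

(** * Induction on grafts and medians of leaves *)

Section GraftInduction.
Variable V : eqType.
Implicit Types (T : bt V) (a b w x y z r : V).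

Lemma graft_ind (P : bt V -> Prop) : (forall a, P (Lf a)) ->
  (forall T a w b, a \in leaves T -> uniq (labels T) -> w \notin labels T ->
     b \notin w :: labels T -> P T -> P (graft T a w b)) ->
  forall T, uniq (labels T) -> P T.
Proof.
move=> hl hg T; move: {2}(size (leaves T)) (leqnn (size (leaves T))) => n.
elim: n T => [|n IH] T sT U; first by rewrite size_leaves in sT.
have [s1|s1] := ltnP 1 (size (leaves T)).
  have [T' [a [w [b [e aT UT /andP[wT bT] sz]]]]] := ungraft U s1.
  by rewrite e; apply: hg => //; apply: IH => //; rewrite -ltnS -sz.
case: T s1 {sT U} => [a|v L R] //.
by rewrite /= size_cat !size_leaves addSn addnS.
Qed.

Lemma graft_perm T a w b s1 s2 r : uniq (leaves T) -> leaves T = s1 ++ a :: s2 ->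
  perm_eq (r :: labels (graft T a w b)) [:: w, b, a & (s2 ++ r :: s1) ++ inners T].
Proof.
move=> U e; have aT : a \in leaves T by rewrite e mem_cat mem_head orbT.
have e1 := graft_leaves w b U e; have /permP p2 := graft_inners w b U aT.
have /permP p1 := labels_perm (graft T a w b).
apply/permP => P; move: (p1 P) (p2 P); rewrite e1 /= !count_cat => -> -> /=.
rewrite ?count_cat /=; lia.
Qed.

Lemma ungraft_perm T a s1 s2 r : leaves T = s1 ++ a :: s2 ->
  perm_eq (r :: labels T) (a :: (s2 ++ r :: s1) ++ inners T).
Proof.
move=> e; have /permP p1 := labels_perm T; apply/permP => P; move: (p1 P).
by rewrite e /= !count_cat => -> /=; lia.
Qed.

Section Merge.
Variables (a b : V).
Hypothesis ab : a != b.

(** Merging [b] into [a] undoes a graft on the leaves; by [br_graft], the old vertices do not see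
    the difference. *)
Definition bar x := if x == b then a else x.
Definition both x y z := (a \in [:: x; y; z]) && (b \in [:: x; y; z]).

Lemma bar_uniq x y z : uniq [:: x; y; z] ->
  uniq [:: bar x; bar y; bar z] = ~~ both x y z.
Proof.
have nb u : u != b -> bar u = u by rewrite /bar => /negPf->.
have main y' z' : uniq [:: b; y'; z'] ->
    uniq [:: bar b; bar y'; bar z'] = ~~ both b y' z'.
  rewrite cons_uniq !inE negb_or => /andP[/andP[yb zb] U].
  have [-> ->] : bar y' = y' /\ bar z' = z' by rewrite !nb // eq_sym.
  rewrite /both mem_head andbT in_cons (negPf ab) orFb cons_uniq U andbT.
  by rewrite /bar eqxx.
have bsw x' y' z' : both y' x' z' = both x' y' z' by rewrite /both !inE !(orbCA (_ == y')).
have brot x' y' z' : both y' z' x' = both x' y' z'.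
  have r u : (u \in [:: y'; z'; x']) = (u \in [:: x'; y'; z']) by exact: (mem_rot 1 [:: x'; y'; z']).
  by rewrite /both !r.
move=> U; have [e|xb] := eqVneq x b; first by subst x; exact: main.
have [e|yb] := eqVneq y b.
  by subst y; rewrite uniq3_swap bsw; apply: main; rewrite uniq3_swap.
have [e|zb] := eqVneq z b.
  by subst z; rewrite -uniq3_rot -uniq3_rot -brot -brot; apply: main; rewrite uniq3_rot uniq3_rot.
rewrite !nb // U /both; rewrite [b \in _]inE [b \in _]inE [b \in _]inE.
by rewrite !(eq_sym b) (negPf xb) (negPf yb) (negPf zb) andbF.
Qed.

Lemma both_inv x y z : both x y z ->
  [\/ (x = a /\ y = b) \/ (x = b /\ y = a), (x = a /\ z = b) \/ (x = b /\ z = a) |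
      (y = a /\ z = b) \/ (y = b /\ z = a)].
Proof.
have abF : a = b -> False by apply/eqP.
rewrite /both !inE => /andP[/or3P[]/eqP ea /or3P[]/eqP eb];
  try (by case: abF; rewrite ea eb);
  by [apply: Or31; auto|apply: Or32; auto|apply: Or33; auto].
Qed.

(** By [br_graft_new], [f] gives the branches at the new vertex of a graft: 1 for [a], 2 for [b] and
    0 for all other leaves. Only triples with both [a] and [b] are separated there. *)
Lemma both_uniq x y z : uniq [:: x; y; z] ->
  let f u := (if u == a then 1 else if u == b then 2 else 0)%N in
  uniq [:: f x; f y; f z] = both x y z.
Proof.
rewrite /both !inE /= !inE !negb_or !andbT => /andP[/andP[xy xz] yz].
have nab u : ~~ ((u == a) && (u == b)).
  by apply/negP => /andP[/eqP e1 /eqP e2]; move: ab; rewrite -e1 e2 eqxx.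
have nuv (u v c : V) : u != v -> ~~ ((u == c) && (v == c)).
  by move=> uv; apply/negP => /andP[/eqP e1 /eqP e2]; move: uv; rewrite e1 e2 eqxx.
move: (nab x) (nab y) (nab z) (nuv x y a xy) (nuv x y b xy) (nuv x z a xz) (nuv x z b xz)
  (nuv y z a yz) (nuv y z b yz).
rewrite !(eq_sym a) !(eq_sym b).
by case: (x == a); case: (x == b); case: (y == a); case: (y == b); case: (z == a); case: (z == b).
Qed.

End Merge.

(** This is the tree form of the condition that a black triangle contains exactly one white point.
    In a graft, a triple with both [a] and [b] is separated by [w] alone, since its merged triple
    has a repetition; any other triple is separated exactly where its merged triple was. *)
Lemma med_ex T r : uniq (labels T) -> r \notin labels T ->
  forall x y z, x \in r :: leaves T -> y \in r :: leaves T -> z \in r :: leaves T ->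
  uniq [:: x; y; z] -> exists w, [/\ w \in inners T,
    uniq [:: br T w x; br T w y; br T w z] &
    forall w', w' \in inners T -> uniq [:: br T w' x; br T w' y; br T w' z] -> w' = w].
Proof.
move=> U; move: T U r; refine (@graft_ind (fun T => forall r, _) _ _).
  move=> a r.
  move=> _ x y z; rewrite !inE.
  by case/orP=> /eqP->; case/orP=> /eqP->; case/orP=> /eqP->; rewrite /= !inE ?eqxx ?orbT ?andbF.
move=> T' a w b aT UT wT bT IH r.
move=> rg x y z xT yT zT U.
have /and3P[rT rw rb] : [&& r \notin labels T', r != w & r != b].
  by move: rg; rewrite graft_mem aT /= !negb_or.
have Ul := uniq_leaves UT.
have ab : a != b.
  by apply: contraNneq bT => <-; rewrite inE leaves_labels ?orbT.
have lg u : (u \in r :: leaves (graft T' a w b)) = (u == b) || (u \in r :: leaves T').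
  have [s1 [s2 e]] : exists s1 s2, leaves T' = s1 ++ a :: s2.
    by case/splitPr: aT => s1 s2; exists s1, s2.
  by rewrite (graft_leaves _ _ Ul e) e !inE !mem_cat !inE; do !case: (_ == _); rewrite ?orbT.
have bT' : b \notin labels T' by move: bT; rewrite inE negb_or => /andP[].
have ne u : u \in r :: leaves (graft T' a w b) -> u != w.
  rewrite lg inE => /or3P[/eqP->|/eqP->//|uT]; first by move: bT; rewrite inE negb_or => /andP[].
  by apply: contraNneq wT => <-; exact: leaves_labels.
have mi u : (u \in inners (graft T' a w b)) = (u == w) || (u \in inners T').
  by rewrite (perm_mem (graft_inners w b Ul aT)) inE.
have wI u : u \in inners T' -> u != w.
  by move=> uT; apply: contraNneq wT => <-; exact: inners_labels.
have br1 u : br (graft T' a w b) w u = (if u == a then 1 else if u == b then 2 else 0)%N.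
  exact: br_graft_new.
have br2 u v : u \in inners T' -> v != w -> br (graft T' a w b) u v = br T' u (bar a b v).
  by move=> uT vw; apply: br_graft => //; exact: wI.
have barT u : u \in r :: leaves (graft T' a w b) -> bar a b u \in r :: leaves T'.
  by rewrite lg /bar; case: eqP => //= _ _; rewrite inE aT orbT.
have b1 : uniq [:: br (graft T' a w b) w x; br (graft T' a w b) w y;
    br (graft T' a w b) w z] = both a b x y z.
  by rewrite !br1; exact: both_uniq.
have b2 u : u \in inners T' -> uniq [:: br (graft T' a w b) u x; br (graft T' a w b) u y;
    br (graft T' a w b) u z] = uniq [:: br T' u (bar a b x); br T' u (bar a b y); br T' u (bar a b z)].
  by move=> uT; rewrite !br2 ?ne.
have [B|B] := boolP (both a b x y z).
  exists w; split; rewrite ?mi ?eqxx // ?b1 //.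
  move=> w'; rewrite mi => /orP[/eqP//|w'T]; rewrite b2 // => u'.
  have : uniq [:: bar a b x; bar a b y; bar a b z] by exact: (@map_uniq _ _ (br T' w')).
  by rewrite bar_uniq // B.
have Ub : uniq [:: bar a b x; bar a b y; bar a b z] by rewrite bar_uniq.
have [v [vT vU vu]] := IH r rT _ _ _ (barT _ xT) (barT _ yT) (barT _ zT) Ub.
exists v; split; rewrite ?mi ?vT ?orbT //; first by rewrite b2.
move=> w'; rewrite mi => /orP[/eqP->|w'T]; first by rewrite b1 (negPf B).
by rewrite b2 //; exact: vu.
Qed.

End GraftInduction.

(** * Placing the vertices of a tree in the plane *)

Section GeometricRealization.
Variables (R : realType) (V : eqType).
Implicit Types (T : bt V) (a b w x y z r : V) (pos : V -> plane R).

(** A vertex of a convex polygon lies in no triangle of other vertices. A new white point near [a]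
    inherits this, having the same signs as [a] with respect to the lines concerned. *)
Lemma ccw_inT (p : plane R) (l : seq (plane R)) : uniq l -> ccw (p :: l) ->
  {in l & &, forall x y z : plane R, uniq [:: x; y; z] -> ~~ inT p x y z}.
Proof.
move=> U cl.
have nz (x y : plane R) : x \in l -> y \in l -> x != y -> det x y p != 0.
  move=> xl yl xy; rewrite (det_rot p).
  have [s|s] := ordered2 xl yl xy; first by rewrite lt0r_neq0 // (ccw_head cl).
  by rewrite det_swapr oppr_eq0 lt0r_neq0 // (ccw_head cl).
move=> x y z xl yl zl Uxyz; move: xl yl zl Uxyz.
suff H (a b c : plane R) : a \in l -> b \in l -> c \in l -> uniq [:: a; b; c] ->
    a \in l -> b \in l -> c \in l -> ~~ inT p a b c.
  by move=> xl yl zl Uxyz; exact: H.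
apply: (@ordered3 _ (fun a b c : plane R => a \in l -> b \in l -> c \in l -> ~~ inT p a b c)).
- move=> a' b' c' U' IH bl al cl'; move: (IH al bl cl').
  have [ab bc ca] : [/\ a' != b', b' != c' & c' != a'].
    by move: U'; rewrite /= !inE negb_or !andbT (eq_sym c') => /andP[/andP[]].
  by rewrite (@inT_swap _ p a' b' c') //; exact: nz.
- by move=> a' b' c' IH bl cl' al; rewrite inT_rot; exact: IH.
- move=> a' b' c' sub _ _ _; apply/negP.
  have s12 : 0 < det a' b' p.
    rewrite (det_rot p) (ccw_head cl) //; apply: subseq_trans sub.
    by apply/subseqP; exists [:: true; true; false].
  have s13 : 0 < det a' c' p.
    rewrite (det_rot p) (ccw_head cl) //; apply: subseq_trans sub.
    by apply/subseqP; exists [:: true; false; true].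
  have s23 : 0 < det b' c' p.
    rewrite (det_rot p) (ccw_head cl) //; apply: subseq_trans sub.
    by apply/subseqP; exists [:: false; true; true].
  rewrite /inT s12 s23 det_neg ?lt0r_neq0 // s13.
  by [].
Qed.

Definition realizes pos r T := [/\ uniq (map pos (r :: labels T)),
  generic (map pos (r :: labels T)), ccw (map pos (r :: leaves T)) &
  forall w x y z, w \in inners T -> x \in r :: leaves T -> y \in r :: leaves T ->
    z \in r :: leaves T -> uniq [:: x; y; z] ->
    inT (pos w) (pos x) (pos y) (pos z) = uniq [:: br T w x; br T w y; br T w z]].

Lemma uniq_map_inj_in (A B : eqType) (f : A -> B) (s : seq A) :
  uniq (map f s) -> {in s &, injective f}.
Proof.
elim: s => //= u s IH /andP[us U] x y; rewrite !inE => /orP[/eqP->|xs] /orP[/eqP->|ys] // e.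
- by case/negP: us; rewrite e map_f.
- by case/negP: us; rewrite -e map_f.
- exact: IH.
Qed.

Lemma generic_perm (s t : seq (plane R)) : s =i t -> generic s -> generic t.
Proof. by move=> st gs x y z; rewrite -!st; exact: gs. Qed.

Lemma realizes_graft pos r T a w b : uniq (r :: labels T) -> a \in leaves T ->
  w \notin r :: labels T -> b \notin w :: r :: labels T -> realizes pos r T ->
  exists pos', realizes pos' r (graft T a w b).
Proof.
move=> Ur aT wT bT [Upos gpos cpos ipos].
have /andP[rT UT] := Ur; have Ul := uniq_leaves UT.
have [s1 [s2 e]] : exists s1 s2, leaves T = s1 ++ a :: s2.
  by case/splitPr: aT => s1 s2; exists s1, s2.
pose L := s2 ++ r :: s1.
pose l := map pos L; pose ws := map pos (inners T).
have pT := ungraft_perm r e; have pG := graft_perm w b r Ul e; rewrite -/L in pT pG.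
have mE : perm_eq (map pos (r :: labels T)) (pos a :: l ++ ws).
  by rewrite -map_cat -map_cons; exact: perm_map.
have US : uniq (pos a :: l ++ ws) by rewrite -(perm_uniq mE).
have gS : generic (pos a :: l ++ ws) by apply: generic_perm gpos; exact: perm_mem.
have cl : ccw (pos a :: l).
  have -> : pos a :: l = rot (size (map pos (r :: s1))) (map pos (r :: leaves T)).
    by rewrite e -cat_cons map_cat rot_size_cat /l /L map_cat.
  exact: ccw_rot.
have ln : l != [::] by rewrite /l /L; case: (s2).
have [B [W [[UW gW] cW F1 F2 [F3 F4]]]] := split_point US gS cl ln.
have leavesG := graft_leaves w b Ul e.
have [wr wL] : w != r /\ w \notin labels T by move: wT; rewrite inE negb_or => /andP[].
have [bw br_ bL] : [/\ b != w, b != r & b \notin labels T].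
  by move: bT; rewrite !inE !negb_or => /and3P[].
pose pos' v := if v == b then B else if v == w then W else pos v.
have pb : pos' b = B by rewrite /pos' eqxx.
have pw : pos' w = W by rewrite /pos' eq_sym (negPf bw) eqxx.
have po v : v \in r :: labels T -> pos' v = pos v.
  move=> vT; rewrite /pos' ifN ?ifN //; first by apply: contraNneq wT => <-.
  by apply: contraTneq vT => ->; rewrite inE negb_or br_.
have pi v : v \in a :: L ++ inners T -> pos' v = pos v by rewrite -(perm_mem pT); exact: po.
have piL v : v \in L -> pos' v = pos v.
  by move=> vL; apply: pi; rewrite inE mem_cat vL orbT.
have pia : pos' a = pos a by apply: pi; rewrite mem_head.
have mG : map pos' [:: w, b, a & L ++ inners T] = [:: W, B, pos a & l ++ ws].
  rewrite /= pw pb pia /l /ws -map_cat; congr [:: _, _, _ & _].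
  by apply/eq_in_map => v vL; apply: pi; rewrite inE vL orbT.
have pmG : perm_eq (map pos' (r :: labels (graft T a w b))) [:: W, B, pos a & l ++ ws].
  by rewrite -mG; exact: perm_map.
have abne : a != b by apply: contraNneq bL => <-; exact: leaves_labels.
have inj : {in a :: L ++ inners T &, injective pos}.
  by apply: uniq_map_inj_in; rewrite map_cons map_cat.
exists pos'; split.
- by rewrite (perm_uniq pmG).
- by apply: generic_perm gW => q; rewrite (perm_mem pmG).
- rewrite leavesG -cat_cons.
  have -> : (r :: s1) ++ [:: a, b & s2] = rot (size [:: a, b & s2]) ([:: a, b & s2] ++ (r :: s1)).
    by rewrite rot_size_cat.
  rewrite map_rot; apply: ccw_rot.
  have -> : map pos' ([:: a, b & s2] ++ r :: s1) = [:: pos a, B & l]; last exact: cW.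
  rewrite -[_ ++ _]/[:: a, b & L] /= pia pb; congr [:: _, _ & _].
  exact/eq_in_map.
have US' : uniq (a :: L ++ inners T) by rewrite -(perm_uniq pT).
have LS v : v \in L -> v \in a :: L ++ inners T by move=> vL; rewrite inE mem_cat vL orbT.
have IS v : v \in inners T -> v \in a :: L ++ inners T by move=> vL; rewrite inE mem_cat vL !orbT.
have aL v : v \in L -> a != v by move=> vL; apply: contraTneq US' => ->; rewrite /= mem_cat vL.
have bLL v : v \in L -> b != v.
  move=> vL; apply: contraNneq bT => ->; rewrite inE; apply/orP; right.
  by rewrite (perm_mem pT) LS.
have UL : uniq L by move: US'; rewrite cons_uniq cat_uniq => /and3P[_].
have lG v : (v \in r :: leaves (graft T a w b)) = (v \in [:: a, b & L]).
  by rewrite leavesG -[[:: a, b & L]]/([:: a, b & s2] ++ (r :: s1)) -cat_cons mem_cat orbC -mem_cat.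
have cases v : v \in r :: leaves (graft T a w b) -> [\/ v = a, v = b | v \in L].
  by rewrite lG !inE => /or3P[/eqP->|/eqP->|]; [apply: Or31|apply: Or32|apply: Or33].
have ba : b != a by rewrite eq_sym.
have aNL v : v \in L -> (a == v) = false by move=> /aL/negPf.
have bNL v : v \in L -> (b == v) = false by move=> /bLL/negPf.
have neL x y : x \in a :: L ++ inners T -> y \in a :: L ++ inners T -> x != y -> pos x != pos y.
  by move=> xS yS; apply: contra => /eqP/(inj _ _ xS yS)->.
have dS x y z : x \in a :: L ++ inners T -> y \in a :: L ++ inners T ->
    z \in a :: L ++ inners T -> uniq [:: x; y; z] -> det (pos x) (pos y) (pos z) != 0.
  move=> xS yS zS U; apply: gS; rewrite -?map_cat -?map_cons ?map_f //.
  by rewrite (map_inj_in_uniq (s := [:: x; y; z])) // => u v hu hv; apply: inj;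
    [move: hu|move: hv]; rewrite !inE => /or3P[]/eqP->.
move=> w0 x y z; rewrite (perm_mem (graft_inners w b Ul aT)) inE => w0T xT yT zT U.
have wne v : v \in r :: leaves (graft T a w b) -> v != w.
  case/cases=> [->|->|vL]; [|exact: bw|].
    by apply: contraNneq wL => <-; exact: leaves_labels.
  by apply: contraNneq wT => <-; rewrite (perm_mem pT) LS.
(* The new white point lies in a black triangle iff both [a] and [b] are vertices of it, which by
   [both_uniq] is also the condition on branches. *)
case/orP: w0T => [/eqP->|w0T].
  rewrite !br_graft_new // both_uniq // pw {wne}.
  have eab := F3.
  have eba : (0 < det B (pos a) W) = false by rewrite det_neg ?F3 // lt0r_neq0.
  have ebL v : v \in L -> 0 < det B (pos v) W by move=> vL; have [] := F4 (pos v) (map_f _ vL).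
  have eLb v : v \in L -> (0 < det (pos v) B W) = false.
    by move=> vL; rewrite det_neg ?ebL // lt0r_neq0 // ebL.
  have eLa v : v \in L -> 0 < det (pos v) (pos a) W by move=> vL; have [] := F4 (pos v) (map_f _ vL).
  have eaL v : v \in L -> (0 < det (pos a) (pos v) W) = false.
    by move=> vL; rewrite det_neg ?eLa // lt0r_neq0 // eLa.
  have LLL : x \in L -> y \in L -> z \in L ->
      inT W (pos' x) (pos' y) (pos' z) = both a b x y z.
    move=> xL yL zL; rewrite /both !inE !aNL // !piL //.
    have Upl : uniq [:: pos x; pos y; pos z].
      rewrite (map_inj_in_uniq (s := [:: x; y; z])) // => u v hu hv; apply: inj; apply: LS;
      [move: hu|move: hv]; rewrite !inE => /or3P[]/eqP->//.
    move: (Upl); rewrite /= !inE negb_or !andbT => /andP[/andP[xy xz] yz].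
    have zx : pos z != pos x by rewrite eq_sym.
    rewrite /inT !F2 ?map_f //.
    have Upl' : uniq l by move: US; rewrite cons_uniq cat_uniq => /and3P[].
    by have := ccw_inT Upl' cl (map_f pos xL) (map_f pos yL) (map_f pos zL) Upl; rewrite /inT => /negPf.
  move: U; case: (cases x xT) => [->|->|xL]; case: (cases y yT) => [->|->|yL];
    case: (cases z zT) => [->|->|zL];
    try (by rewrite /= !inE ?eqxx ?orbT ?andbF); try (by move=> _; exact: LLL);
    rewrite ?pia ?pb /inT ?piL //= /both ?inE ?eqxx ?(negPf abne) ?(negPf ba) ?aNL ?bNL
      ?eab ?eba ?ebL ?eLb ?eLa ?eaL ?orbT ?orbF ?andbF //=.
    by move=> _; case: (0 < det (pos y) (pos z) W).
  by move=> _; case: (0 < det (pos y) (pos z) W).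
have w0w : w0 != w.
  by apply: contraNneq wL => <-; exact: inners_labels.
have w0S := IS _ w0T.
rewrite (pi w0 w0S) !(br_graft UT aT bL w0w (wne _ _)) // -!/(bar a b _).
have bara : bar a b a = a by rewrite /bar (negPf abne).
have barb : bar a b b = a by rewrite /bar eqxx.
have barL v : v \in L -> bar a b v = v by rewrite /bar => /bLL; rewrite eq_sym => /negPf->.
have w0L v : v \in L -> pos v != pos w0.
  move=> vL; apply: (neL _ _ (LS _ vL) w0S).
  move: US'; rewrite cons_uniq cat_uniq => /and3P[_ _ /andP[/hasPn h _]].
  by apply: contraTneq vL => ->; exact: h.
have w0ws : pos w0 \in l ++ ws by rewrite mem_cat orbC map_f.
have Lws v : v \in L -> pos v \in l ++ ws by move=> vL; rewrite mem_cat map_f.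
(* For an old white point, [B] may be replaced by [pos a] in a determinant that does not involve
   both. *)
have sgn u v : u \in r :: leaves (graft T a w b) -> v \in r :: leaves (graft T a w b) ->
    bar a b u != bar a b v ->
    (0 < det (pos' u) (pos' v) (pos w0)) = (0 < det (pos (bar a b u)) (pos (bar a b v)) (pos w0)).
  case/cases=> [->|->|uL]; case/cases=> [->|->|vL];
    rewrite ?bara ?barb ?(barL u) ?(barL v) // ?eqxx // ?pia ?pb ?(piL u) ?(piL v) // => _.
  - rewrite -(det_rot B) -(det_rot (pos a)).
    exact: (F1 _ _ (Lws _ vL) w0ws (w0L _ vL)).
  - rewrite (det_rot (pos w0)) [in RHS](det_rot (pos w0)).
    by apply: (F1 _ _ w0ws (Lws _ uL)); rewrite eq_sym w0L.
have [bo|bo] := boolP (both a b x y z); last first.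
  have Ub : uniq [:: bar a b x; bar a b y; bar a b z] by rewrite bar_uniq.
  have barT v : v \in r :: leaves (graft T a w b) -> bar a b v \in r :: leaves T.
    case/cases=> [->|->|vL]; rewrite ?bara ?barb; [by rewrite inE aT orbT|by rewrite inE aT orbT|].
    rewrite barL //.
    rewrite e -cat_cons mem_cat [v \in a :: s2]in_cons.
    by move: vL; rewrite /L mem_cat => /orP[->|->]; rewrite ?orbT.
  rewrite -(ipos w0) ?barT //; move: (Ub).
  rewrite /= !inE negb_or !andbT => /andP[/andP[xy xz] yz].
  by rewrite /inT !sgn // eq_sym.
have -> : uniq [:: br T w0 (bar a b x); br T w0 (bar a b y); br T w0 (bar a b z)] = false.
  apply: contraTF bo => h; rewrite -bar_uniq //; exact: (@map_uniq _ _ (br T w0)).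
have eaz v : v \in L -> (0 < det (pos a) (pos v) (pos w0)) = ~~ (0 < det (pos v) (pos a) (pos w0)).
  move=> vL; rewrite det_neg //; apply: (dS _ _ _ (LS _ vL) (mem_head _ _) w0S).
  have vw : v != w0 by apply: contraTneq (w0L _ vL) => ->; rewrite eqxx.
  have aw0 : a != w0 by apply: contraTneq US' => ->; rewrite /= mem_cat w0T orbT.
  by rewrite /= !inE negb_or vw aw0 eq_sym aL.
have ebz v : v \in L -> (0 < det B (pos v) (pos w0)) = (0 < det (pos a) (pos v) (pos w0)).
  move=> vL; have vG : v \in r :: leaves (graft T a w b) by rewrite lG !inE vL !orbT.
  have bG : b \in r :: leaves (graft T a w b) by rewrite lG !inE eqxx orbT.
  by have := sgn _ _ bG vG; rewrite barb barL // pb piL // => ->; rewrite // aL.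
have ezb v : v \in L -> (0 < det (pos v) B (pos w0)) = (0 < det (pos v) (pos a) (pos w0)).
  move=> vL; have vG : v \in r :: leaves (graft T a w b) by rewrite lG !inE vL !orbT.
  have bG : b \in r :: leaves (graft T a w b) by rewrite lG !inE eqxx orbT.
  by have := sgn _ _ vG bG; rewrite barb barL // pb piL // => ->; rewrite // eq_sym aL.
(* An old white point is on the same side of the lines from [pos a] and from [B] to [pos v]. As
   edges of a triangle they are traversed in opposite directions relative to [pos v], so their signs
   differ and the triangle does not contain the point. *)
have tri v : v \in L -> [/\ inT (pos w0) (pos a) B (pos v) = false,
    inT (pos w0) B (pos a) (pos v) = false & [/\ inT (pos w0) (pos a) (pos v) B = false,
    inT (pos w0) B (pos v) (pos a) = false, inT (pos w0) (pos v) (pos a) B = false &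
    inT (pos w0) (pos v) B (pos a) = false]].
  move=> vL; rewrite /inT (ebz _ vL) (ezb _ vL) (eaz _ vL).
  by case: (0 < det (pos v) (pos a) (pos w0)); rewrite /= ?andbF; split=> //; split;
    case: (0 < det _ _ (pos w0)); case: (0 < det _ _ (pos w0)).
have third v : v \in r :: leaves (graft T a w b) -> v != a -> v != b -> v \in L.
  by move=> /cases[->|->|//]; rewrite eqxx.
move: U; rewrite /= !inE negb_or !andbT => /andP[/andP[xy xz] yz].
case: (both_inv abne bo) => [[]|[]|[]] [ex ey]; rewrite ex ey in xy xz yz *.
- have zL : z \in L by apply: third; rewrite // eq_sym.
  by have [t _ _] := tri _ zL; rewrite pia pb piL.
- have zL : z \in L by apply: third; rewrite // eq_sym.
  by have [_ t _] := tri _ zL; rewrite pia pb piL.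
- have yL : y \in L by apply: third; rewrite // eq_sym.
  by have [_ _ [t _ _ _]] := tri _ yL; rewrite pia pb piL.
- have yL : y \in L by apply: third; rewrite // eq_sym.
  by have [_ _ [_ t _ _]] := tri _ yL; rewrite pia pb piL.
- have xL : x \in L by apply: third.
  by have [_ _ [_ _ t _]] := tri _ xL; rewrite pia pb piL.
- have xL : x \in L by apply: third.
  by have [_ _ [_ _ _ t]] := tri _ xL; rewrite pia pb piL.
Qed.

Lemma realizes_ex r T : uniq (labels T) -> r \notin labels T -> exists pos, realizes pos r T.
Proof.
move=> U; move: T U r; refine (@graft_ind _ (fun T => forall r, _) _ _).
  move=> a r; rewrite inE => ra.
  pose pos v : plane R := if v == r then 0 else pt 1 0.
  have pr : pos r = 0 by rewrite /pos eqxx.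
  have pa : pos a = pt 1 0 by rewrite /pos eq_sym (negPf ra).
  exists pos; rewrite /realizes [labels _]/= [leaves _]/= /map pr pa; split=> //.
    rewrite /= inE andbT; apply/eqP => /(congr1 (@cx R)); rewrite !cE => /eqP.
    by rewrite eq_sym oner_eq0.
  move=> p q s; rewrite !inE; case/orP=> /eqP->; case/orP=> /eqP->; case/orP=> /eqP->;
  by rewrite /= !inE ?eqxx ?orbT ?andbF.
move=> T a w b aT UT wT bT IH r; rewrite graft_mem aT /= !negb_or => /and3P[rT rw rb].
have [pos hp] := IH r rT.
have bw : b \notin w :: r :: labels T.
  by move: bT; rewrite !inE !negb_or => /andP[-> ->]; rewrite eq_sym rb.
have wr : w \notin r :: labels T by rewrite inE negb_or eq_sym rw.
by apply: realizes_graft hp => //; rewrite /= rT.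
Qed.

End GeometricRealization.

(** This yields, for each white point, a black triangle with vertex [r] around it, so that it lies
    in the hull of the black points. *)
Lemma lca_ex (V : eqType) (T : bt V) w : uniq (labels T) -> w \in inners T ->
  exists x y, [/\ x \in leaves T, y \in leaves T, x != y & lca T x y = w].
Proof.
elim: T => // v L IHL R IHR U; have Ul := uniq_leaves U.
have [UL UR _ _ _] := uniq_Nd U; rewrite [inners _]/= inE mem_cat.
case/or3P=> [/eqP->|/(IHL UL)[x [y [xL yL xy e]]]|/(IHR UR)[x [y [xR yR xy e]]]].
- have xL := head_leaves L v; have yR := head_leaves R v.
  exists (head v (leaves L)), (head v (leaves R)); split; last exact: lca_lr.
  + by rewrite mem_cat xL.
  + by rewrite mem_cat yR orbT.
  + by apply: contraTneq xL => ->; exact: (uniq_cat_notin Ul).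
- by exists x, y; rewrite ![_ \in leaves _]mem_cat xL yL lca_l.
- by exists x, y; rewrite ![_ \in leaves _]mem_cat xR yR !orbT lca_r.
Qed.

(** * The t-diagram of a tree *)

Section DiagramOfTree.
Variables (R : realType) (d : nat) (G : three_tree) (r : G) (T : bt G) (pos : G -> plane R).
Hypotheses (cardG : #|G| = (2 * d + 4)%N) (hG : unfolding r T) (hpos : realizes pos r T).

Let UT : uniq (r :: labels T). Proof. by case: hG. Qed.
Let cover x : x \in r :: labels T. Proof. by case: hG. Qed.
Let UlT : uniq (labels T). Proof. by case/andP: UT. Qed.

Lemma pos_inj : injective pos.
Proof.
have [U _ _ _] := hpos; move=> x y; apply: (uniq_map_inj_in U); exact: cover.
Qed.

Definition tree_points : {fset plane R} := [fset p in map pos (enum G)]%fset.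

Lemma pos_tree_points v : pos v \in tree_points.
Proof. by rewrite in_fset map_f // mem_enum. Qed.

Definition point_of (v : G) : tree_points := FSetSub (pos_tree_points v).

Lemma point_of_bij : bijective point_of.
Proof.
have h (x : tree_points) : exists v, point_of v = x.
  have := fsvalP x; rewrite in_fset => /mapP[v _ e].
  by exists v; apply: val_inj.
apply: (@Bijective _ _ _ (fun x => sval (cid (h x)))) => v.
  by case: cid => u /= /(congr1 val) /= /pos_inj.
by case: cid.
Qed.

Lemma vertex_of_ex : exists phi : tree_points -> G,
  [/\ bijective phi, forall x, pos (phi x) = fsval x & forall v, phi (point_of v) = v].
Proof.
have [phi pK Kp] := point_of_bij; exists phi; split=> //; first by exists point_of.
by move=> x; rewrite -[in RHS](Kp x).
Qed.

Lemma card_tree_leaves : size (leaves T ++ [:: r]) = (d + 3)%N.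
Proof.
have : size (r :: labels T) = #|G|.
  by rewrite -(card_uniqP UT); apply: eq_card => x; rewrite cover.
rewrite cardG /= (perm_size (labels_perm T)) !size_cat size_leaves /=; lia.
Qed.

Lemma tree_diagram_ex : exists (X : tdiagram R d) (phi : X -> G), characteristic_tree phi.
Proof.
have [phi [bij pE phiK]] := vertex_of_ex; have inj := bij_inj bij.
have [_ gen cw ip] := hpos.
pose black := [set x | leaf (phi x)]%SET.
have bE x : (x \in black) = (phi x \in r :: leaves T).
  by rewrite inE (leaf_leaves hG) mem_cat inE orbC.
have wE x : (x \notin black) = (phi x \in inners T).
  by rewrite inE leafN_inner negbK (inner_inners hG).
have dne (a b c : tree_points) : uniq [:: a; b; c] -> det (fsval a) (fsval b) (fsval c) != 0.
  move=> U; rewrite -!pE; apply: gen; rewrite ?map_f ?cover //.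
  rewrite -[[:: _; _; _]]/(map pos (map phi [:: a; b; c])) !map_inj_uniq //; exact: pos_inj.
have nw (w x : tree_points) : w \notin black -> x \in black -> w != x.
  by move=> wB xB; apply: contraNneq wB => ->.
have tri (w a b c : tree_points) : w \notin black -> a \in black -> b \in black ->
    c \in black -> uniq [:: a; b; c] -> triangle a b c (fsval w) <->
    uniq [:: br T (phi w) (phi a); br T (phi w) (phi b); br T (phi w) (phi c)].
  move=> wB aB bB cB U; rewrite triangle_hull.
  have [ab bc ca] : [/\ a != b, b != c & c != a].
    by move: U; rewrite /= !inE negb_or !andbT (eq_sym c) => /andP[/andP[]].
  have dw x y : x \in black -> y \in black -> x != y -> det (fsval x) (fsval y) (fsval w) != 0.
    by move=> xB yB xy; apply: dne; rewrite /= !inE negb_or xy ![_ == w]eq_sym !nw.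
  rewrite (triangle_inT erefl (dne _ _ _ U) (dw _ _ aB bB ab) (dw _ _ bB cB bc) (dw _ _ cB aB ca)).
  by rewrite -!pE ip -?wE -?bE // (map_inj_uniq inj [:: a; b; c]).
have c1 : #|` tree_points| = (2 * d + 4)%N.
  by rewrite cardfE -cardG; exact: bij_eq_card bij.
have c2 : #|black| = (d + 3)%N.
  rewrite -card_tree_leaves.
  have -> : black = (phi @^-1: [set v | v \in leaves T ++ [:: r]])%SET.
    by apply/setP => x; rewrite !inE (leaf_leaves hG).
  rewrite on_card_preimset; last exact: onW_bij.
  rewrite cardsE; apply/card_uniqP; rewrite cat_uniq uniq_leaves //= orbF andbT.
  by case/andP: UT => rT _; apply: contra rT; exact: leaves_labels.
have c3 (a b c : tree_points) : distinct3 a b c -> ~ collinear (fsval a) (fsval b) (fsval c).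
  by case=> ab ac bc /collinear_det; apply/eqP/dne; rewrite /= !inE negb_or ab ac bc.
(* A supporting line at [a] leaves all other black points in an open half-plane, which is convex and
   does not contain [a]. *)
have c4 a : a \in black -> ~ hull (black :\ a)%SET (fsval a).
  move=> aB ha.
  have Up : uniq (map pos (r :: leaves T)).
    rewrite map_inj_uniq; last exact: pos_inj.
    by rewrite /= uniq_leaves // andbT; case/andP: UT => rT _; apply: contra rT; exact: leaves_labels.
  have aP : fsval a \in map pos (r :: leaves T) by rewrite -pE map_f // -bE.
  have s2 : (1 < size (map pos (r :: leaves T)))%N by rewrite size_map /= size_leaves.
  have [u _ hu] := ccw_support Up cw aP s2.
  have : 0 < det (fsval a) (fsval a + u) (fsval a).
    apply: (@conv_hull_min R _ [set x | 0 < det (fsval a) (fsval a + u) x] _ _ _ ha).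
      apply/convex_setP => x y t /andP[t0 t1] /= hx hy; rewrite det_conv.
      have [->|tn] := eqVneq t 0; first by rewrite mul0r add0r subr0 mul1r.
      apply: ltr_pwDl; first by apply: mulr_gt0 => //; rewrite lt0r tn.
      by apply: mulr_ge0; [rewrite subr_ge0|exact: ltW].
    move=> q [x /= + <-]; rewrite !inE => /andP[xa lx]; apply: hu.
      by rewrite -pE map_f // -bE inE.
    by rewrite (inj_eq (@fsval_inj _ _)).
  by rewrite det_aba ltxx.
have c5 w : w \notin black -> hull black (fsval w).
  rewrite wE => wT; have [x [y [xT yT xy e]]] := lca_ex UlT wT.
  have rx : r != x by case/andP: UT => rT _; apply: contraNneq rT => ->; exact: leaves_labels.
  have ry : r != y by case/andP: UT => rT _; apply: contraNneq rT => ->; exact: leaves_labels.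
  have U : uniq [:: point_of r; point_of x; point_of y].
    by rewrite -(map_inj_uniq inj) /= !phiK !inE negb_or rx ry xy.
  have B v : v \in r :: leaves T -> point_of v \in black by rewrite bE phiK.
  apply: (@hull_mem_mono _ _ [set point_of r; point_of x; point_of y]%SET).
    apply/fintype.subsetP => z; rewrite !inE -orbA => /or3P[]/eqP->;
      by rewrite phiK (leaf_leaves hG) mem_cat inE ?eqxx ?xT ?yT ?orbT.
  apply/(tri w) => //; rewrite ?wE // ?B ?inE ?eqxx ?xT ?yT ?orbT //.
  rewrite !phiK br_out; last by case/andP: UT.
  by rewrite lca_br // e eqxx.
have c6 a b c : a \in black -> b \in black -> c \in black -> distinct3 a b c ->
    exists! w, w \notin black /\ triangle a b c (fsval w).
  move=> aB bB cB [ab ac bc].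
  have U : uniq [:: a; b; c] by rewrite /= !inE negb_or ab ac bc.
  have rT : r \notin labels T by case/andP: UT.
  have Up : uniq [:: phi a; phi b; phi c] by rewrite (map_inj_uniq inj [:: a; b; c]).
  rewrite !bE in aB bB cB.
  have [v [vT vU vu]] := med_ex UlT rT aB bB cB Up.
  rewrite -!bE in aB bB cB.
  have vB : point_of v \notin black by rewrite wE phiK.
  exists (point_of v); split; first by split=> //; apply/(tri _ _ _ _ vB aB bB cB U); rewrite phiK.
  move=> w [wB /(tri _ _ _ _ wB aB bB cB U) wU].
  by apply: inj; rewrite phiK; apply/esym/vu => //; rewrite -wE.
pose X := TDiagram c1 c2 c3 c4 c5 c6.
exists X, phi; split=> //.
- move=> x; case: ifP => xB; first by move: xB; rewrite inE.
  by move/negbT: xB; rewrite wE (inner_inners hG).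
- have [lr hT _ cv] := hG.
  exists (map point_of (leaves T ++ [:: r])); last first.
    rewrite -map_comp map_id_in; last by move=> v _ /=; exact: phiK.
    exact: leaf_cycle_unfolding lr hT UT.
  apply: (@ccw_hull_cycle R d X).
  + rewrite map_inj_uniq; last exact: bij_inj point_of_bij.
    rewrite cat_uniq uniq_leaves //= orbF andbT.
    by case/andP: UT => rT _; apply: contra rT; exact: leaves_labels.
  + move=> x; rewrite [RHS]bE -(mem_map inj) -map_comp map_id_in; last by move=> v _ /=; exact: phiK.
    by rewrite mem_cat !inE orbC.
  + rewrite -map_comp.
    have -> : map (fsval (A := points X) \o point_of) (leaves T ++ [:: r]) = rot 1 (map pos (r :: leaves T)).
      by rewrite -map_rot rot1_cons -cats1; apply: eq_map.
    exact: ccw_rot.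
- move=> w a b c wB aB bB cB /distinct3P U.
  rewrite (tri w a b c wB aB bB cB U); apply: iff_sym; rewrite wE in wB.
  have ne x : x \in black -> phi x != phi w.
    by move=> xB; rewrite (inj_eq inj) eq_sym nw // wE.
  by apply: (three_paths_br hG wB); exact: ne.
Qed.

End DiagramOfTree.

Lemma diagram_ex (R : realType) (d : nat) (G : three_tree) : #|G| = (2 * d + 4)%N ->
  exists (X : tdiagram R d) (phi : X -> G), characteristic_tree phi.
Proof.
move=> cG; have [r lr] : exists r : G, leaf r by apply: leaf_ex; rewrite cG addn4.
have [T hT] := unfolding_ex lr.
have [_ _ /= /andP[rT UT] _] := hT.
have [pos hp] := realizes_ex R UT rT.
exact: tree_diagram_ex cG hT hp.
Qed.

Theorem theorem3p12 (R : realType) (d : nat) :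
  (forall X : tdiagram R d,
     (exists (G : three_tree) (phi : X -> G), characteristic_tree phi) /\
     (forall (G G' : three_tree) (phi : X -> G) (phi' : X -> G'),
        characteristic_tree phi -> characteristic_tree phi' ->
        exists psi : G -> G',
          [/\ graph_iso psi,
              forall x : X, psi (phi x) = phi' x &
              preserves_orders psi \/ reverses_orders psi])) /\
  (forall G : three_tree, #|G| = (2 * d + 4)%N ->
     (exists (X : tdiagram R d) (phi : X -> G), characteristic_tree phi) /\
     (forall (X Y : tdiagram R d) (phi : X -> G) (phi' : Y -> G),
        characteristic_tree phi -> characteristic_tree phi' ->
        equivalent_by_diagonals X Y)).
Proof.
split=> [X|G cG]; split.
- exact: characteristic_ex.
- by move=> G G' phi phi'; exact: characteristic_unique.
- exact: diagram_ex.
- by move=> X Y phi phi'; exact: characteristic_equivalent.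
Qed.
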